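(* Let $a_1,a_2,a_3\in\mathbb Z$ and let $$P_0=-2a_1^3+9a_1a_2-27a_3,\quad Q_0=(a_1^2-3a_2)^3,\quad D_0=-\tfrac1{27}(P_0^2-4Q_0)=a_1^2a_2^2-4a_2^3-4a_1^3a_3-27a_3^2+18a_1a_2a_3.$$ Put $(P_1,Q_1,D_1)=(P_0/2,\,Q_0,\,D_0/4)$ if $2\mid P_0$, and $(P_1,Q_1,D_1)=(P_0,\,4Q_0,\,D_0)$ if $2\nmid P_0$ (these are integers and $P_1^2+27D_1=Q_1$). Let $p>3$ be a prime such that $p\nmid D_0P_0Q_0$. Then the following statements are equivalent (statement (ii) being included when $D_1$ is not a perfect square, so that $H(4D_1)$ is defined): (i) $x^3+a_1x^2+a_2x+a_3\equiv 0\pmod p$ has three solutions; (ii) $p$ is represented by some class in $G(P_1,D_1)$, where $$G(P_1,D_1)=\Big\{[a,2b,c]\in H(4D_1)\ \Big|\ (a,3D_1Q_1)=1,\ \Big(\frac{P_1-3b(1+2\omega)}a\Big)_3=1\Big\}$$ (with $a>0$ when $D_1<0$); (iii) $p\mid u_{p-2}(a_1,a_2,a_3)$; (iv) $p\mid u_p(0,\,-3(a_1^2-3a_2),\,2a_1^3-9a_1a_2+27a_3)$; (v) $s_{p+1}(a_1,a_2,a_3)\equiv a_1^2-2a_2\pmod p$; (vi) $p\mid U_{(p-(\frac p3))/3}(P_0,Q_0)$; (vii) $V_{(p-(\frac p3))/3}(P_0,Q_0)\equiv 2(a_1^2-3a_2)^{(1-(\frac p3))/2}\pmod p$. Moreover,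 if $p\nmid P_0^2-3Q_0$, then statements (i)–(vii) are equivalent to (viii) $\displaystyle\sum_{k=1}^{[p/3]}\binom{3k}k\Big(\frac{P_0^2}{27Q_0}\Big)^k\equiv 0\pmod p$; and if $a_1=0$, statements (i)–(vii) are equivalent to (ix) $p\mid u_p(0,a_2,a_3)$.
   Context: Solutions of congruences are counted as residue classes modulo $p$. $(\frac{\cdot}{p})$ is the Legendre symbol (so $(\frac p3)=\pm1$ with $(\frac p3)\equiv p \pmod 3$), $[\alpha]$ is the greatest integer not exceeding $\alpha$, and $(m,n)$ is the greatest common divisor. A congruence modulo $p$ between rational numbers whose denominators are prime to $p$ is understood in the ring of $p$-integral rationals. Sequences. For numbers $b,c$: $U_n=U_n(b,c)$, $V_n=V_n(b,c)$ are given by $U_0=0$, $U_1=1$, $U_{n+1}=bU_n-cU_{n-1}$ and $V_0=2$, $V_1=b$, $V_{n+1}=bV_n-cV_{n-1}$ ($n\ge1$). For $b_1,b_2,b_3\in\mathbb Z$, $u_n=u_n(b_1,b_2,b_3)$ is given by $u_{-2}=u_{-1}=0$, $u_0=1$, $u_{n+3}+b_1u_{n+2}+b_2u_{n+1}+b_3u_n=0$ ($n\ge-2$), and $s_n=s_n(b_1,b_2,b_3)$ by $s_0=3$, $s_1=-b_1$, $s_2=b_1^2-2b_2$, $s_{n+3}+b_1s_{n+2}+b_2s_{n+1}+b_3s_n=0$ ($n\ge0$). Binary quadratic forms. For integers $A,B,C$, $(A,B,C)$ denotes the form $Ax^2+Bxy+Cy^2$, of discriminant $B^2-4AC$; it is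 primitive if $\gcd(A,B,C)=1$. Two forms are equivalent if they are related by a substitution in $SL_2(\mathbb Z)$, and $[A,B,C]$ is the equivalence class of $(A,B,C)$. For a nonsquare integer $\Delta\equiv0,1\pmod4$, $H(\Delta)$ is the form class group (under Gauss composition) of classes of primitive integral binary quadratic forms of discriminant $\Delta$ (positive definite forms if $\Delta<0$). A positive integer $n$ is represented by a class if $n=Ax^2+Bxy+Cy^2$ for some $x,y\in\mathbb Z$, for one (equivalently every) form $(A,B,C)$ in the class. Every class of $H(4D)$ contains a form $(a,2b,c)$ with $b^2-ac=D$ and $a$ prime to any given positive integer; a class belongs to the set $G$ if it contains a form $(a,2b,c)$ satisfying the stated conditions. Cubic Jacobi symbol. Let $\omega=(-1+\sqrt{-3})/2$ and $N(a+b\omega)=a^2-ab+b^2$. An element $a+b\omega\in\mathbb Z[\omega]$ is primary if $a\equiv2\pmod3$ and $3\mid b$. For a primary prime $\pi\in\mathbb Z[\omega]$ and $\alpha\in\mathbb Z[\omega]$, $\big(\frac{\alpha}{\pi}\big)_3=0$ if $\pi\mid\alpha$, and otherwise $\big(\frac{\alpha}{\pi}\big)_3=\omega^i$ where $\alpha^{(N(\pi)-1)/3}\equiv\omega^i\pmod\pi$. If $\beta=a+b\omega$ with $3\nmid a$, $3\mid b$ and $N(\beta)>1$, write $\beta=\pm\pi_1\cdots\pi_r$ with primary primes $\pi_j$ and put $\big(\frac{\alpha}{\beta}\big)_3=\prod_j\big(\frac{\alpha}{\pi_j}\big)_3$; also $\big(\frac{\alpha}{\pm1}\big)_3=1$.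 *)

(* Defs.v *)
From HB Require Import structures.
From mathcomp Require Import all_boot all_order all_algebra.
From mathcomp Require Import boolp classical_sets.
From mathcomp Require Import ring.

Set Implicit Arguments.
Unset Strict Implicit.
Unset Printing Implicit Defensive.

Import GRing.Theory.
Local Open Scope ring_scope.

Definition legendre (a : int) (q : nat) : int :=
  if (q%:Z %| a)%Z then 0
  else if [exists x : 'F_q, x ^+ 2 == a%:~R] then 1 else -1.

Fixpoint lucasU (b c : int) (n : nat) : int :=
  if n is n1.+1 then
    if n1 is n2.+1 then b * lucasU b c n1 - c * lucasU b c n2 else 1
  else 0.

Fixpoint lucasV (b c : int) (n : nat) : int :=
  if n is n1.+1 then
    if n1 is n2.+1 then b * lucasV b c n1 - c * lucasV b c n2 else b
  else 2.

(* The sequence u starts at index -2; [cubicU_from_m2 n] is u_(n-2). *)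
Fixpoint cubicU_from_m2 (b1 b2 b3 : int) (n : nat) : int :=
  if n is n1.+1 then
    if n1 is n2.+1 then
      if n2 is n3.+1 then
        - b1 * cubicU_from_m2 b1 b2 b3 n1 - b2 * cubicU_from_m2 b1 b2 b3 n2
        - b3 * cubicU_from_m2 b1 b2 b3 n3
      else 1
    else 0
  else 0.

Definition cubicU (b1 b2 b3 : int) (n : nat) : int :=
  cubicU_from_m2 b1 b2 b3 n.+2.

Fixpoint cubicS (b1 b2 b3 : int) (n : nat) : int :=
  if n is n1.+1 then
    if n1 is n2.+1 then
      if n2 is n3.+1 then
        - b1 * cubicS b1 b2 b3 n1 - b2 * cubicS b1 b2 b3 n2
        - b3 * cubicS b1 b2 b3 n3
      else b1 ^+ 2 - 2 * b2
    else - b1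
  else 3.

(* The congruence x = y mod p in the ring of p-integral rationals. *)
Definition p_integral (p : nat) (x : rat) : Prop := coprimez p%:Z (denq x).

Definition rat_congr (p : nat) (x y : rat) : Prop :=
  exists2 r : rat, p_integral p r & x - y = p%:R * r.

Record qform := QForm { qA : int; qB : int; qC : int }.

Definition qeval (f : qform) (x y : int) : int :=
  qA f * x ^+ 2 + qB f * x * y + qC f * y ^+ 2.

Definition qdisc (f : qform) : int := qB f ^+ 2 - 4 * qA f * qC f.

Definition qprimitive (f : qform) : Prop :=
  gcdz (gcdz (qA f) (qB f)) (qC f) = 1.

Definition qposdef (f : qform) : Prop :=
  forall x y : int, (x, y) <> (0, 0) -> 0 < qeval f x y.

(* An integral binary quadratic form is determined by its values on Z^2, so the
   last condition says that g is obtained from f by the substitution. *)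
Definition qequiv (f g : qform) : Prop :=
  exists r s t u : int,
    r * u - s * t = 1 /\
    forall x y : int, qeval g x y = qeval f (r * x + s * y) (t * x + u * y).

Definition qclass (f : qform) : set qform := qequiv f.

(* The underlying set of the form class group H(Delta); composition of classes
   is not needed here. *)
Definition form_classes (Delta : int) : set (set qform) :=
  fun K => exists f : qform,
    [/\ qprimitive f, qdisc f = Delta, Delta < 0 -> qposdef f & K = qclass f].

Definition class_represents (K : set qform) (n : int) : Prop :=
  exists2 f, K f & exists x y : int, n = qeval f x y.

(* The ring Z[omega], with [Eis a b] standing for a + b * omega and
   multiplication given by omega ^ 2 = -1 - omega. *)
Record eis := Eis { eis1 : int; eisw : int }.

Definition eis_pair (x : eis) : int * int := (eis1 x, eisw x).
Definition pair_eis (u : int * int) : eis := Eis u.1 u.2.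
Lemma eis_pairK : cancel eis_pair pair_eis. Proof. by case. Qed.

HB.instance Definition _ := Countable.copy eis (can_type eis_pairK).

Definition eis_add (x y : eis) := Eis (eis1 x + eis1 y) (eisw x + eisw y).
Definition eis_opp (x : eis) := Eis (- eis1 x) (- eisw x).
Definition eis_mul (x y : eis) :=
  Eis (eis1 x * eis1 y - eisw x * eisw y)
      (eis1 x * eisw y + eisw x * eis1 y - eisw x * eisw y).

Lemma eis_addA : associative eis_add.
Proof. by move=> [? ?] [? ?] [? ?]; rewrite /eis_add /= !addrA. Qed.
Lemma eis_addC : commutative eis_add.
Proof. by move=> [a b] [c d]; rewrite /eis_add /= addrC [b + d]addrC. Qed.
Lemma eis_add0 : left_id (Eis 0 0) eis_add.
Proof. by move=> [? ?]; rewrite /eis_add /= !add0r. Qed.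
Lemma eis_addN : left_inverse (Eis 0 0) eis_opp eis_add.
Proof. by move=> [? ?]; rewrite /eis_add /= !addNr. Qed.

HB.instance Definition _ :=
  GRing.isZmodule.Build eis eis_addA eis_addC eis_add0 eis_addN.

Lemma eis_mulA : associative eis_mul.
Proof. by move=> [? ?] [? ?] [? ?]; rewrite /eis_mul /=; congr Eis; ring. Qed.
Lemma eis_mulC : commutative eis_mul.
Proof. by move=> [? ?] [? ?]; rewrite /eis_mul /=; congr Eis; ring. Qed.
Lemma eis_mul1 : left_id (Eis 1 0) eis_mul.
Proof. by move=> [? ?]; rewrite /eis_mul /=; congr Eis; ring. Qed.
Lemma eis_mulDl : left_distributive eis_mul +%R.
Proof.
move=> [a b] [c d] [e f].
by rewrite /GRing.add /= /eis_mul /eis_add /=; congr Eis; ring.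
Qed.
Lemma eis_1neq0 : Eis 1 0 != 0. Proof. by []. Qed.

HB.instance Definition _ := GRing.Zmodule_isComNzRing.Build eis
  eis_mulA eis_mulC eis_mul1 eis_mulDl eis_1neq0.

Definition omega : eis := Eis 0 1.

Lemma omega_eq : omega ^+ 2 + omega + 1 = 0. Proof. by []. Qed.

Definition eis_norm (x : eis) : int :=
  eis1 x ^+ 2 - eis1 x * eisw x + eisw x ^+ 2.

Definition eis_dvd (x y : eis) : Prop := exists z : eis, y = z * x.

Definition eis_prime (x : eis) : Prop :=
  [/\ x <> 0, ~ eis_dvd x 1 &
      forall y z : eis, eis_dvd x (y * z) -> eis_dvd x y \/ eis_dvd x z].

Definition eis_primary (x : eis) : Prop :=
  (eis1 x = 2 %[mod 3])%Z /\ (3 %| eisw x)%Z.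

Definition cubic_residue (alpha pi : eis) : eis :=
  if `[< eis_dvd pi alpha >] then 0
  else xget 0 (fun z : eis => exists2 i : nat, z = omega ^+ i &
    eis_dvd pi (alpha ^+ `|((eis_norm pi - 1) %/ 3)%Z|%N - omega ^+ i)).

(* The factorization of beta is unique up to order, so the value does not depend
   on the choice made by [xget]; the empty factorization gives 1 for
   beta = 1 or -1. When beta has no such factorization the value is 0. *)
Definition cubic_jacobi (alpha beta : eis) : eis :=
  xget 0 (fun z : eis => exists s : seq eis,
    [/\ forall pi, pi \in s -> eis_prime pi /\ eis_primary pi,
        beta = \prod_(pi <- s) pi \/ beta = - \prod_(pi <- s) pi &
        z = \prod_(pi <- s) cubic_residue alpha pi]).

Definition Gset (P D Q : int) : set (set qform) :=
  fun K => form_classes (4 * D) K /\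
    exists a b c : int,
      [/\ K (QForm a (2 * b) c), D < 0 -> 0 < a, coprimez a (3 * D * Q) &
          cubic_jacobi (P%:~R - 3 * b%:~R * (1 + 2 * omega)) a%:~R = 1].

Definition cubP0 (a1 a2 a3 : int) : int := - 2 * a1 ^+ 3 + 9 * a1 * a2 - 27 * a3.
Definition cubQ0 (a1 a2 : int) : int := (a1 ^+ 2 - 3 * a2) ^+ 3.
Definition cubD0 (a1 a2 a3 : int) : int :=
  a1 ^+ 2 * a2 ^+ 2 - 4 * a2 ^+ 3 - 4 * a1 ^+ 3 * a3 - 27 * a3 ^+ 2
  + 18 * a1 * a2 * a3.

Definition cubP1 (a1 a2 a3 : int) : int :=
  if (2 %| cubP0 a1 a2 a3)%Z then (cubP0 a1 a2 a3 %/ 2)%Z else cubP0 a1 a2 a3.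
Definition cubQ1 (a1 a2 a3 : int) : int :=
  if (2 %| cubP0 a1 a2 a3)%Z then cubQ0 a1 a2 else 4 * cubQ0 a1 a2.
Definition cubD1 (a1 a2 a3 : int) : int :=
  if (2 %| cubP0 a1 a2 a3)%Z then (cubD0 a1 a2 a3 %/ 4)%Z else cubD0 a1 a2 a3.

Lemma cubD0E (a1 a2 a3 : int) :
  - 27 * cubD0 a1 a2 a3 = cubP0 a1 a2 a3 ^+ 2 - 4 * cubQ0 a1 a2.
Proof. by rewrite /cubD0 /cubP0 /cubQ0; ring. Qed.

Lemma cubP1_exact (a1 a2 a3 : int) :
  (2 %| cubP0 a1 a2 a3)%Z -> cubP0 a1 a2 a3 = cubP1 a1 a2 a3 * 2.
Proof. by rewrite /cubP1 => P0even; rewrite P0even divzK. Qed.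

Lemma cubD1_exact (a1 a2 a3 : int) :
  (2 %| cubP0 a1 a2 a3)%Z -> cubD0 a1 a2 a3 = cubD1 a1 a2 a3 * 4.
Proof.
rewrite /cubD1 => P0even; rewrite P0even divzK //.
have/dvdzP[m P0E] := P0even.
rewrite -(@Gauss_dvdzr 4 27) //; apply/dvdzP; exists (cubQ0 a1 a2 - m ^+ 2).
have -> : 27 * cubD0 a1 a2 a3 = - (cubP0 a1 a2 a3 ^+ 2 - 4 * cubQ0 a1 a2) by rewrite -cubD0E; ring.
by rewrite P0E; ring.
Qed.

Lemma cubQ1E (a1 a2 a3 : int) :
  cubP1 a1 a2 a3 ^+ 2 + 27 * cubD1 a1 a2 a3 = cubQ1 a1 a2 a3.
Proof.
have D0E := cubD0E a1 a2 a3; case P0even: (2 %| cubP0 a1 a2 a3)%Z; last first.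
  rewrite /cubP1 /cubD1 /cubQ1 P0even.
  have -> : 27 * cubD0 a1 a2 a3 = - (- 27 * cubD0 a1 a2 a3) by ring.
  by rewrite D0E; ring.
rewrite /cubQ1 P0even; apply: (@mulfI _ (4 : int)) => //.
have -> : 4 * cubQ0 a1 a2 = cubP0 a1 a2 a3 ^+ 2 - (- 27 * cubD0 a1 a2 a3) by rewrite D0E; ring.
by rewrite (cubP1_exact P0even) (cubD1_exact P0even); ring.
Qed.

(* Main.v *)
Require Import Defs.
From mathcomp Require Import all_boot all_order all_algebra all_field.
From mathcomp Require Import boolp classical_sets.
From mathcomp Require Import ring zify.

(** The cubic has three distinct roots x1, x2, x3 in an algebraic closure of
    the prime field, and Frobenius permutes them (frobenius_roots): the
    congruence has three solutions exactly when this permutation is the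
    identity (splits_fixed). All criteria are tests of whether the permutation
    is the identity.

    The criteria on recurring sequences. By the closed forms of u_n and s_n,
    the tested term is, up to a nonzero factor, a polynomial in the roots x_i
    and their images under the permutation. For a transposition or a 3-cycle
    it differs from its value at the identity by a product of factors of D0,
    P0 and Q0 and of numbers prime to p. For the Lucas sequences, the roots of
    X^2 - P0 X + Q0 are the cubes of the Lagrange resolvents L1 = x1 + w x2 +
    w^2 x3 and L2, and the index (p - (p/3))/3 turns their powers into L^(p-1)
    or L^(p+1) (frob_resolvents). The sum of binomial coefficients is, modulo
    p, a Lucas number of index 2 [p/3] + 1 divided by a power of - Q0
    (central_bin_sum), and the same resolvents decide it.

    The class group criterion. If b^2 = D1 modulo p, then P1 + 3b sqrt(-3) and
    P1 - 3b sqrt(-3) are, in some order, proportional modulo p to L1^3 and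
    L2^3, so that the cubic splits exactly when the symbol of P1 - 3b(1 + 2
    omega) at p is 1 (splits_symbol). When it does, (p, 2b, (b^2 - D1)/p) is a
    form of the set G representing p. Conversely let (a, 2b, c) be a form of G
    representing p. Then a p is X^2 - D1 y^2 for suitable X and y, and the
    point is that the symbol of y P1 - 3X sqrt(-3) at such a value is always 1
    (form_symbol); it is the product of the symbol at a, which is 1 by
    assumption, and of the symbol at p.

    This last fact is a reciprocity: the norm of the element is y^2 Q1 + 27 n
    for n = a p, so n is congruent to - y^2 Q1 up to a cube modulo the norm,
    and Q1 is a cube or four times a cube. It therefore suffices that the
    symbol of a fixed Eisenstein integer x, congruent to 1 or -1 modulo 3, at
    a rational integer n prime to 3 N(x) only depends on n modulo N(x)
    (symbol_reciprocity), with supplements for factors sqrt(-3) and omega of x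
    (symbol_reciprocity9) and for the prime 3 (symbol_inverse3). Reciprocity
    is reduced to prime factors of x. Above a rational prime l = 1 mod 3 these
    are the Jacobi sums of the cubic characters of l, for which the statement
    follows by computing the q-th power of a cubic Gauss sum in characteristic
    q in two ways (local_symbol_jacobi). The symbols at rational moduli are
    tied to the cubic Jacobi symbol, defined through factorizations into
    primary primes, by prod_cubic_residue. *)

Set Implicit Arguments.
Unset Strict Implicit.
Unset Printing Implicit Defensive.

Import Order.TTheory GRing.Theory Num.Theory.
Local Open Scope ring_scope.

(** * Characteristic p and the closure of the prime field *)

(** An algebraic closure supplies, besides the roots of the cubic, the
    primitive cube roots of unity and the l-th roots of unity that Gauss sums
    need. *)
Definition Fbar (q : nat) : closedFieldType :=
  tag (countable_algebraic_closure 'F_q).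

Definition Fp_to_Fbar (q : nat) : {rmorphism 'F_q -> Fbar q} :=
  sval (tagged (countable_algebraic_closure 'F_q)).

Lemma Fbar_pchar (q : nat) : prime q -> q \in [pchar Fbar q].
Proof. by move=> q_pr; rewrite (fmorph_pchar (Fp_to_Fbar q)) pchar_Fp. Qed.

Section CharP.
Variables (p : nat) (K : fieldType).
Hypothesis chK : p \in [pchar K].

Lemma exprDp (x y : K) : (x + y) ^+ p = x ^+ p + y ^+ p.
Proof. exact: (rmorphD (pFrobenius_aut chK)). Qed.

Lemma exprBp (x y : K) : (x - y) ^+ p = x ^+ p - y ^+ p.
Proof. exact: (rmorphB (pFrobenius_aut chK)). Qed.

Lemma expr_intp (z : int) : (z%:~R : K) ^+ p = z%:~R.
Proof. exact: (rmorph_int (pFrobenius_aut chK)). Qed.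

Lemma expr_sump (I : finType) (F : I -> K) :
  (\sum_i F i) ^+ p = \sum_i F i ^+ p.
Proof. exact: (rmorph_sum (pFrobenius_aut chK)). Qed.

Lemma intr_eq0p (z : int) : ((z%:~R : K) == 0) = (p%:Z %| z)%Z.
Proof. by rewrite (dvdz_pcharf chK). Qed.

Lemma intr_eqp (x y : int) :
  ((x%:~R : K) == y%:~R) = (x == y %[mod p%:Z])%Z.
Proof. by rewrite eqz_mod_dvd -intr_eq0p rmorphB subr_eq0. Qed.

Lemma natr_neq0p (m : nat) : (0 < m < p)%N -> (m%:R : K) != 0.
Proof.
case/andP=> m0 mp; rewrite -(dvdn_pcharf chK); apply/negP => /(dvdn_leq m0).
by rewrite leqNgt mp.
Qed.

End CharP.

Section FrobeniusFixed.
Variables (p : nat).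
Hypothesis p_pr : prime p.
Local Notation K := (Fbar p).
Local Notation iota := (Fp_to_Fbar p).

Lemma Fp_fixed (y : 'F_p) : iota y ^+ p = iota y.
Proof. by have := expf_card y; rewrite card_Fp // -rmorphXn => ->. Qed.

(** 'X^p - 'X already has the p images of 'F_p among its roots, and its degree
    leaves no room for another one. *)
Lemma fixed_Fp (x : K) : x ^+ p = x -> exists y : 'F_p, x = iota y.
Proof.
move=> xp; have p_gt1 := prime_gt1 p_pr.
have sz : size ('X^p - 'X : {poly K}) = p.+1.
  by rewrite size_polyDl size_polyXn // size_polyN size_polyX.
have nz : 'X^p - 'X != 0 :> {poly K} by rewrite -size_poly_eq0 sz.
have rt z : z ^+ p = z -> root ('X^p - 'X : {poly K}) z.
  by move=> zp; rewrite /root !hornerE zp subrr.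
case: (boolP (x \in [seq iota y | y : 'F_p])) => [/codomP[y ->]|xN].
  by exists y.
have := @max_poly_roots _ ('X^p - 'X) (x :: [seq iota y | y : 'F_p]) nz.
rewrite sz /= xN size_map -cardE card_Fp // ltnn rt //=.
have -> : all (root ('X^p - 'X)) [seq iota y | y : 'F_p].
  by apply/allP=> _ /codomP[y ->]; apply/rt/Fp_fixed.
by rewrite map_inj_uniq ?enum_uniq; [move=> /(_ isT isT)|apply: fmorph_inj].
Qed.

End FrobeniusFixed.

(** * Frobenius on the roots of the cubic *)

Definition splits_mod (p : nat) (a1 a2 a3 : int) : Prop :=
  #|[pred x : 'F_p |
      x ^+ 3 + a1%:~R * x ^+ 2 + a2%:~R * x + a3%:~R == 0]| = 3%N.

Definition cubic_roots (K : fieldType) (a1 a2 a3 : int) (x1 x2 x3 : K) :=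
  [/\ a1%:~R = - (x1 + x2 + x3), a2%:~R = x1 * x2 + x2 * x3 + x3 * x1,
      a3%:~R = - (x1 * x2 * x3)
    & [/\ x1 != x2, x2 != x3 & x3 != x1]].

Lemma cubic_rootsC (K : fieldType) (a1 a2 a3 : int) (x1 x2 x3 : K) :
  cubic_roots a1 a2 a3 x1 x2 x3 -> cubic_roots a1 a2 a3 x2 x3 x1.
Proof.
by rewrite /cubic_roots => -[-> -> -> [d12 d23 d31]]; split=> //; ring.
Qed.

Lemma cubic_rootsS (K : fieldType) (a1 a2 a3 : int) (x1 x2 x3 : K) :
  cubic_roots a1 a2 a3 x1 x2 x3 -> cubic_roots a1 a2 a3 x1 x3 x2.
Proof.
rewrite /cubic_roots => -[-> -> -> [d12 d23 d31]]; split; try ring.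
by split; rewrite eq_sym.
Qed.

Lemma cubic_factor (K : fieldType) (a1 a2 a3 : int) (x1 x2 x3 x : K) :
  cubic_roots a1 a2 a3 x1 x2 x3 ->
  x ^+ 3 + a1%:~R * x ^+ 2 + a2%:~R * x + a3%:~R
    = (x - x1) * (x - x2) * (x - x3).
Proof. by case=> -> -> -> _; ring. Qed.

Lemma cubic_rootsP (K : fieldType) (a1 a2 a3 : int) (x1 x2 x3 x : K) :
  cubic_roots a1 a2 a3 x1 x2 x3 ->
  (x ^+ 3 + a1%:~R * x ^+ 2 + a2%:~R * x + a3%:~R == 0)
    = (x \in [:: x1; x2; x3]).
Proof.
move/cubic_factor=> ->.
by rewrite !mulf_eq0 !subr_eq0 !inE orbA.
Qed.

Lemma cubic_roots_uniq (K : fieldType) (a1 a2 a3 : int) (x1 x2 x3 : K) :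
  cubic_roots a1 a2 a3 x1 x2 x3 -> uniq [:: x1; x2; x3].
Proof.
case=> _ _ _ [d12 d23 d31] /=.
by rewrite !inE negb_or d12 d23 eq_sym d31.
Qed.

(** The discriminant is the square of the product of the differences of the
    roots, so it cannot vanish unless two of them coincide. *)
Lemma cubic_roots_exist (K : closedFieldType) (a1 a2 a3 : int) :
  ((cubD0 a1 a2 a3)%:~R : K) != 0 ->
  exists x1 x2 x3 : K, cubic_roots a1 a2 a3 x1 x2 x3.
Proof.
move=> D0.
have [x1 x1E] := @GRing.solve_monicpoly K 3
  (fun i => nth 0 [:: - a3%:~R; - a2%:~R; - a1%:~R] i) isT.
have [x2 x2E] := @GRing.solve_monicpoly K 2
  (fun i => nth 0 [:: - (a2%:~R + a1%:~R * x1 + x1 ^+ 2); - (a1%:~R + x1)] i)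
  isT.
move: x1E x2E; rewrite !big_ord_recr !big_ord0 /= => x1E x2E.
have a3E : a3%:~R = - x1 ^+ 3 - a1%:~R * x1 ^+ 2 - a2%:~R * x1 :> K.
  by rewrite x1E; ring.
have a2E : a2%:~R =
    - x2 ^+ 2 - (a1%:~R + x1) * x2 - a1%:~R * x1 - x1 ^+ 2 :> K.
  by rewrite x2E; ring.
pose x3 := - (a1%:~R + x1 + x2).
exists x1, x2, x3.
have a1E : a1%:~R = - (x1 + x2 + x3) by rewrite /x3; ring.
have a2E' : a2%:~R = x1 * x2 + x2 * x3 + x3 * x1 by rewrite a2E a1E; ring.
have a3E' : a3%:~R = - (x1 * x2 * x3) by rewrite a3E a2E' a1E; ring.
split=> //.
have DE : (cubD0 a1 a2 a3)%:~R
    = ((x1 - x2) * (x2 - x3) * (x3 - x1)) ^+ 2 :> K.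
  have -> : (cubD0 a1 a2 a3)%:~R = a1%:~R ^+ 2 * a2%:~R ^+ 2 - 4 * a2%:~R ^+ 3
      - 4 * a1%:~R ^+ 3 * a3%:~R - 27 * a3%:~R ^+ 2
      + 18 * a1%:~R * a2%:~R * a3%:~R :> K by rewrite /cubD0; ring.
  by rewrite a1E a2E' a3E'; ring.
by split; apply: contraNneq D0 => e; rewrite DE e; apply/eqP; ring.
Qed.

(** A permutation of three letters is the identity, a transposition or a
    3-cycle; after renaming the roots it is one of these three. *)
Variant frob_spec (p : nat) (a1 a2 a3 : int) (x1 x2 x3 : Fbar p) : Prop :=
  | FrobId of splits_mod p a1 a2 a3 & x1 ^+ p = x1 & x2 ^+ p = x2
      & x3 ^+ p = x3
  | FrobSwap of ~ splits_mod p a1 a2 a3 & x1 ^+ p = x1 & x2 ^+ p = x3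
      & x3 ^+ p = x2
  | FrobCycle of ~ splits_mod p a1 a2 a3 & x1 ^+ p = x2 & x2 ^+ p = x3
      & x3 ^+ p = x1.

Section Trichotomy.
Variables (p : nat) (a1 a2 a3 : int).
Hypothesis p_pr : prime p.
Local Notation K := (Fbar p).
Local Notation iota := (Fp_to_Fbar p).
Let chK := Fbar_pchar p_pr.

(** The fixed points of Frobenius are the elements of the prime field, and
    three solutions in 'F_p exhaust the three roots. *)
Lemma splits_fixed (x1 x2 x3 : K) : cubic_roots a1 a2 a3 x1 x2 x3 ->
  splits_mod p a1 a2 a3 <-> [/\ x1 ^+ p = x1, x2 ^+ p = x2 & x3 ^+ p = x3].
Proof.
move=> rts; pose Rt := [pred x : 'F_p |
      x ^+ 3 + a1%:~R * x ^+ 2 + a2%:~R * x + a3%:~R == 0].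
have RtE x : (x \in Rt) = (iota x \in [:: x1; x2; x3]).
  rewrite -(cubic_rootsP _ rts) inE -(fmorph_eq0 iota).
  by rewrite !(rmorphD, rmorphM, rmorphXn, rmorph_int).
split=> [card3|[/(fixed_Fp p_pr)[y1 e1] /(fixed_Fp p_pr)[y2 e2]
                /(fixed_Fp p_pr)[y3 e3]]].
  have sub : {subset map iota (enum Rt) <= [:: x1; x2; x3]}.
    by move=> x /mapP[y yR ->]; rewrite -RtE -mem_enum.
  have Us : uniq (map iota (enum Rt)).
    by rewrite map_inj_uniq ?enum_uniq //; apply: fmorph_inj.
  have sz : (size [:: x1; x2; x3] <= size (map iota (enum Rt)))%N.
    by rewrite size_map -cardE; move: card3; rewrite /splits_mod => ->.
  have [_ eqm] := uniq_min_size Us sub sz.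
  have fx x : x \in [:: x1; x2; x3] -> x ^+ p = x.
    by rewrite -eqm => /mapP[y _ ->]; apply: Fp_fixed.
  by split; apply: fx; rewrite !inE eqxx ?orbT.
have mE : Rt =i [:: y1; y2; y3].
  move=> x; rewrite RtE e1 e2 e3.
  by rewrite -[[:: iota y1; iota y2; iota y3]]/(map iota [:: y1; y2; y3])
     mem_map //; apply: fmorph_inj.
rewrite /splits_mod (eq_card mE); apply/card_uniqP.
have := cubic_roots_uniq rts; rewrite e1 e2 e3.
by rewrite -[[:: iota y1; iota y2; iota y3]]/(map iota [:: y1; y2; y3])
     map_inj_uniq //; apply: fmorph_inj.
Qed.

Lemma frobenius_roots : ~~ (p%:Z %| cubD0 a1 a2 a3)%Z ->
  exists x1 x2 x3 : K,
    cubic_roots a1 a2 a3 x1 x2 x3 /\ frob_spec a1 a2 a3 x1 x2 x3.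
Proof.
rewrite -(intr_eq0p chK) => /cubic_roots_exist[x1 [x2 [x3 rts]]].
have := splits_fixed rts.
have stable x : x \in [:: x1; x2; x3] -> x ^+ p \in [:: x1; x2; x3].
  rewrite -!(cubic_rootsP _ rts) => /eqP e.
  have := congr1 (fun z => z ^+ p) e; rewrite /= expr0n.
  rewrite !(exprDp chK) !exprMn !(expr_intp chK) => xpE.
  by apply/eqP/(etrans xpE); rewrite (gtn_eqF (prime_gt0 p_pr)).
have inj (x y : K) : x != y -> x ^+ p <> y ^+ p.
  move=> xy e; have /eqP := exprBp chK x y.
  rewrite e subrr expf_eq0 subr_eq0.
  by rewrite (negPf xy) andbF.
have [_ _ _ [d12 d23 d31]] := rts.
have i12 := inj _ _ d12; have i23 := inj _ _ d23; have i31 := inj _ _ d31.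
have s1 := stable x1; have s2 := stable x2; have s3 := stable x3.
move: s1 s2 s3; rewrite !inE !eqxx !orbT /=.
have rts2 := cubic_rootsC rts; have rts3 := cubic_rootsC rts2.
have rtsS := cubic_rootsS rts.
(* Of the 27 maps of three letters to themselves only the injective ones survive. *)
move=> /(_ isT)/or3P[]/eqP f1 /(_ isT)/or3P[]/eqP f2 /(_ isT)/or3P[]/eqP f3 sp;
  try by case: i12; rewrite f1 f2.
all: try by case: i23; rewrite f2 f3.
all: try by case: i31; rewrite f1 f3.
- by exists x1, x2, x3; split=> //; apply: FrobId => //; apply/sp.
- exists x1, x2, x3; split=> //; apply: FrobSwap => // /sp[_ e _].
  by move: d23; rewrite -e f2 eqxx.
- exists x3, x1, x2; split=> //; apply: FrobSwap => // /sp[e _ _].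
  by move: d12; rewrite -e f1 eqxx.
- exists x1, x2, x3; split=> //; apply: FrobCycle => // /sp[e _ _].
  by move: d12; rewrite -e f1 eqxx.
- exists x1, x3, x2; split=> //; apply: FrobCycle => // /sp[e _ _].
  by move: d31; rewrite -e f1 eqxx.
exists x2, x3, x1; split=> //; apply: FrobSwap => // /sp[e _ _].
by move: d31; rewrite -e f1 eqxx.
Qed.

End Trichotomy.

(** * Recurrences evaluated at the roots *)

Section ClosedForms.
Variable K : fieldType.

(** u_n is the complete symmetric polynomial of degree n in the roots; the
    factor on the left is the Vandermonde product that clears the denominators
    of its expansion as the sum of the x_i^(n+2) / f'(x_i). *)
Lemma cubicU_roots (b1 b2 b3 : int) (x1 x2 x3 : K) n :
  cubic_roots b1 b2 b3 x1 x2 x3 ->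
  (cubicU_from_m2 b1 b2 b3 n)%:~R * - ((x1 - x2) * (x2 - x3) * (x3 - x1))
    = x1 ^+ n * (x2 - x3) + x2 ^+ n * (x3 - x1) + x3 ^+ n * (x1 - x2).
Proof.
case=> e1 e2 e3 _; have [V VE] : exists V, V = - ((x1 - x2) * (x2 - x3) * (x3 - x1)).
  by eexists.
pose F m := (cubicU_from_m2 b1 b2 b3 m)%:~R * V
  = x1 ^+ m * (x2 - x3) + x2 ^+ m * (x3 - x1) + x3 ^+ m * (x1 - x2).
rewrite -VE; suff [] : [/\ F n, F n.+1 & F n.+2] by [].
elim: n => [|n [F0 F1 F2]]; first by rewrite /F /= !mulr0z VE; split; ring.
split=> //; rewrite {}/F in F0 F1 F2 *.
rewrite -[cubicU_from_m2 _ _ _ n.+3]/(- b1 * cubicU_from_m2 b1 b2 b3 n.+2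
  - b2 * cubicU_from_m2 b1 b2 b3 n.+1 - b3 * cubicU_from_m2 b1 b2 b3 n).
transitivity (- b1%:~R * ((cubicU_from_m2 b1 b2 b3 n.+2)%:~R * V)
  - b2%:~R * ((cubicU_from_m2 b1 b2 b3 n.+1)%:~R * V)
  - b3%:~R * ((cubicU_from_m2 b1 b2 b3 n)%:~R * V)); first by ring.
rewrite F0 F1 F2 e1 e2 e3.
by rewrite !exprS; ring.
Qed.

Lemma cubicS_roots (b1 b2 b3 : int) (x1 x2 x3 : K) n :
  cubic_roots b1 b2 b3 x1 x2 x3 ->
  (cubicS b1 b2 b3 n)%:~R = x1 ^+ n + x2 ^+ n + x3 ^+ n.
Proof.
case=> e1 e2 e3 _; pose F m := (cubicS b1 b2 b3 m)%:~R
  = x1 ^+ m + x2 ^+ m + x3 ^+ m.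
suff [] : [/\ F n, F n.+1 & F n.+2] by [].
elim: n => [|n [F0 F1 F2]].
  rewrite /F /= !(rmorphB, rmorphM, rmorphN, rmorphXn) /= e1 e2.
  by split; ring.
split=> //; rewrite {}/F in F0 F1 F2 *.
rewrite -[cubicS _ _ _ n.+3]/(- b1 * cubicS b1 b2 b3 n.+2
  - b2 * cubicS b1 b2 b3 n.+1 - b3 * cubicS b1 b2 b3 n).
rewrite !(rmorphB, rmorphM, rmorphN) /= F0 F1 F2 e1 e2 e3.
by rewrite !exprS; ring.
Qed.

Lemma lucasU_roots (b c : int) (r1 r2 : K) n :
  b%:~R = r1 + r2 -> c%:~R = r1 * r2 ->
  (lucasU b c n)%:~R * (r1 - r2) = r1 ^+ n - r2 ^+ n.
Proof.
move=> eb ec; pose F m := (lucasU b c m)%:~R * (r1 - r2) = r1 ^+ m - r2 ^+ m.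
suff [] : F n /\ F n.+1 by [].
elim: n => [|n [F0 F1]]; first by rewrite /F /= mulr0z; split; ring.
split=> //; rewrite {}/F in F0 F1 *.
rewrite -[lucasU _ _ n.+2]/(b * lucasU b c n.+1 - c * lucasU b c n).
transitivity (b%:~R * ((lucasU b c n.+1)%:~R * (r1 - r2))
  - c%:~R * ((lucasU b c n)%:~R * (r1 - r2))); first by ring.
rewrite F0 F1 eb ec.
by rewrite !exprS; ring.
Qed.

Lemma lucasV_roots (b c : int) (r1 r2 : K) n :
  b%:~R = r1 + r2 -> c%:~R = r1 * r2 ->
  (lucasV b c n)%:~R = r1 ^+ n + r2 ^+ n.
Proof.
move=> eb ec; pose F m := (lucasV b c m)%:~R = r1 ^+ m + r2 ^+ m.
suff [] : F n /\ F n.+1 by [].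
elim: n => [|n [F0 F1]]; first by rewrite /F /= eb; split; ring.
split=> //; rewrite {}/F in F0 F1 *.
rewrite -[lucasV _ _ n.+2]/(b * lucasV b c n.+1 - c * lucasV b c n).
rewrite !(rmorphB, rmorphM) /= F0 F1 eb ec.
by rewrite !exprS; ring.
Qed.

End ClosedForms.

Lemma p3_neq0 (p : nat) : prime p -> (3 < p)%N -> (3 : Fbar p) != 0.
Proof.
by move=> p_pr p_gt3; apply: (natr_neq0p (Fbar_pchar p_pr)); lia.
Qed.

Section Criteria.
Variables (p : nat) (a1 a2 a3 : int).
Hypotheses (p_pr : prime p) (p_gt3 : (3 < p)%N).
Hypotheses (D0N : ~~ (p%:Z %| cubD0 a1 a2 a3)%Z)
           (P0N : ~~ (p%:Z %| cubP0 a1 a2 a3)%Z)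
           (Q0N : ~~ (p%:Z %| cubQ0 a1 a2)%Z).
Local Notation K := (Fbar p).
Let chK := Fbar_pchar p_pr.

Section Roots.
Variables (x1 x2 x3 : K).
Hypotheses (rts : cubic_roots a1 a2 a3 x1 x2 x3)
           (frob : frob_spec a1 a2 a3 x1 x2 x3).

Let e1 : a1%:~R = - (x1 + x2 + x3). Proof. by case: rts. Qed.
Let e2 : a2%:~R = x1 * x2 + x2 * x3 + x3 * x1. Proof. by case: rts. Qed.
Let e3 : a3%:~R = - (x1 * x2 * x3). Proof. by case: rts. Qed.
Let d12 : x1 - x2 != 0. Proof. by rewrite subr_eq0; case: rts => _ _ _ []. Qed.
Let d23 : x2 - x3 != 0. Proof. by rewrite subr_eq0; case: rts => _ _ _ []. Qed.
Let d31 : x3 - x1 != 0. Proof. by rewrite subr_eq0; case: rts => _ _ _ []. Qed.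

Lemma P0_roots : (cubP0 a1 a2 a3)%:~R = (2 * x1 - x2 - x3) * (2 * x2 - x3 - x1)
  * (2 * x3 - x1 - x2) :> K.
Proof.
have -> : (cubP0 a1 a2 a3)%:~R = - 2 * a1%:~R ^+ 3 + 9 * a1%:~R * a2%:~R
  - 27 * a3%:~R :> K by rewrite /cubP0; ring.
by rewrite e1 e2 e3; ring.
Qed.

Lemma Q0_root : (a1 ^+ 2 - 3 * a2)%:~R
  = x1 ^+ 2 + x2 ^+ 2 + x3 ^+ 2 - x1 * x2 - x2 * x3 - x3 * x1 :> K.
Proof.
have -> : (a1 ^+ 2 - 3 * a2)%:~R = a1%:~R ^+ 2 - 3 * a2%:~R :> K by ring.
by rewrite e1 e2; ring.
Qed.

Lemma Q0_roots : (cubQ0 a1 a2)%:~R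
  = (x1 ^+ 2 + x2 ^+ 2 + x3 ^+ 2 - x1 * x2 - x2 * x3 - x3 * x1) ^+ 3 :> K.
Proof. by rewrite /cubQ0 rmorphXn /= Q0_root. Qed.

Lemma Q0_root_neq0 :
  x1 ^+ 2 + x2 ^+ 2 + x3 ^+ 2 - x1 * x2 - x2 * x3 - x3 * x1 != 0.
Proof.
by apply: contraNneq Q0N => e; rewrite -(intr_eq0p chK) Q0_roots e expr0n.
Qed.

(** P0 is the product of the three expressions of this shape, so no root is
    the midpoint of the two others. *)
Lemma midpoint_neq0 : 2 * x1 - x2 - x3 != 0.
Proof.
by apply: contraNneq P0N => e; rewrite -(intr_eq0p chK) P0_roots e !mul0r.
Qed.

(** Applying Frobenius, the numerator of u_(p-2) becomes the sum of the
    x_(sigma 1) (x2 - x3). It vanishes for the identity; for a transposition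
    it is (x2 - x3) (2 x1 - x2 - x3), and for a 3-cycle it is a1^2 - 3 a2. *)
Lemma splits_cubicU :
  splits_mod p a1 a2 a3 <-> (p%:Z %| cubicU a1 a2 a3 (p - 2))%Z.
Proof.
rewrite /cubicU -[(p - 2).+2]addn2 subnK; last by apply: leq_trans p_gt3.
have V0 : - ((x1 - x2) * (x2 - x3) * (x3 - x1)) != 0 :> K.
  by rewrite oppr_eq0 !mulf_neq0.
rewrite -(intr_eq0p chK) -(mulIr_eq0 _ (mulIf V0)) (cubicU_roots p rts).
case: frob => spl -> -> ->; split=> // /eqP.
- by move=> _; apply/eqP; ring.
- have -> : x1 * (x2 - x3) + x3 * (x3 - x1) + x2 * (x1 - x2)
    = (x2 - x3) * (2 * x1 - x2 - x3) by ring.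
  by move/eqP; rewrite mulf_eq0 (negPf d23) (negPf midpoint_neq0).
have -> : x2 * (x2 - x3) + x3 * (x3 - x1) + x1 * (x1 - x2)
  = x1 ^+ 2 + x2 ^+ 2 + x3 ^+ 2 - x1 * x2 - x2 * x3 - x3 * x1 by ring.
by move/eqP; rewrite (negPf Q0_root_neq0).
Qed.

(** s_(p+1) is the sum of the x_i x_(sigma i). Its distance to the sum of the
    x_i^2 is, up to sign, (x2 - x3)^2 for a transposition and a1^2 - 3 a2 for
    a 3-cycle. *)
Lemma splits_cubicS : splits_mod p a1 a2 a3 <->
  (cubicS a1 a2 a3 p.+1 = a1 ^+ 2 - 2 * a2 %[mod p%:Z])%Z.
Proof.
rewrite (rwP eqP) -(intr_eqp chK) (cubicS_roots _ rts) !(exprS _ p).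
have -> : (a1 ^+ 2 - 2 * a2)%:~R = x1 ^+ 2 + x2 ^+ 2 + x3 ^+ 2 :> K.
  have -> : (a1 ^+ 2 - 2 * a2)%:~R = a1%:~R ^+ 2 - 2 * a2%:~R :> K by ring.
  by rewrite e1 e2; ring.
case: frob => spl -> -> ->; split=> //; rewrite -subr_eq0.
- have -> : x1 * x1 + x2 * x3 + x3 * x2 - (x1 ^+ 2 + x2 ^+ 2 + x3 ^+ 2)
    = - ((x2 - x3) * (x2 - x3)) by ring.
  by rewrite oppr_eq0 mulf_eq0 (negPf d23).
have -> : x1 * x2 + x2 * x3 + x3 * x1 - (x1 ^+ 2 + x2 ^+ 2 + x3 ^+ 2)
  = - (x1 ^+ 2 + x2 ^+ 2 + x3 ^+ 2 - x1 * x2 - x2 * x3 - x3 * x1) by ring.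
by rewrite oppr_eq0 (negPf Q0_root_neq0).
Qed.

(** An affine change of variable commutes with Frobenius, so the roots y_i are
    permuted like the x_i. When they sum to 0, the numerator of u_p vanishes
    for the identity, and is up to sign (y2 - y3) y1 b2 for a transposition
    and b2^2 for a 3-cycle. *)
Lemma cubicU_affine_roots (k m b2 b3 : int) :
  let y x := k%:~R * x + m%:~R in
  cubic_roots 0 b2 b3 (y x1) (y x2) (y x3) ->
  y x1 != 0 -> ~~ (p%:Z %| b2)%Z ->
  splits_mod p a1 a2 a3 <-> (p%:Z %| cubicU 0 b2 b3 p)%Z.
Proof.
move=> y ry y1N b2N; rewrite /cubicU.
have [ye1 ye2 _ [dy12 dy23 dy31]] := ry.
have V0 : - ((y x1 - y x2) * (y x2 - y x3) * (y x3 - y x1)) != 0 :> K.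
  by rewrite oppr_eq0 !mulf_neq0 ?subr_eq0.
rewrite -(intr_eq0p chK) -(mulIr_eq0 _ (mulIf V0)) (cubicU_roots p.+2 ry).
have yp x : y x ^+ p = y (x ^+ p).
  by rewrite /y (exprDp chK) exprMn !(expr_intp chK).
rewrite !exprSr !yp.
have y3E : y x3 = - y x1 - y x2.
  by apply/eqP; rewrite -subr_eq0 -oppr_eq0; apply/eqP; rewrite [RHS]ye1; ring.
have b2K : (b2%:~R : K) != 0 by rewrite (intr_eq0p chK).
rewrite ye2 in b2K.
case: frob => spl -> -> ->; split=> //.
- by rewrite y3E => _; apply/eqP; ring.
- have -> : y x1 * y x1 * y x1 * (y x2 - y x3)
      + y x3 * y x2 * y x2 * (y x3 - y x1)
      + y x2 * y x3 * y x3 * (y x1 - y x2)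
    = - ((y x2 - y x3) * y x1
         * (y x1 * y x2 + y x2 * y x3 + y x3 * y x1)) by rewrite y3E; ring.
  rewrite oppr_eq0 !mulf_eq0 subr_eq0 (negPf dy23) (negPf y1N).
  by rewrite (negPf b2K).
have -> : y x2 * y x1 * y x1 * (y x2 - y x3)
      + y x3 * y x2 * y x2 * (y x3 - y x1)
      + y x1 * y x3 * y x3 * (y x1 - y x2)
    = (y x1 * y x2 + y x2 * y x3 + y x3 * y x1) ^+ 2 by rewrite y3E; ring.
by rewrite expf_eq0 (negPf b2K) andbF.
Qed.

(** The cubic in question has the roots 3 x_i + a1, whose sum is 0. *)
Lemma splits_cubicU_depressed : splits_mod p a1 a2 a3 <->
  (p%:Z %| cubicU 0 (- 3 * (a1 ^+ 2 - 3 * a2))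
                       (2 * a1 ^+ 3 - 9 * a1 * a2 + 27 * a3) p)%Z.
Proof.
have yE (x x' x'' : K) : a1%:~R = - (x + x' + x'') ->
  (3 : int)%:~R * x + a1%:~R = 2 * x - x' - x'' by move=> ->; ring.
apply: (@cubicU_affine_roots 3 a1).
- rewrite (yE x1 x2 x3) // (yE x2 x3 x1) ?(yE x3 x1 x2) ?e1; try ring.
  split.
  + by ring.
  + have -> : (- 3 * (a1 ^+ 2 - 3 * a2))%:~R
      = - 3 * (a1 ^+ 2 - 3 * a2)%:~R :> K by ring.
    by rewrite Q0_root; ring.
  + have -> : (2 * a1 ^+ 3 - 9 * a1 * a2 + 27 * a3)%:~R
      = - (cubP0 a1 a2 a3)%:~R :> K by rewrite /cubP0; ring.
    by rewrite P0_roots; ring.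
  + have dN (z z' z'' : K) : z - z' != 0 ->
        2 * z - z' - z'' != 2 * z' - z'' - z.
      move=> d; rewrite -subr_eq0.
      have -> : 2 * z - z' - z'' - (2 * z' - z'' - z) = 3 * (z - z') by ring.
      by rewrite mulf_neq0 ?(p3_neq0 p_pr).
    by split; apply: dN.
- by rewrite (yE x1 x2 x3) // midpoint_neq0.
rewrite -(intr_eq0p chK).
have -> : (- 3 * (a1 ^+ 2 - 3 * a2))%:~R
      = - (3 * (a1 ^+ 2 - 3 * a2)%:~R) :> K by ring.
by rewrite Q0_root oppr_eq0 mulf_neq0 ?(p3_neq0 p_pr) ?Q0_root_neq0.
Qed.

Lemma splits_cubicU_sum0 : a1 = 0 ->
  splits_mod p a1 a2 a3 <-> (p%:Z %| cubicU 0 a2 a3 p)%Z.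
Proof.
move=> a10; apply: (@cubicU_affine_roots 1 0).
- by rewrite /= !mul1r !addr0 -[X in cubic_roots X]a10.
- rewrite mul1r addr0; apply: contraNneq midpoint_neq0 => x10.
  have -> : 2 * x1 - x2 - x3 = 3 * x1 - (x1 + x2 + x3) by ring.
  by rewrite -e1 a10 x10 mulr0 addr0.
apply: contraNN Q0N => a2p; rewrite /cubQ0 a10 expr0n sub0r.
rewrite -[3%N]/(1 + 2)%N exprD expr1; apply: dvdz_mulr.
by rewrite rpredN dvdz_mull.
Qed.

End Roots.
End Criteria.

(** * Lagrange resolvents *)

Lemma prime_mod3 (p : nat) : prime p -> (p != 3)%N ->
  (p %% 3 = 1)%N \/ (p %% 3 = 2)%N.
Proof.
move=> p_pr p3; have : ~~ (3 %| p)%N by rewrite dvdn_prime2 // eq_sym.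
rewrite /dvdn; have := ltn_pmod p (isT : (0 < 3)%N).
by case: (p %% 3)%N => [|[|[]]] //; [left|right].
Qed.

Lemma legendre3 (p : nat) : prime p -> (p != 3)%N ->
  legendre p%:Z 3 = if (p %% 3 == 1)%N then 1 else -1.
Proof.
move=> p_pr p3; rewrite /legendre.
have -> : (3%:Z %| p%:Z)%Z = false.
  by rewrite -[(_ %| _)%Z]/(3 %| p)%N dvdn_prime2 // eq_sym; apply: negPf.
have pE : (p%:~R : 'F_3) = ((p %% 3)%N)%:R.
  by apply: val_inj; rewrite /= !val_Fp_nat // modn_mod.
case: (prime_mod3 p_pr p3) => pm; rewrite pm /= pE pm.
  by case: existsP => // -[]; exists 1; apply/eqP; ring.
case: existsP => // -[x].
by case: x => [[|[|[|]]]].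
Qed.

Lemma cube_root_exists (K : closedFieldType) :
  exists w : K, w ^+ 2 + w + 1 = 0.
Proof.
have [w wE] := @GRing.solve_monicpoly K 2 (fun _ => -1) isT.
by exists w; move: wE; rewrite !big_ord_recr big_ord0 /= => ->; ring.
Qed.

Section CubeRoot.
Variables (K : fieldType) (w : K).
Hypothesis wE : w ^+ 2 + w + 1 = 0.

Lemma cube_root2 : w ^+ 2 = - w - 1.
Proof. by apply/eqP; rewrite -subr_eq0 -wE; apply/eqP; ring. Qed.

Lemma cube_root3 : w ^+ 3 = 1.
Proof.
by apply/eqP; rewrite -subr_eq0; apply/eqP;
  rewrite -[RHS](mulr0 (w - 1)) -wE; ring.
Qed.

Lemma cube_root_mod n : w ^+ n = w ^+ (n %% 3)%N.
Proof. by rewrite expr_mod // cube_root3. Qed.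

Lemma cube_root_neq0 : w != 0.
Proof.
apply: contraTneq isT => w0; have := cube_root3; rewrite w0 expr0n /=.
by move/eqP; rewrite eq_sym oner_eq0.
Qed.

Lemma cube_root_neq1 : (3 : K) != 0 -> w != 1.
Proof.
apply: contraNneq => w1; have := wE; rewrite w1 => <-; apply/eqP; ring.
Qed.

End CubeRoot.

Lemma sqr_ratio_cube (F : fieldType) (A B : F) : A != 0 ->
  (B / A) ^+ 2 * A ^+ 3 + B ^+ 3 = B ^+ 2 * (A + B).
Proof. by move=> AN; field. Qed.

Section Lagrange.
Variables (p : nat) (a1 a2 a3 : int).
Hypotheses (p_pr : prime p) (p_gt3 : (3 < p)%N).
Hypotheses (D0N : ~~ (p%:Z %| cubD0 a1 a2 a3)%Z)
           (P0N : ~~ (p%:Z %| cubP0 a1 a2 a3)%Z)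
           (Q0N : ~~ (p%:Z %| cubQ0 a1 a2)%Z).
Local Notation K := (Fbar p).
Let chK := Fbar_pchar p_pr.
Variables (x1 x2 x3 w : K).
Hypotheses (rts : cubic_roots a1 a2 a3 x1 x2 x3)
           (frob : frob_spec a1 a2 a3 x1 x2 x3)
           (wE : w ^+ 2 + w + 1 = 0).

Definition resolvent (z x1 x2 x3 : K) := x1 + z * x2 + z ^+ 2 * x3.
Let L1 := resolvent w x1 x2 x3.
Let L2 := resolvent (w ^+ 2) x1 x2 x3.

Let w2 := cube_root2 wE.
Let w4 : (w ^+ 2) ^+ 2 = w.
Proof. by rewrite -exprM -[(2 * 2)%N]/(3 + 1)%N exprD cube_root3 // mul1r. Qed.

Let L2E : L2 = x1 + w ^+ 2 * x2 + w * x3.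
Proof. by rewrite /L2 /resolvent w4. Qed.

Lemma resolvent_mul : L1 * L2 = (a1 ^+ 2 - 3 * a2)%:~R.
Proof. by rewrite (Q0_root rts) L2E /L1 /resolvent w2; ring: w2. Qed.

Lemma resolventM_neq0 : L1 * L2 != 0.
Proof. by rewrite resolvent_mul (Q0_root rts) (Q0_root_neq0 p_pr Q0N rts). Qed.

Let L1N : L1 != 0.
Proof. by apply: contraNneq resolventM_neq0 => ->; rewrite mul0r. Qed.
Let L2N : L2 != 0.
Proof. by apply: contraNneq resolventM_neq0 => ->; rewrite mulr0. Qed.

Lemma resolvent_cube_add : L1 ^+ 3 + L2 ^+ 3 = (cubP0 a1 a2 a3)%:~R.
Proof. by rewrite (P0_roots rts) L2E /L1 /resolvent w2; ring: w2. Qed.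

Lemma resolvent_cube_mul : L1 ^+ 3 * L2 ^+ 3 = (cubQ0 a1 a2)%:~R.
Proof. by rewrite -exprMn resolvent_mul /cubQ0 rmorphXn. Qed.

(** The cubes of the resolvents are the roots of X^2 - P0 X + Q0, a polynomial
    of discriminant -27 D0. *)
Lemma resolvent_cube_neq : L1 ^+ 3 - L2 ^+ 3 != 0.
Proof.
apply: contraNneq D0N => r12.
have : (-27 * cubD0 a1 a2 a3)%:~R = 0 :> K.
  rewrite cubD0E rmorphB rmorphXn rmorphM /= -resolvent_cube_add.
  rewrite -resolvent_cube_mul.
  have -> : (L1 ^+ 3 + L2 ^+ 3) ^+ 2 - (4 : int)%:~R * (L1 ^+ 3 * L2 ^+ 3)
    = (L1 ^+ 3 - L2 ^+ 3) ^+ 2 by ring.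
  by rewrite r12 expr0n.
have -> : (-27 * cubD0 a1 a2 a3)%:~R = - (3 ^+ 3 * (cubD0 a1 a2 a3)%:~R) :> K.
  by ring.
move/eqP; rewrite oppr_eq0 mulf_eq0 expf_eq0 (negPf (p3_neq0 p_pr p_gt3)) /=.
by rewrite (intr_eq0p chK).
Qed.

Lemma resolvent_add_neq0 : L1 + L2 != 0.
Proof.
rewrite L2E /L1 /resolvent w2.
have -> : x1 + w * x2 + (- w - 1) * x3 + (x1 + (- w - 1) * x2 + w * x3)
  = 2 * x1 - x2 - x3 by ring.
exact: (midpoint_neq0 p_pr P0N rts).
Qed.

(** For n = (p - (p/3))/3 the n-th power of L^3 is L^p / L or L^p L, and L^p
    is read off from the way Frobenius permutes the roots and the cube roots
    of unity. The factor u is 1 for the identity, L2 / L1 for a transposition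
    and w^2 for a 3-cycle. The condition on P0^2 - 3 Q0 excludes that the
    ratio of the two cubes is minus a primitive cube root of unity. *)
Lemma frob_resolvents (n : nat) :
  ((p %% 3 = 1)%N -> p = (3 * n).+1) -> ((p %% 3 = 2)%N -> (3 * n)%N = p.+1) ->
  exists u v : K, [/\ u * v = 1, splits_mod p a1 a2 a3 <-> u = 1,
    u ^+ 2 = 1 -> u = 1,
    ~~ (p%:Z %| cubP0 a1 a2 a3 ^+ 2 - 3 * cubQ0 a1 a2)%Z ->
      u ^+ 2 * L1 ^+ 3 + L2 ^+ 3 != 0
    & if (p %% 3 == 1)%N then (L1 ^+ 3) ^+ n = u /\ (L2 ^+ 3) ^+ n = v
      else (L1 ^+ 3) ^+ n = L1 * L2 * v /\ (L2 ^+ 3) ^+ n = L1 * L2 * u].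
Proof.
move=> n1 n2; have w3 := cube_root3 wE.
have wN1 := cube_root_neq1 wE (p3_neq0 p_pr p_gt3).
have pm : (p %% 3 = 1)%N \/ (p %% 3 = 2)%N.
  by apply: prime_mod3; rewrite // gtn_eqF.
have powE (L u1 : K) : L != 0 -> (p %% 3 = 1)%N -> L ^+ p = u1 * L ->
    (L ^+ 3) ^+ n = u1.
  move=> LN pm1; have -> : L ^+ p = (L ^+ 3) ^+ n * L.
    by rewrite -exprM -exprSr -n1.
  exact: mulIf.
have powE' (L u1 : K) : (p %% 3 = 2)%N -> L ^+ p = u1 -> (L ^+ 3) ^+ n = L * u1.
  by move=> pm2 <-; rewrite -exprM n2 // exprS.
have wp : w ^+ p = if (p %% 3 == 1)%N then w else w ^+ 2.
  rewrite (cube_root_mod wE).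
  by case: pm => ->.
have L1p : L1 ^+ p = resolvent (w ^+ p) (x1 ^+ p) (x2 ^+ p) (x3 ^+ p).
  by rewrite /L1 /resolvent !(exprDp chK) !exprMn.
have L2p : L2 ^+ p = resolvent ((w ^+ p) ^+ 2) (x1 ^+ p) (x2 ^+ p) (x3 ^+ p).
  by rewrite /L2 /resolvent !(exprDp chK) !exprMn.

case: frob => spl f1 f2 f3; rewrite {}f1 {}f2 {}f3 in L1p L2p.
- exists 1, 1; rewrite !mulr1; split=> //.
  + by rewrite expr1n mul1r resolvent_cube_add (intr_eq0p chK).
  case: pm => pm; rewrite pm /= in wp L1p L2p *; rewrite wp in L1p L2p.
    by split; apply: powE; rewrite ?mul1r.
  by rewrite w4 in L2p; split; [|rewrite [RHS]mulrC]; apply: powE'.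
- exists (L2 / L1), (L1 / L2); split.
  + by rewrite mulrA divfK // divff.
  + split=> // /(congr1 (fun z => z * L1)); rewrite divfK // mul1r => L12.
    by have := resolvent_cube_neq; rewrite L12 subrr eqxx.
  + move/eqP; rewrite sqrf_eq1 => /orP[]/eqP // /(congr1 (fun z => z * L1)).
    rewrite divfK // => L12; have := resolvent_add_neq0.
    by rewrite L12 mulN1r subrr eqxx.
  + rewrite sqr_ratio_cube //.
    by rewrite mulf_neq0 ?expf_neq0 ?resolvent_add_neq0.
  case: pm => pm; rewrite pm /= in wp L1p L2p *; rewrite wp in L1p L2p.
    have L1p' : L1 ^+ p = L2 by rewrite L1p L2E /resolvent; ring.
    have L2p' : L2 ^+ p = L1.
      by rewrite L2p /L1 /resolvent w4; ring.
    by split; apply: powE; rewrite ?divfK.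
  have L1p' : L1 ^+ p = L1.
    by rewrite L1p /L1 /resolvent w4; ring.
  have L2p' : L2 ^+ p = L2 by rewrite L2p L2E /resolvent !w4; ring.
  split.
    by rewrite -mulrA [L2 * _]mulrC divfK //; apply: powE'.
  by rewrite [L1 * L2]mulrC -mulrA [L1 * _]mulrC divfK //; apply: powE'.
exists (w ^+ 2), w; split.
- by rewrite -exprSr.
- split=> // e; case/eqP: wN1.
  by rewrite -w3 exprS e mulr1.
- by rewrite w4 => e; case/eqP: wN1.
- apply: contraNneq; rewrite w4 => e; rewrite -(intr_eq0p chK).
  have e' : L2 ^+ 3 = - (w * L1 ^+ 3).
    by apply/eqP; rewrite -subr_eq0 opprK addrC e.
  rewrite rmorphB rmorphXn rmorphM /= -resolvent_cube_add -resolvent_cube_mul.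
  by rewrite e' -[X in _ == X](mulr0 ((L1 ^+ 3) ^+ 2)) -wE; apply/eqP; ring.
case: pm => pm; rewrite pm /= in wp L1p L2p *; rewrite wp in L1p L2p.
  split; apply: powE => //.
    by rewrite L1p /L1 /resolvent w2; ring: w2.
  by rewrite L2p L2E /resolvent w2; ring: w2.
split.
  by rewrite -mulrA; apply: powE' => //; rewrite L1p L2E /resolvent w4 w2; ring: w2.
rewrite [L1 * L2]mulrC -mulrA; apply: powE' => //.
by rewrite L2p /L1 /resolvent w4 w2; ring: w2.
Qed.

End Lagrange.

(** * Central binomial coefficients and Lucas numbers modulo p *)

(** For a prime q other than 3, one third of the order of the group of
    elements of norm 1 of the Eisenstein integers modulo q. *)
Definition torus_index (q : nat) : nat := `|((q%:Z - legendre q%:Z 3) %/ 3)%Z|%N.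

Lemma torus_index1 (q : nat) : prime q -> q != 3%N ->
  (q %% 3 = 1)%N -> q = (3 * torus_index q).+1.
Proof.
by move=> q_pr q3 qm; rewrite /torus_index legendre3 // qm /=; lia.
Qed.

Lemma torus_index2 (q : nat) : prime q -> q != 3%N ->
  (q %% 3 = 2)%N -> (3 * torus_index q)%N = q.+1.
Proof.
by move=> q_pr q3 qm; rewrite /torus_index legendre3 // qm /=; lia.
Qed.

Lemma torus_index1_div (q : nat) : prime q -> q != 3%N ->
  (q %% 3 = 1)%N -> torus_index q = (q %/ 3)%N.
Proof. by move=> q_pr q3 qm; have := torus_index1 q_pr q3 qm; lia. Qed.

Lemma torus_index2_div (q : nat) : prime q -> q != 3%N ->
  (q %% 3 = 2)%N -> torus_index q = (q %/ 3).+1.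
Proof. by move=> q_pr q3 qm; have := torus_index2 q_pr q3 qm; lia. Qed.

Definition lucas_odd (R : pzRingType) (m : nat) (P Q : R) : R :=
  \sum_(k < m.+1) 'C(m + k, 2 * k)%:R * (- Q) ^+ (m - k) * P ^+ (2 * k).

(** Pascal's rule passes from the expansion of odd index to the one of even
    index and back, so that the two are proved together. *)
Lemma lucasU_oddE (m : nat) (P Q : int) :
  lucasU P Q (2 * m).+1 = lucas_odd m P Q.
Proof.
pose B n : int := \sum_(k < n.+1)
  'C(n + k + 1, 2 * k + 1)%:R * (- Q) ^+ (n - k) * P ^+ (2 * k + 1).
suff [] : lucasU P Q (2 * m).+1 = lucas_odd m P Q
       /\ lucasU P Q (2 * m).+2 = B m by [].
elim: m => [|m [IH1 IH2]].
  rewrite /lucas_odd /B !big_ord_recr !big_ord0 /= !(muln0, addn0, subn0) bin0.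
  by rewrite binn; split; ring.
have recU n : lucasU P Q n.+2 = P * lucasU P Q n.+1 - Q * lucasU P Q n by [].
have oddE : lucas_odd m.+1 P Q = P * B m - Q * lucas_odd m P Q.
  pose G k : int :=
    'C(m + k, 2 * k)%:R * (- Q) ^+ (m.+1 - k) * P ^+ (2 * k).
  have GE : - Q * lucas_odd m P Q = \sum_(k < m.+2) G k.
    rewrite big_ord_recr /= {2}/G bin_small; last lia.
    rewrite !mul0r addr0 big_distrr; apply: eq_bigr => k _ /=.
    by rewrite /G subSn ?exprS; [ring|have := ltn_ord k; lia].
  rewrite -mulNr GE /lucas_odd /B big_distrr.
  rewrite [LHS]big_ord_recl [\sum_(k < m.+2) G k]big_ord_recl addrCA.
  congr (_ + _); first by rewrite /G /= muln0 !bin0.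
  rewrite -big_split; apply: eq_bigr => k _ /=.
  rewrite /G /bump /= !add1n.
  have -> : (m.+1 + k.+1 = (m + k + 1).+1)%N by lia.
  have -> : (2 * k.+1 = (2 * k + 1).+1)%N by lia.
  have -> : (m + k.+1 = m + k + 1)%N by lia.
  by rewrite binS natrD subSS !exprS; ring.
have evenE : B m.+1 = P * lucas_odd m.+1 P Q - Q * B m.
  pose G k : int :=
    'C(m + k + 1, 2 * k + 1)%:R * (- Q) ^+ (m.+1 - k) * P ^+ (2 * k + 1).
  have GE : - Q * B m = \sum_(k < m.+2) G k.
    rewrite big_ord_recr /= {2}/G bin_small; last lia.
    rewrite !mul0r addr0 big_distrr; apply: eq_bigr => k _ /=.
    by rewrite /G subSn ?exprS; [ring|have := ltn_ord k; lia].
  rewrite -mulNr GE /lucas_odd /B big_distrr -big_split.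
  apply: eq_bigr => k _ /=; rewrite /G.
  have -> : (m.+1 + k + 1 = (m + k + 1).+1)%N by lia.
  have -> : (m.+1 + k = m + k + 1)%N by lia.
  have -> : (2 * k + 1 = (2 * k).+1)%N by lia.
  by rewrite binS natrD !exprS; ring.
have -> : (2 * m.+1 = (2 * m).+2)%N by lia.
by rewrite recU IH1 IH2 -oddE; split=> //; rewrite recU recU IH1 IH2 -oddE.
Qed.

Lemma central_bin_step (k : nat) :
  ('C(3 * k.+1, k.+1) * (k.+1 * (2 * k).+1 * (2 * k).+2)
   = 'C(3 * k, k) * ((3 * k).+1 * (3 * k).+2 * (3 * k).+3))%N.
Proof.
have e1 : ('C(3 * k.+1, k.+1) * (k.+1`! * ((2 * k).+2)`!) = (3 * k.+1)`!)%N.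
  have -> : ((2 * k).+2 = 3 * k.+1 - k.+1)%N by lia.
  by rewrite bin_fact //; lia.
have e2 : ('C(3 * k, k) * (k`! * (2 * k)`!) = (3 * k)`!)%N.
  have -> : (2 * k = 3 * k - k)%N by lia.
  by rewrite bin_fact //; lia.
have e3 : (3 * k.+1 = (3 * k).+3)%N by lia.
apply/eqP; rewrite -(@eqn_pmul2r (k`! * (2 * k)`!)) ?muln_gt0 ?fact_gt0 //.
move: e1; rewrite e3 !factS -e2 => e1; apply/eqP; lia.
Qed.

Lemma shifted_bin_step (k d : nat) :
  ('C(2 * k + d + 2, (2 * k).+2) * ((2 * k).+1 * (2 * k).+2)
   = 'C(2 * k + d + 1, 2 * k) * ((2 * k + d + 2) * d.+1))%N.
Proof.
have e1 : ('C(2 * k + d + 2, (2 * k).+2) * (((2 * k).+2)`! * d`!)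
    = (2 * k + d + 2)`!)%N.
  rewrite -(@bin_fact (2 * k + d + 2) (2 * k).+2); last lia.
  by congr (_ * (_ * _`!))%N; lia.
have e2 : ('C(2 * k + d + 1, 2 * k) * ((2 * k)`! * d.+1`!)
    = (2 * k + d + 1)`!)%N.
  rewrite -(@bin_fact (2 * k + d + 1) (2 * k)); last lia.
  by congr (_ * (_ * _`!))%N; lia.
have e3 : (2 * k + d + 2 = (2 * k + d + 1).+1)%N by lia.
apply/eqP; rewrite -(@eqn_pmul2r ((2 * k)`! * d`!)) ?muln_gt0 ?fact_gt0 //.
move: e1; rewrite e3 (factS (2 * k + d + 1)) -e2 !factS => e1; apply/eqP; lia.
Qed.

Section BinomialModP.
Variables (p : nat) (K : fieldType).
Hypotheses (p_pr : prime p) (p_gt3 : (3 < p)%N) (chK : p \in [pchar K]).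
Let m := (p %/ 3)%N.

(** Both sides satisfy the same recurrence in k: modulo p, 3 m is -1 or -2,
    and in both cases 9 (m + k + 1) (m - k) = - (3 k + 1) (3 k + 2). *)
Lemma central_bin_modp (k : nat) : (k <= m)%N ->
  'C(3 * k, k)%:R = (- 27) ^+ k * 'C(m + k, 2 * k)%:R :> K.
Proof.
elim: k => [|k IH] km; first by rewrite !muln0 !bin0 expr0 mulr1.
have mE : (m = k + (m - k.+1).+1)%N by lia.
set d := (m - k.+1)%N in mE.
have sN : ((k.+1 * (2 * k).+1 * (2 * k).+2)%:R : K) != 0.
  by rewrite !natrM !mulf_neq0 ?(natr_neq0p chK) //; lia.
have X9 : 9 * ((m + k.+1)%:R * d.+1%:R)
    = - ((3 * k).+1%:R * (3 * k).+2%:R) :> K.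
  have -> : d.+1%:R = m%:R - k%:R :> K by rewrite mE natrD; ring.
  have pE : (p%:R : K) = 0 by apply/eqP; rewrite -(dvdn_pcharf chK).
  transitivity ((3 * m%:R + (3 * k%:R + 3)) * (3 * m%:R - 3 * k%:R) : K).
    by ring.
  have [pm|pm] : p = (3 * m + 1)%N \/ p = (3 * m + 2)%N.
  - have p3 : p != 3%N by lia.
    by rewrite /m; case: (prime_mod3 p_pr p3); lia.
  - have -> : 3 * m%:R = - 1 :> K.
      by apply/eqP; rewrite -subr_eq0 -pE pm; apply/eqP; ring.
    by ring.
  have -> : 3 * m%:R = - 2 :> K.
    by apply/eqP; rewrite -subr_eq0 -pE pm; apply/eqP; ring.
  by ring.
have := congr1 (fun n : nat => n%:R : K) (central_bin_step k).
have := congr1 (fun n : nat => n%:R : K) (shifted_bin_step k d).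
have -> : (2 * k + d + 2 = m + k.+1)%N by lia.
have -> : (2 * k + d + 1 = m + k)%N by lia.
have e2 : ((2 * k).+2 = 2 * k.+1)%N by lia.
have e3 : ((3 * k).+3 = 3 * k.+1)%N by lia.
rewrite /= e2 e3 !natrM => sh ce.
apply: (mulIf sN); rewrite e2 !natrM ce IH ?(ltnW km) // exprS.
transitivity ((- 27) ^+ k * 'C(m + k, 2 * k)%:R * k.+1%:R * 3
  * ((3 * k).+1%:R * (3 * k).+2%:R) : K); first by ring.
transitivity (- 27 * (- 27) ^+ k * k.+1%:R * ('C(m + k.+1, 2 * k.+1)%:R
  * ((2 * k).+1%:R * (2 * k.+1%:R))) : K); last by ring.
rewrite sh; have -> : (3 * k).+1%:R * (3 * k).+2%:R
  = - (9 * ((m + k.+1)%:R * d.+1%:R)) :> K by rewrite X9 opprK.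
by ring.
Qed.

(** The terms match those of the expansion of U_(2m+1) one by one; the
    subtracted power of - Q is the term k = 0 of that expansion. *)
Lemma central_bin_sum (P Q : int) :
  (\sum_(1 <= k < m.+1)
     'C(3 * k, k)%:R * (P ^+ 2) ^+ k * (27 * Q) ^+ (m - k))%:~R
  = (- 27) ^+ m * ((lucasU P Q (2 * m).+1)%:~R - (- Q%:~R) ^+ m) :> K.
Proof.
rewrite -[LHS]addr0 -(subrr ((27 * Q%:~R) ^+ m : K)) addrA.
have -> : (\sum_(1 <= k < m.+1)
     'C(3 * k, k)%:R * (P ^+ 2) ^+ k * (27 * Q) ^+ (m - k))%:~R
     + (27 * Q%:~R) ^+ m
  = \sum_(k < m.+1)
     'C(3 * k, k)%:R * (P%:~R ^+ 2) ^+ k * (27 * Q%:~R) ^+ (m - k) :> K.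
  rewrite big_add1 /= big_mkord big_ord_recl /= muln0 bin0 expr0 mulr1 mul1r.
  rewrite subn0 addrC rmorph_sum; congr (_ + _); apply: eq_bigr => k _ /=.
  by rewrite !(rmorphM, rmorphXn) /= rmorph_nat.
have -> : (27 * Q%:~R) ^+ m = (- 27) ^+ m * (- Q%:~R) ^+ m :> K.
  by rewrite -exprMn mulrNN.
rewrite mulrBr; congr (_ - _).
rewrite lucasU_oddE /lucas_odd rmorph_sum big_distrr; apply: eq_bigr => k _ /=.
have km : (k <= m)%N by rewrite -ltnS.
rewrite !(rmorphM, rmorphXn, rmorphN) /= rmorph_nat central_bin_modp // exprM.
have -> : (- 27) ^+ m = (- 27) ^+ k * (- 27) ^+ (m - k) :> K.
  by rewrite -exprD subnKC.
have -> : (27 * Q%:~R) ^+ (m - k)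
  = (- 27) ^+ (m - k) * (- Q%:~R) ^+ (m - k) :> K.
  by rewrite -exprMn mulrNN.
by ring.
Qed.

End BinomialModP.

(** * The Lucas and binomial criteria *)

Lemma rat_congr_frac (p : nat) (N M : int) : M != 0 -> coprimez p%:Z M ->
  rat_congr p (N%:~R / M%:~R) 0 <-> (p%:Z %| N)%Z.
Proof.
move=> M0 pM; have MQ : (M%:~R : rat) != 0 by rewrite intr_eq0.
rewrite /rat_congr subr0; split=> [[r rint rE]|/dvdzP[N' ->]].
  have e : N * denq r = p%:Z * (numq r * M).
    apply: (@intr_inj rat); rewrite !rmorphM /= numqE.
    have -> : p%:Z%:~R = p%:R :> rat by [].
    by rewrite -[N%:~R](divfK MQ) rE; ring.
  by rewrite -(Gauss_dvdzl N rint) e dvdz_mulr.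
exists (N'%:~R / M%:~R); last by rewrite rmorphM mulrAC mulrC mulrA.
set r := _ / _; have e : M * numq r = N' * denq r.
  by apply: (@intr_inj rat); rewrite !rmorphM /= numqE mulrA [_ * r]mulrC divfK.
have dM : (denq r %| M)%Z.
  have cop : coprimez (denq r) (numq r).
    by rewrite coprimez_sym /coprimez /gcdz; apply/eqP; congr Posz;
       apply/eqP; apply: coprime_num_den.
  by rewrite -(Gauss_dvdzl M cop) e dvdz_mull.
by rewrite /p_integral; apply: coprimez_dvdr pM.
Qed.

Lemma central_bin_sum_rat (m : nat) (P Q : int) : Q != 0 ->
  \sum_(1 <= k < m.+1) ('C(3 * k, k))%:R * (P%:~R ^+ 2 / (27 * Q%:~R)) ^+ k
  = (\sum_(1 <= k < m.+1)
     'C(3 * k, k)%:R * (P ^+ 2) ^+ k * (27 * Q) ^+ (m - k))%:~R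
     / ((27 * Q) ^+ m)%:~R :> rat.
Proof.
move=> Q0; have D27Q : (27 * Q%:~R : rat) != 0.
  by rewrite mulf_neq0 // intr_eq0.
rewrite rmorph_sum big_distrl; apply: eq_big_nat => k /andP[_ km] /=.
rewrite !(rmorphM, rmorphXn) /= rmorph_nat expr_div_n -!mulrA.
congr (_ * (_ * _)).
have -> : (27 * Q%:~R : rat) ^+ m
    = (27 * Q%:~R) ^+ (m - k) * (27 * Q%:~R) ^+ k by rewrite -exprD subnK.
by rewrite invfM mulrA divff ?mul1r // expf_neq0.
Qed.

(** With v inverse to u, the equation amounts to (u^2 - 1) (u^2 r1 + r2) = 0. *)
Lemma twisted_diff (F : fieldType) (r1 r2 u v : F) :
  u * v = 1 -> u ^+ 2 * r1 + r2 != 0 -> (u ^+ 2 = 1 -> u = 1) ->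
  u ^+ 2 * r1 - v ^+ 2 * r2 = r1 - r2 <-> u = 1.
Proof.
move=> uv nd u2; split=> [e|u1]; last by rewrite -[v]mul1r -u1 uv u1; ring.
apply: u2; apply/eqP; rewrite -subr_eq0 -(mulIr_eq0 _ (mulIf nd)); apply/eqP.
transitivity (u ^+ 2 * (u ^+ 2 * r1 - v ^+ 2 * r2 - (r1 - r2))
  + ((u * v) ^+ 2 - 1) * r2); first by ring.
by rewrite e uv; ring.
Qed.

(** For p = 2 mod 3 the index 2m+1 is 2n - 1, one step below a double of n;
    multiplying by r1 r2 brings back the equation that arises for p = 1 mod 3. *)
Lemma twisted_diff_shift (F : fieldType) (r1 r2 A B c u v z : F) :
  r1 * r2 != 0 -> c != 0 -> r1 * A = (c * v) ^+ 2 -> r2 * B = (c * u) ^+ 2 ->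
  r1 * r2 * z = c ^+ 2 ->
  A - B = - z * (r1 - r2) <-> u ^+ 2 * r1 - v ^+ 2 * r2 = r1 - r2.
Proof.
move=> rrN cN AE BE zE.
have lE : r1 * r2 * (A - B) = c ^+ 2 * - (u ^+ 2 * r1 - v ^+ 2 * r2).
  transitivity (r2 * (r1 * A) - r1 * (r2 * B)); first by ring.
  by rewrite AE BE; ring.
have rE : r1 * r2 * (- z * (r1 - r2)) = c ^+ 2 * - (r1 - r2).
  by rewrite -zE; ring.
have c2N : c ^+ 2 != 0 by rewrite expf_neq0.
split=> [e|e]; first by apply/oppr_inj/(mulfI c2N); rewrite -lE -rE e.
by apply: (mulfI rrN); rewrite lE rE e.
Qed.

Section LucasCriteria.
Variables (p : nat) (a1 a2 a3 : int).
Hypotheses (p_pr : prime p) (p_gt3 : (3 < p)%N).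
Hypotheses (D0N : ~~ (p%:Z %| cubD0 a1 a2 a3)%Z)
           (P0N : ~~ (p%:Z %| cubP0 a1 a2 a3)%Z)
           (Q0N : ~~ (p%:Z %| cubQ0 a1 a2)%Z).
Local Notation K := (Fbar p).
Local Notation P0 := (cubP0 a1 a2 a3).
Local Notation Q0 := (cubQ0 a1 a2).
Local Notation n := (torus_index p).
Let chK := Fbar_pchar p_pr.
Variables (x1 x2 x3 w : K).
Hypotheses (rts : cubic_roots a1 a2 a3 x1 x2 x3)
           (frob : frob_spec a1 a2 a3 x1 x2 x3)
           (wE : w ^+ 2 + w + 1 = 0).

Let L1 := resolvent w x1 x2 x3.
Let L2 := resolvent (w ^+ 2) x1 x2 x3.
Let p3 : p != 3%N. Proof. by rewrite gtn_eqF. Qed.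

Let PE : (P0%:~R : K) = L1 ^+ 3 + L2 ^+ 3.
Proof. by rewrite (resolvent_cube_add rts wE). Qed.
Let QE : (Q0%:~R : K) = L1 ^+ 3 * L2 ^+ 3.
Proof. by rewrite (resolvent_cube_mul rts wE). Qed.
Let c0 : L1 * L2 != 0.
Proof. exact: (resolventM_neq0 p_pr Q0N rts wE). Qed.
Let r12 : L1 ^+ 3 - L2 ^+ 3 != 0.
Proof. exact: (resolvent_cube_neq p_pr p_gt3 D0N rts wE). Qed.
Let F := frob_resolvents p_pr p_gt3 D0N P0N Q0N rts frob wE
           (torus_index1 p_pr p3) (torus_index2 p_pr p3).

(** Equality of the two powers says u = v for the inverse pair of factors,
    that is u^2 = 1. *)
Lemma splits_root_powers :
  splits_mod p a1 a2 a3 <-> (L1 ^+ 3) ^+ n = (L2 ^+ 3) ^+ n.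
Proof.
have [u [v [uv spl u2 _ pw]]] := F.
have key : u = v <-> u = 1.
  split=> [e|u1]; first by apply: u2; rewrite expr2 {2}e.
  by rewrite u1 -uv u1 mul1r.
case: ifP pw => _ [-> ->]; first by split=> [/spl/key|/key/spl].
split=> [/spl/key ->//|/(mulfI c0) e]; apply/spl/key/esym/e.
Qed.

Lemma splits_lucasU :
  splits_mod p a1 a2 a3 <-> (p%:Z %| lucasU P0 Q0 n)%Z.
Proof.
rewrite splits_root_powers -(intr_eq0p chK) -(mulIr_eq0 _ (mulIf r12)).
by rewrite (lucasU_roots _ PE QE) subr_eq0; split=> /eqP.
Qed.

Lemma splits_lucasV : splits_mod p a1 a2 a3 <->
  (lucasV P0 Q0 n = 2 * (a1 ^+ 2 - 3 * a2) ^+ `|((1 - legendre p%:Z 3) %/ 2)%Z|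
     %[mod p%:Z])%Z.
Proof.
rewrite (rwP eqP) -(intr_eqp chK) (lucasV_roots _ PE QE).
rewrite legendre3 //.
have [u [v [uv spl u2 _ pw]]] := F.
have key : u + v = 2 <-> u = 1.
  split=> [e|u1]; last by rewrite u1 -[v]mul1r -u1 uv u1; ring.
  apply/eqP; rewrite -subr_eq0 -sqrf_eq0; apply/eqP.
  have -> : (u - 1) ^+ 2 = u ^+ 2 - u * 2 + 1 by ring.
  by rewrite -e mulrDr uv; ring.
case: ifP pw => _ [-> ->].
  rewrite [`|_|%N](_ : _ = 0%N) // expr0 mulr1.
  by split=> [/spl/key ->|/eqP/key/spl].
rewrite [`|_|%N](_ : _ = 1%N) // expr1 rmorphM /= -(resolvent_mul rts wE).
rewrite -mulrDr addrC [X in _ == X]mulrC.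
by split=> [/spl/key ->//|/eqP/(mulfI c0)/key/spl].
Qed.

Lemma odd_third : odd (p %/ 3) = (p %% 3 == 2)%N.
Proof.
have p_odd : odd p by case: (even_prime p_pr) p_gt3 => [->|].
by case: (prime_mod3 p_pr p3) => pm; rewrite pm; lia.
Qed.

Lemma splits_lucasU_odd : ~~ (p%:Z %| P0 ^+ 2 - 3 * Q0)%Z ->
  splits_mod p a1 a2 a3 <->
  (lucasU P0 Q0 (2 * (p %/ 3)).+1)%:~R = (- Q0%:~R) ^+ (p %/ 3) :> K.
Proof.
move=> nondeg; have [u [v [uv spl u2 nd pw]]] := F.
have {}nd := nd nondeg.
have [r1 r1E] : exists r1, r1 = L1 ^+ 3 by exists (L1 ^+ 3).
have [r2 r2E] : exists r2, r2 = L2 ^+ 3 by exists (L2 ^+ 3).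
rewrite -!r1E -!r2E in pw nd.
have PEr : (P0%:~R : K) = r1 + r2 by rewrite r1E r2E.
have QEr : (Q0%:~R : K) = r1 * r2 by rewrite r1E r2E.
have r12N : r1 - r2 != 0 by rewrite r1E r2E.
have key : u ^+ 2 * r1 - v ^+ 2 * r2 = r1 - r2 <-> u = 1.
  exact: twisted_diff.
have r1N : r1 != 0.
  by rewrite r1E expf_neq0 //; apply: contraNneq c0 => ->; rewrite mul0r.
have r2N : r2 != 0.
  by rewrite r2E expf_neq0 //; apply: contraNneq c0 => ->; rewrite mulr0.
have mulE : (lucasU P0 Q0 (2 * (p %/ 3)).+1)%:~R = (- Q0%:~R) ^+ (p %/ 3) :> K
    <-> r1 ^+ (2 * (p %/ 3)).+1 - r2 ^+ (2 * (p %/ 3)).+1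
        = (- Q0%:~R) ^+ (p %/ 3) * (r1 - r2).
  by rewrite -(lucasU_roots _ PEr QEr); split=> [->//|/(mulIf r12N)].
(* p %/ 3 is even or odd according to the class of p modulo 3. *)
rewrite {}mulE [(- _) ^+ _]exprNn -signr_odd odd_third.
case: (prime_mod3 p_pr p3) => pm; rewrite pm /= in pw *.
  rewrite -(torus_index1_div p_pr p3 pm).
  case: pw => e1 e2.
  rewrite mul1r QEr exprMn e1 e2 uv mul1r !exprSr ![(2 * n)%N]mulnC !exprM e1 e2.
  by split=> [/spl/key|/key/spl].
have nE := torus_index2_div p_pr p3 pm.
case: pw => e1 e2.
have sq (r z : K) : r ^+ n = z -> r * r ^+ (2 * (p %/ 3)).+1 = z ^+ 2.
  by move=> <-; rewrite -exprS -exprM nE muln2 mul2n doubleS.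
have QmE : r1 * r2 * Q0%:~R ^+ (p %/ 3) = (L1 * L2) ^+ 2.
  by rewrite QEr -exprS -nE exprMn e1 e2 mulrACA [v * u]mulrC uv mulr1 expr2.
have {}e1 := sq _ _ e1; have {}e2 := sq _ _ e2.
by rewrite expr1 mulN1r (twisted_diff_shift _ c0 e1 e2 QmE) ?mulf_neq0 // key spl.
Qed.

Lemma splits_binomial_sum : ~~ (p%:Z %| P0 ^+ 2 - 3 * Q0)%Z ->
  splits_mod p a1 a2 a3 <->
  rat_congr p (\sum_(1 <= k < (p %/ 3).+1)
     ('C(3 * k, k))%:R * (P0%:~R ^+ 2 / (27 * Q0%:~R)) ^+ k) 0.
Proof.
move=> nondeg; rewrite splits_lucasU_odd //; set m := (p %/ 3)%N.
have Qn0 : Q0 != 0 by apply: contraNneq Q0N => ->; apply: dvdz0.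
have D27 : 27 * Q0 != 0 by rewrite mulf_neq0.
have cop : coprimez p%:Z (27 * Q0).
  rewrite coprimezMr; apply/andP; split.
    rewrite -[27]/(3 ^+ 3 : int) coprimezXr //.
    by rewrite /coprimez /gcdz /= -[_ == _]/(coprime p 3) prime_coprime // gtnNdvd.
  by rewrite /coprimez /gcdz -[_ == _]/(coprime p `|Q0|%N) prime_coprime.
rewrite central_bin_sum_rat //.
rewrite rat_congr_frac ?expf_neq0 ?coprimezXr //.
rewrite -(intr_eq0p chK) (central_bin_sum p_pr p_gt3 chK).
have N27 : (- 27 : K) ^+ m != 0.
  have -> : - 27 = - (3 ^+ 3) :> K by ring.
  by rewrite expf_neq0 // oppr_eq0 expf_neq0 // (p3_neq0 p_pr).
rewrite mulf_eq0 (negPf N27) /= subr_eq0.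
by split=> /eqP.
Qed.

End LucasCriteria.

(** * Eisenstein integers and their evaluations *)

Definition eis_conj (x : eis) : eis := Eis (eis1 x - eisw x) (- eisw x).

Lemma eis_addE x y : x + y = Eis (eis1 x + eis1 y) (eisw x + eisw y).
Proof. by []. Qed.

Lemma eis_oppE x : - x = Eis (- eis1 x) (- eisw x).
Proof. by []. Qed.

Lemma eis_mulE x y : x * y = Eis (eis1 x * eis1 y - eisw x * eisw y)
      (eis1 x * eisw y + eisw x * eis1 y - eisw x * eisw y).
Proof. by []. Qed.

Lemma eis_natE n : n%:R = Eis n 0 :> eis.
Proof. by elim: n => // n IH; rewrite -natr1 IH eis_addE /=; congr Eis; lia. Qed.

Lemma eis_intE (z : int) : z%:~R = Eis z 0 :> eis.
Proof.
by case: z => n; rewrite ?NegzE ?rmorphN /= -?pmulrn eis_natE ?eis_oppE.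
Qed.

Lemma eis_conjK : involutive eis_conj.
Proof. by case=> a b; rewrite /eis_conj /=; congr Eis; ring. Qed.

Lemma eis_conjM x y : eis_conj (x * y) = eis_conj x * eis_conj y.
Proof. by case: x y => [a b] [c d]; rewrite !eis_mulE /eis_conj /=; congr Eis; ring. Qed.

Lemma eis_conj_int (z : int) : eis_conj z%:~R = z%:~R.
Proof. by rewrite eis_intE /eis_conj /=; congr Eis; ring. Qed.

Lemma eis_normM x y : eis_norm (x * y) = eis_norm x * eis_norm y.
Proof. by case: x y => [a b] [c d]; rewrite eis_mulE /eis_norm /=; ring. Qed.

Lemma eis_norm_conj x : eis_norm (eis_conj x) = eis_norm x.
Proof. by case: x => [a b]; rewrite /eis_norm /eis_conj /=; ring. Qed.

Lemma eis_mul_conj x : x * eis_conj x = (eis_norm x)%:~R.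
Proof.
case: x => [a b]; rewrite eis_intE eis_mulE /eis_norm /eis_conj /=.
by congr Eis; ring.
Qed.

Lemma eis_norm_int (z : int) : eis_norm z%:~R = z ^+ 2.
Proof. by rewrite eis_intE /eis_norm /=; ring. Qed.

Lemma eis_norm_ge0 x : 0 <= eis_norm x.
Proof. case: x => a b; rewrite /eis_norm /=; nia. Qed.

Lemma eis_norm_eq0 x : eis_norm x = 0 -> x = 0.
Proof.
by case: x => a b; rewrite /eis_norm /= => e; congr Eis; nia.
Qed.

Definition eis_theta : eis := Eis 1 2.

Definition sqrtm3 (c d : int) : eis := Eis (c + d) (2 * d).

Section Evaluation.
Variables (K : fieldType) (w : K).
Hypothesis wE : w ^+ 2 + w + 1 = 0.

(** For w a primitive cube root of unity this is the ring morphism sending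
    omega to w; in characteristic q its kernel is a prime ideal above q. *)
Definition ev (x : eis) : K := (eis1 x)%:~R + (eisw x)%:~R * w.

Lemma evM x y : ev (x * y) = ev x * ev y.
Proof.
case: x y => [a b] [c d]; rewrite eis_mulE /ev /=.
rewrite !(rmorphB, rmorphD, rmorphM) /=.
transitivity ((a%:~R + b%:~R * w) * (c%:~R + d%:~R * w)
  - b%:~R * d%:~R * (w ^+ 2 + w + 1)); first by ring.
by rewrite wE mulr0 subr0.
Qed.

Lemma evD x y : ev (x + y) = ev x + ev y.
Proof. by case: x y => [a b] [c d]; rewrite eis_addE /ev /=; ring. Qed.

Lemma evN x : ev (- x) = - ev x.
Proof. by case: x => [a b]; rewrite eis_oppE /ev /=; ring. Qed.

Lemma evB x y : ev (x - y) = ev x - ev y.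
Proof. by rewrite evD evN. Qed.

Lemma ev_int (z : int) : ev z%:~R = z%:~R.
Proof. by rewrite eis_intE /ev /= mulr0z mul0r addr0. Qed.

Lemma evX x n : ev (x ^+ n) = ev x ^+ n.
Proof.
elim: n => [|n IH]; first by rewrite !expr0 -(mulr1z (1 : eis)) ev_int.
by rewrite !exprS evM IH.
Qed.

Lemma ev_omega : ev omega = w.
Proof. by rewrite /ev /= mulr0z mul1r add0r. Qed.

Lemma evJ x : ev (eis_conj x) = (eis1 x)%:~R + (eisw x)%:~R * w ^+ 2.
Proof.
case: x => a b; rewrite /ev /eis_conj /= (cube_root2 wE); ring.
Qed.

Lemma ev_norm x : ev x * ev (eis_conj x) = (eis_norm x)%:~R.
Proof. by rewrite -evM eis_mul_conj ev_int. Qed.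

Lemma cube_root_sqr : (w ^+ 2) ^+ 2 + w ^+ 2 + 1 = 0.
Proof.
transitivity ((w ^+ 2 + w + 1) * (w ^+ 2 - w + 1)); first by ring.
by rewrite wE mul0r.
Qed.

End Evaluation.

Lemma ev_sqr (K : fieldType) (w : K) (x : eis) : w ^+ 2 + w + 1 = 0 ->
  ev (w ^+ 2) x = ev w (eis_conj x).
Proof. by move=> wE; rewrite evJ. Qed.

Lemma cube_root_cases (K : fieldType) (w w' : K) :
  w ^+ 2 + w + 1 = 0 -> w' ^+ 2 + w' + 1 = 0 -> w' = w \/ w' = w ^+ 2.
Proof.
move=> wE w'E; have : (w' - w) * (w' - w ^+ 2) = 0.
  rewrite (cube_root2 wE); transitivity ((w' ^+ 2 + w' + 1) - (w ^+ 2 + w + 1)).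
    by ring.
  by rewrite wE w'E subrr.
by move/eqP; rewrite mulf_eq0 !subr_eq0 => /orP[]/eqP; [left|right].
Qed.

Section EvalFrobenius.
Variables (q : nat) (K : fieldType) (w : K).
Hypotheses (q_pr : prime q) (q3 : q != 3%N) (chK : q \in [pchar K]).
Hypothesis wE : w ^+ 2 + w + 1 = 0.

(** Frobenius fixes or exchanges the primitive cube roots of unity according
    to the class of q modulo 3. *)
Lemma ev_frob x :
  ev w x ^+ q = if (q %% 3 == 1)%N then ev w x else ev w (eis_conj x).
Proof.
rewrite evJ // {1}/ev (exprDp chK) exprMn !(expr_intp chK) (cube_root_mod wE q).
by case: (prime_mod3 q_pr q3) => ->.
Qed.

Lemma three_neq0 : (3 : K) != 0.
Proof. by rewrite -(dvdn_pcharf chK) dvdn_prime2. Qed.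

Lemma cube_root_expr_inj i j : w ^+ i = w ^+ j -> (i = j %[mod 3])%N.
Proof.
rewrite (cube_root_mod wE i) (cube_root_mod wE j).
have w1 := cube_root_neq1 wE three_neq0.
have w0 := cube_root_neq0 wE.
have w2 : w ^+ 2 != 1.
  by apply: contraNneq w1 => e; rewrite -(cube_root3 wE) exprS e mulr1.
have w12 : w ^+ 2 != w.
  by apply: contraNneq w1 => e; apply/eqP/(mulfI w0); rewrite mulr1 -expr2.
have := ltn_pmod i (isT : (0 < 3)%N); have := ltn_pmod j (isT : (0 < 3)%N).
move: (i %% 3)%N (j %% 3)%N => a b.
case: b => [|[|[|//]]] _; case: a => [|[|[|//]]] _ //;
  rewrite ?expr0 ?expr1 => /eqP; rewrite ?(negPf w1) ?(negPf w2) ?(negPf w12) //;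
  by rewrite eq_sym ?(negPf w1) ?(negPf w2) ?(negPf w12).
Qed.

End EvalFrobenius.

(** * The cubic symbol at a rational prime *)

Lemma cbrt1_subproof (q : nat) : exists w : Fbar q, w ^+ 2 + w + 1 == 0.
Proof. by have [w /eqP wE] := cube_root_exists (Fbar q); exists w. Qed.

Definition cbrt1 (q : nat) : Fbar q := xchoose (cbrt1_subproof q).

Lemma cbrt1P (q : nat) : cbrt1 q ^+ 2 + cbrt1 q + 1 = 0.
Proof. exact/eqP/(xchooseP (cbrt1_subproof q)). Qed.

(** The exponent e of omega in the cubic residue symbol of x modulo q. It is
    normalised by (x / conj x)^k = w^(q e), where k is the torus index: this
    covers split and inert primes at once, and the value does not change when
    w is replaced by its conjugate. Exponents in 'F_3 turn products of symbols
    into sums. *)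
Definition local_symbol (x : eis) (q : nat) : 'F_3 :=
  let w := cbrt1 q in let k := torus_index q in
  if ev w x ^+ k == ev w (eis_conj x) ^+ k then 0
  else if ev w x ^+ k == w ^+ q * ev w (eis_conj x) ^+ k then 1 else 2.

Lemma F3_nat (i : nat) : (i%:R : 'F_3) = (i %% 3)%N :> nat.
Proof. by rewrite /= val_Fp_nat. Qed.

Lemma F3_natK (e : 'F_3) : (e : nat)%:R = e.
Proof. by apply: ord_inj; rewrite F3_nat modn_small. Qed.

Lemma F3_eq (i j : nat) : (i = j %[mod 3])%N -> (i%:R = j%:R :> 'F_3).
Proof. by move=> e; apply: ord_inj; rewrite !F3_nat. Qed.

Lemma F3_0 : (3 : 'F_3) = 0.
Proof. exact: (F3_eq (erefl : 3 = 0 %[mod 3])). Qed.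

Lemma local_symbol_congr (q : nat) (x y : eis) : prime q ->
  (q%:Z %| eis1 x - eis1 y)%Z -> (q%:Z %| eisw x - eisw y)%Z ->
  local_symbol x q = local_symbol y q.
Proof.
move=> q_pr; rewrite -!(intr_eq0p (Fbar_pchar q_pr)) !rmorphB /= !subr_eq0.
move=> /eqP e1 /eqP e2.
have ex : ev (cbrt1 q) x = ev (cbrt1 q) y by rewrite /ev e1 e2.
have ec : ev (cbrt1 q) (eis_conj x) = ev (cbrt1 q) (eis_conj y).
  by rewrite !(evJ (cbrt1P q)) e1 e2.
by rewrite /local_symbol ex ec.
Qed.

Lemma local_symbol_real (q : nat) (x : eis) : eis_conj x = x ->
  local_symbol x q = 0.
Proof. by rewrite /local_symbol => ->; rewrite eqxx. Qed.

Section LocalSymbol.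
Variables (q : nat).
Hypotheses (q_pr : prime q) (q3 : q != 3%N).
Local Notation K := (Fbar q).
Local Notation w := (cbrt1 q).
Local Notation k := (torus_index q).
Let chK := Fbar_pchar q_pr.
Let wE := cbrt1P q.

Lemma torus_index_even : (q != 2)%N -> ~~ odd k.
Proof.
move=> q2; have q_odd : odd q by case: (even_prime q_pr) q2 => [->|].
case: (prime_mod3 q_pr q3) => qm.
  by have := torus_index1 q_pr q3 qm; lia.
by have := torus_index2 q_pr q3 qm; lia.
Qed.

(** Here x / conj x = -1, while k is even unless q = 2. *)
Lemma local_symbol_anti (x : eis) : eis_conj x = - x -> local_symbol x q = 0.
Proof.
rewrite /local_symbol => ->; rewrite evN; case: (eqVneq q 2%N) => q2.
  have ch2 : 2%N \in [pchar K] by rewrite -{1}q2.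
  by rewrite oppr_pchar2 // eqxx.
by rewrite exprNn -signr_odd (negPf (torus_index_even q2)) mul1r eqxx.
Qed.

(** x / conj x is a 3k-th root of unity modulo q, so its k-th power is a cube
    root of unity. *)
Lemma local_symbolP (x : eis) : ~~ (q%:Z %| eis_norm x)%Z ->
  ev w x ^+ k = w ^+ (q * local_symbol x q) * ev w (eis_conj x) ^+ k.
Proof.
rewrite -(intr_eq0p chK) -(ev_norm wE) mulf_eq0 negb_or => /andP[A0 B0].
have fr := ev_frob q_pr q3 chK wE; have w3 := cube_root3 wE.
set A := ev w x in A0 *; set B := ev w (eis_conj x) in B0 *.
have AB3 : (A ^+ k) ^+ 3 = (B ^+ k) ^+ 3.
  rewrite -!exprM ![(k * 3)%N]mulnC; case: (prime_mod3 q_pr q3) => qm.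
    apply: (mulIf (mulf_neq0 A0 B0)).
    rewrite mulrA -exprSr -(torus_index1 q_pr q3 qm) mulrCA -exprSr.
    by rewrite -(torus_index1 q_pr q3 qm) !fr qm mulrC.
  rewrite (torus_index2 q_pr q3 qm) !exprS !fr qm /= eis_conjK.
  by rewrite mulrC.
have : (A ^+ k - B ^+ k) * (A ^+ k - w ^+ q * B ^+ k)
    * (A ^+ k - w ^+ (q * 2) * B ^+ k) = 0.
  rewrite exprM; set z := w ^+ q; have zE : z ^+ 2 + z + 1 = 0.
    rewrite /z (cube_root_mod wE q); case: (prime_mod3 q_pr q3) => -> //.
    by rewrite -[RHS](cube_root_sqr wE).
  transitivity ((A ^+ k) ^+ 3 - (B ^+ k) ^+ 3 + (z ^+ 2 + z + 1) * (
     (A ^+ k) * (B ^+ k) ^+ 2 * z - (A ^+ k) ^+ 2 * B ^+ k - (B ^+ k) ^+ 3 * (z - 1))).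
    by ring.
  by rewrite AB3 zE subrr mul0r addr0.
rewrite /local_symbol -/A -/B.
case: ifP => [/eqP -> _|nA]; first by rewrite muln0 mul1r.
case: ifP => [/eqP -> _|nB]; first by rewrite muln1.
by move/eqP; rewrite !mulf_eq0 !subr_eq0 nA nB /= => /eqP.
Qed.

(** The other root w^2 exchanges the two evaluations of x and inverts w, which
    leaves the normalisation unchanged; so any root may be used to find the
    symbol. *)
Lemma local_symbol_uniq (w' : K) (x : eis) (i : nat) :
  w' ^+ 2 + w' + 1 = 0 -> ~~ (q%:Z %| eis_norm x)%Z ->
  ev w' x ^+ k = w' ^+ (q * i) * ev w' (eis_conj x) ^+ k ->
  local_symbol x q = i%:R.
Proof.
move=> w'E nx; have spec := local_symbolP nx; move: nx.
rewrite -(intr_eq0p chK) -(ev_norm wE) mulf_eq0 negb_or => /andP[A0 B0].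
have w3 := cube_root3 wE.
wlog: w' w'E / w' = w.
  move=> H; case: (cube_root_cases wE w'E) => [w'w|->]; first exact: H.
  rewrite !(ev_sqr _ wE) eis_conjK => e; apply: (H w) => //.
  rewrite e mulrA -exprM -exprD.
  rewrite [w ^+ _](cube_root_mod wE) (_ : (_ %% 3)%N = 0%N) ?mul1r //; lia.
move=> -> e; have : w ^+ (q * local_symbol x q) = w ^+ (q * i).
  by apply: (mulIf (expf_neq0 k B0)); rewrite -spec -e.
move/(cube_root_expr_inj q_pr q3 chK wE)/eqP => eqm.
rewrite -[LHS]F3_natK; apply: F3_eq; apply/eqP.
move: eqm; rewrite /=; case: (prime_mod3 q_pr q3); lia.
Qed.

Lemma local_symbolM (x y : eis) :
  ~~ (q%:Z %| eis_norm x)%Z -> ~~ (q%:Z %| eis_norm y)%Z ->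
  local_symbol (x * y) q = local_symbol x q + local_symbol y q.
Proof.
move=> nx ny; rewrite -[RHS]F3_natK -[local_symbol x q]F3_natK.
rewrite -[local_symbol y q]F3_natK -natrD F3_natK.
apply: (local_symbol_uniq wE).
  rewrite eis_normM -(intr_eq0p chK) rmorphM mulf_eq0 !(intr_eq0p chK).
  by rewrite negb_or nx.
have exE (a b : K) : (a * b) ^+ k = a ^+ k * b ^+ k by apply: exprMn.
rewrite eis_conjM !(evM wE) !exE (local_symbolP nx) (local_symbolP ny) mulnDr.
by rewrite exprD; apply: mulrACA.
Qed.

Lemma local_symbolJ (x : eis) : ~~ (q%:Z %| eis_norm x)%Z ->
  local_symbol (eis_conj x) q = - local_symbol x q.
Proof.
move=> nx; apply/eqP; rewrite -addr_eq0; apply/eqP.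
rewrite -local_symbolM ?eis_norm_conj // mulrC eis_mul_conj.
by apply: local_symbol_real; rewrite eis_conj_int.
Qed.

Lemma local_symbol_omega : local_symbol omega q = (q ^ 2 %/ 3)%:R.
Proof.
apply: (local_symbol_uniq wE).
  by rewrite (_ : eis_norm omega = 1) // dvdz1 neq_ltn prime_gt1 ?orbT.
rewrite ev_omega (evJ wE) /= mulr0z mul1r add0r -exprM -exprD.
rewrite (cube_root_mod wE k) [RHS](cube_root_mod wE); congr (_ ^+ _).
case: (prime_mod3 q_pr q3) => qm.
  have qE := torus_index1 q_pr q3 qm; move: k qE => m qE.
  have -> : (q ^ 2 %/ 3 = 3 * m ^ 2 + 2 * m)%N.
    have -> : (q ^ 2 = (3 * m ^ 2 + 2 * m) * 3 + 1)%N by rewrite qE; ring.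
    by rewrite divnMDl // addn0.
  rewrite qE (_ : _ + _ = 3 * (3 * m ^ 3 + 3 * m ^ 2 + m) + m)%N; last by ring.
  by rewrite mulnC modnMDl.
have qE := torus_index2 q_pr q3 qm; move: k qE => [|m] qE; first lia.
have {}qE : q = (3 * m + 2)%N by lia.
have -> : (q ^ 2 %/ 3 = 3 * m ^ 2 + 4 * m + 1)%N.
  have -> : (q ^ 2 = (3 * m ^ 2 + 4 * m + 1) * 3 + 1)%N by rewrite qE; ring.
  by rewrite divnMDl // addn0.
rewrite qE (_ : _ + _ = 3 * (3 * m ^ 3 + 6 * m ^ 2 + 4 * m + 1) + m.+1)%N.
  by rewrite mulnC modnMDl.
by ring.
Qed.

End LocalSymbol.

(** * The cubic symbol at a rational integer *)

(** The cubic Jacobi symbol of x with rational denominator n, as an exponent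
    of omega. *)
Definition symbol (x : eis) (n : int) : 'F_3 :=
  \sum_(0 <= q < `|n|.+1) (logn q `|n|)%:R * local_symbol x q.

(** Under this condition no prime factor of n is ramified or divides x or its
    conjugate, and the symbol at n is additive in x. *)
Definition admissible (n : int) (x : eis) := coprimez n (3 * eis_norm x).

Lemma symbol_widen (x : eis) (n : int) (N : nat) : (`|n| <= N)%N ->
  symbol x n = \sum_(0 <= q < N.+1) (logn q `|n|)%:R * local_symbol x q.
Proof.
move=> nN; rewrite (big_cat_nat (n := `|n|.+1)) //= [X in _ = _ + X]big_nat_cond.
rewrite [X in _ = _ + X]big1 ?addr0 // => q /andP[/andP[nq _] _].
suff -> : logn q `|n| = 0%N by rewrite mul0r.
apply/eqP; rewrite -leqn0 leqNgt logn_gt0 mem_primes; apply/negP.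
by case/and3P=> _ n0 /(dvdn_leq n0); rewrite leqNgt nq.
Qed.

Lemma symbolM (x : eis) (m n : int) : m != 0 -> n != 0 ->
  symbol x (m * n) = symbol x m + symbol x n.
Proof.
rewrite -!absz_gt0 => m0 n0.
rewrite (@symbol_widen x m `|m * n|) ?(@symbol_widen x n `|m * n|);
  try by rewrite abszM (leq_pmulr, leq_pmull).
rewrite -big_split; apply: eq_bigr => q _ /=.
by rewrite abszM lognM // natrD mulrDl.
Qed.

Lemma symbol_eq (x y : eis) (n : int) :
  (forall q, prime q -> (q %| `|n|)%N -> local_symbol x q = local_symbol y q) ->
  symbol x n = symbol y n.
Proof.
move=> e; apply: eq_bigr => q _; have [->|] := posnP (logn q `|n|).
  by rewrite !mul0r.
by rewrite logn_gt0 mem_primes => /and3P[q_pr _ qn]; rewrite e.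
Qed.

Lemma symbolN (x : eis) (n : int) : symbol x (- n) = symbol x n.
Proof. by rewrite /symbol abszN. Qed.

Lemma symbol1 (x : eis) : symbol x 1 = 0.
Proof.
by rewrite /symbol big1 // => q _; rewrite logn1 mul0r.
Qed.

Lemma symbol_congr (x y : eis) (n : int) :
  (n %| eis1 x - eis1 y)%Z -> (n %| eisw x - eisw y)%Z ->
  symbol x n = symbol y n.
Proof.
move=> e1 e2; apply: symbol_eq => q q_pr qn.
by apply: local_symbol_congr => //; [apply: dvdz_trans e1|apply: dvdz_trans e2].
Qed.

Lemma symbol_int (z n : int) : symbol z%:~R n = 0.
Proof.
rewrite /symbol big1 // => q _.
by rewrite local_symbol_real ?mulr0 ?eis_conj_int.
Qed.

Lemma coprimez_prime (n N : int) (q : nat) : coprimez n N -> prime q ->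
  (q %| `|n|)%N -> ~~ (q%:Z %| N)%Z.
Proof.
move=> cop q_pr qn; apply/negP => qN.
have : (q%:Z %| gcdz n N)%Z by rewrite dvdz_gcd qN andbT.
by rewrite (eqP cop) dvdz1 /= => /eqP q1; rewrite q1 in q_pr.
Qed.

Lemma coprimez_primeP (n N : int) :
  (forall q : nat, prime q -> (q%:Z %| n)%Z -> ~~ (q%:Z %| N)%Z) -> coprimez n N.
Proof.
move=> H; rewrite /coprimez /gcdz -[_ == _]/(gcdn `|n| `|N| == 1)%N.
case: (ltngtP (gcdn `|n| `|N|) 1) => // [|g1].
  rewrite ltnS leqNgt gcdn_gt0 !absz_gt0 negb_or !negbK => /andP[/eqP n0 /eqP N0].
  by have := H 2%N isT; rewrite n0 N0 dvdz0 => /(_ isT).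
have := H _ (pdiv_prime g1); have := pdiv_dvd (gcdn `|n| `|N|).
rewrite dvdn_gcd => /andP[d1 d2].
by rewrite /dvdz /= !unfold_in /= d1 d2 => /(_ isT).
Qed.

Lemma admissible_prime (n : int) (x : eis) (q : nat) : admissible n x ->
  prime q -> (q %| `|n|)%N -> q != 3%N /\ ~~ (q%:Z %| eis_norm x)%Z.
Proof.
move=> adm q_pr qn; have := coprimez_prime adm q_pr qn.
split; first by apply: contraNneq H => ->; apply: dvdz_mulr.
by apply: contraNN H => h; apply: dvdz_mull.
Qed.

Lemma symbolMl (x y : eis) (n : int) : admissible n x -> admissible n y ->
  symbol (x * y) n = symbol x n + symbol y n.
Proof.
move=> ax ay; rewrite /symbol -big_split; apply: eq_bigr => q _ /=.
have [->|] := posnP (logn q `|n|); first by rewrite !mul0r addr0.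
rewrite logn_gt0 mem_primes => /and3P[q_pr _ qn]; rewrite -mulrDr.
have [q3 nx] := admissible_prime ax q_pr qn.
have [_ ny] := admissible_prime ay q_pr qn.
by rewrite local_symbolM.
Qed.

Lemma symbolJ (x : eis) (n : int) : admissible n x ->
  symbol (eis_conj x) n = - symbol x n.
Proof.
move=> ax; rewrite /symbol -sumrN; apply: eq_bigr => q _ /=.
have [->|] := posnP (logn q `|n|); first by rewrite !mul0r oppr0.
rewrite logn_gt0 mem_primes => /and3P[q_pr _ qn].
have [q3 nx] := admissible_prime ax q_pr qn.
by rewrite local_symbolJ // mulrN.
Qed.

Lemma symbol_anti (x : eis) (n : int) : ~~ (3 %| n)%Z -> eis_conj x = - x ->
  symbol x n = 0.
Proof.
move=> n3 xJ; rewrite /symbol big1 // => q _.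
have [->|] := posnP (logn q `|n|); first by rewrite mul0r.
rewrite logn_gt0 mem_primes => /and3P[q_pr _ qn].
rewrite local_symbol_anti ?mulr0 //.
by apply: contraNneq n3 => q3; rewrite q3 in qn.
Qed.

Lemma admissible_neq0 (n : int) (x : eis) : admissible n x -> n != 0.
Proof.
by move=> a; apply: contraTneq a => ->; rewrite /admissible /coprimez gcd0z; lia.
Qed.

Lemma admissible_not3 (n : int) (x : eis) : admissible n x -> ~~ (3 %| n)%Z.
Proof.
move=> adm; apply/negP => n3; have := @admissible_prime _ _ 3 adm isT n3.
by case.
Qed.

Lemma symbol_prime (x : eis) (q : nat) : prime q ->
  symbol x q%:Z = local_symbol x q.
Proof.
move=> q_pr; rewrite /symbol absz_nat big_nat_recr //= logn_prime // eqxx mul1r.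
rewrite big_nat_cond big1 ?add0r // => r /andP[/andP[_ rq] _].
by rewrite logn_prime // ltn_eqF // mul0r.
Qed.

(** S singles out the moduli on which f is additive; the symbol is determined
    by its values at the primes. *)
Lemma symbol_multiplicative (x : eis) (S : nat -> bool) (f : nat -> 'F_3) :
  (forall m n, S (m * n)%N -> S m && S n) -> f 1%N = 0 ->
  (forall m n, S (m * n)%N -> f (m * n)%N = f m + f n) ->
  (forall q, prime q -> S q -> local_symbol x q = f q) ->
  forall n : int, n != 0 -> S `|n|%N -> symbol x n = f `|n|%N.
Proof.
move=> Sdiv f1 fM fq n n0.
have -> : symbol x n = symbol x `|n|%:Z by rewrite /symbol.
move: n0; rewrite -absz_gt0; move: `|n|%N => {}n.
have [N] := ubnP n; elim: N n => // N IH n nN n0 Sn.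
have [n1|n1] := leqP n 1.
  have -> : n = 1%N by lia.
  by rewrite symbol1 f1.
have q_pr := pdiv_prime n1; set q := pdiv n in q_pr.
have [m nE] := dvdnP (pdiv_dvd n); rewrite -/q in nE.
have m0 : (0 < m)%N by case: m nE n0 => [->|].
have mN : (m < N)%N by move: nE (prime_gt1 q_pr) nN m0; nia.
have mz : m%:Z != 0 by rewrite eqz_nat -lt0n.
have qz : q%:Z != 0 by rewrite eqz_nat -lt0n prime_gt0.
rewrite nE in Sn *; have /andP[Sm Sq] := Sdiv _ _ Sn.
by rewrite PoszM symbolM // (symbol_prime _ q_pr) IH // fq // fM.
Qed.

Lemma symbol_omega (n : int) : ~~ (3 %| n)%Z ->
  symbol omega n = (`|n| ^ 2 %/ 3)%:R.
Proof.
move=> n3; have nz : n != 0 by apply: contraNneq n3 => ->.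
apply: (symbol_multiplicative (S := fun m => ~~ (3 %| m)%N)
          (f := fun m => (m ^ 2 %/ 3)%:R)) => //.
- by move=> a b; rewrite Euclid_dvdM // negb_or.
- move=> a b; rewrite Euclid_dvdM // negb_or => /andP[a3 b3].
  have sq (c : nat) : ~~ (3 %| c)%N -> exists b, (c ^ 2 = b * 3 + 1)%N.
    move=> c3; have : (c %% 3 = 1 \/ c %% 3 = 2)%N by lia.
    case=> cE; rewrite (divn_eq c 3) cE; move: (c %/ 3)%N => d.
      by exists (3 * d ^ 2 + 2 * d)%N; ring.
    by exists (3 * d ^ 2 + 4 * d + 1)%N; ring.
  have [c cE] := sq _ a3; have [d dE] := sq _ b3.
  rewrite expnMn cE dE !divnMDl // !addn0 -natrD; apply: F3_eq.
  have -> : ((c * 3 + 1) * (d * 3 + 1) = (3 * c * d + c + d) * 3 + 1)%N by ring.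
  by rewrite divnMDl // addn0 -addnA -mulnA mulnC modnMDl.
move=> q q_pr q3; apply: local_symbol_omega => //.
by apply: contraNneq q3 => ->.
Qed.

(** The supplementary law for omega: (n^2 - 1)/3 modulo 3 depends on n modulo
    9. *)
Lemma symbol_omega_congr (m n : int) : ~~ (3 %| m)%Z -> ~~ (3 %| n)%Z ->
  (9 %| m - n)%Z -> symbol omega m = symbol omega n.
Proof.
move=> m3 n3 d; rewrite !symbol_omega //; apply: F3_eq.
have [z zE] := dvdzP d.
have e : (`|m| ^ 2)%N%:Z - (`|n| ^ 2)%N%:Z = 9 * (z * (m + n)).
  rewrite -!mulnn !PoszM !abszE -!normrM !ger0_norm -?expr2 ?sqr_ge0 //.
  by rewrite mulrA [9 * z]mulrC -zE; ring.
move: (`|m| ^ 2)%N (`|n| ^ 2)%N (z * (m + n)) e => A B C; lia.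
Qed.

(** * Cubic Gauss sums *)

(** The logarithm of a cubic character of 'F_l. The convention at 0 lets sums
    of logarithms range over the whole field. *)
Record cubic_log (l : nat) (lam : 'F_l -> 'F_3) : Prop := CubicLog {
  cubic_log0 : lam 0 = 0;
  cubic_logM : forall s t, s != 0 -> t != 0 -> lam (s * t) = lam s + lam t;
  cubic_log_nontriv : exists2 t, t != 0 & lam t != 0 }.

(** t^((l-1)/3) is a cube root of unity in 'F_l; it is not always 1, as 'X^k -
    1 has at most k roots. Its logarithm to such a nontrivial base is the
    character. *)
Lemma cubic_log_exists (l : nat) : prime l -> (l %% 3 = 1)%N ->
  exists lam : 'F_l -> 'F_3, cubic_log lam.
Proof.
move=> l_pr lm; set k := (l %/ 3)%N.
have lE : l = (3 * k).+1 by rewrite /k; lia.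
have k0 : (0 < k)%N by have := prime_gt1 l_pr; lia.
have powl (t : 'F_l) : t != 0 -> (t ^+ k) ^+ 3 = 1.
  move=> t0; apply: (mulIf t0); rewrite mul1r -exprM mulnC -exprSr.
  by have := expf_card t; rewrite card_Fp // -lE.
have [t0 t0N t0k] : exists2 t : 'F_l, t != 0 & t ^+ k != 1.
  apply/exists_inP; apply: contraT => /exists_inPn H.
  have sz : size ('X^k - 1 : {poly 'F_l}) = k.+1 by rewrite size_XnsubC.
  have nz : 'X^k - 1 != 0 :> {poly 'F_l} by rewrite -size_poly_eq0 sz.
  have := @max_poly_roots _ ('X^k - 1) (enum (predC1 (0 : 'F_l))) nz.
  rewrite enum_uniq -cardE sz cardC1 card_Fp //.
  have -> : all (root ('X^k - 1)) (enum (predC1 (0 : 'F_l))).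
    apply/allP => t; rewrite mem_enum => /H; rewrite negbK => /eqP tk.
    by rewrite /root !hornerE tk subrr.
  by move=> /(_ isT isT); lia.
set w := t0 ^+ k in t0k; have w3 : w ^+ 3 = 1 by apply: powl.
have wE : w ^+ 2 + w + 1 = 0.
  have : (w - 1) * (w ^+ 2 + w + 1) = 0.
    by transitivity (w ^+ 3 - 1); [ring|rewrite w3 subrr].
  by move/eqP; rewrite mulf_eq0 subr_eq0 (negPf t0k) /= => /eqP.
have ch := pchar_Fp l_pr; have l3 : l != 3%N by lia.
pose lam (t : 'F_l) : 'F_3 :=
  if t == 0 then 0 else if t ^+ k == 1 then 0 else if t ^+ k == w then 1 else 2.
have lamP t : t != 0 -> t ^+ k = w ^+ lam t.
  move=> tN; rewrite /lam (negPf tN).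
  case: eqP => [->|/eqP n1] //; case: eqP => [->|/eqP n2] //.
  have : (t ^+ k - 1) * (t ^+ k - w) * (t ^+ k - w ^+ 2) = 0.
    transitivity ((t ^+ k) ^+ 3 - 1 + (w ^+ 2 + w + 1) *
       (t ^+ k * w - (t ^+ k) ^+ 2 - (w - 1))); first by ring.
    by rewrite wE powl // subrr mul0r addr0.
  by move/eqP; rewrite !mulf_eq0 !subr_eq0 (negPf n1) (negPf n2) /= => /eqP.
exists lam; split.
- by rewrite /lam eqxx.
- move=> s t sN tN.
  have e : w ^+ lam (s * t) = w ^+ (lam s + lam t)%N.
    by rewrite -lamP ?mulf_neq0 // exprMn !lamP // exprD.
  rewrite -[LHS]F3_natK -[lam s]F3_natK -[lam t]F3_natK -natrD.
  by apply: F3_eq; apply: (cube_root_expr_inj l_pr l3 ch wE e).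
exists t0 => //; apply: contraNneq t0k => e; rewrite /w lamP // e.
by rewrite expr0.
Qed.

Section GaussSum.
Variables (l : nat) (lam : 'F_l -> 'F_3).
Hypotheses (l_pr : prime l) (lm : (l %% 3 = 1)%N) (lamP : cubic_log lam).

Lemma cubic_log1 : lam 1 = 0.
Proof.
have := cubic_logM lamP (oner_neq0 _) (oner_neq0 _); rewrite mulr1.
by move/(congr1 (fun z => z - lam 1)); rewrite subrr addrK.
Qed.

Lemma F3_double (e : 'F_3) : e + e = 0 -> e = 0.
Proof.
move=> ee; have -> : e = 3 * e - (e + e) by ring.
by rewrite ee F3_0 mul0r subr0.
Qed.

Lemma cubic_logN1 : lam (-1) = 0.
Proof.
have m1 : -1 != 0 :> 'F_l by rewrite oppr_eq0 oner_neq0.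
by apply: F3_double; rewrite -cubic_logM // mulrNN mulr1 cubic_log1.
Qed.

Lemma cubic_logV t : t != 0 -> lam t^-1 = - lam t.
Proof.
move=> t0; apply/eqP; rewrite -addr_eq0 -cubic_logM ?invr_eq0 //.
by rewrite mulVf // cubic_log1.
Qed.

Lemma cubic_log_sum : \sum_t lam t = 0.
Proof.
apply: F3_double; rewrite {2}(reindex_inj invr_inj) -big_split big1 //= => t _.
have [->|t0] := eqVneq t 0; first by rewrite invr0 (cubic_log0 lamP) addr0.
by rewrite cubic_logV // subrr.
Qed.


Definition cubic_char (R : pzRingType) (w : R) (t : 'F_l) : R :=
  if t == 0 then 0 else w ^+ lam t.

Definition jacobi_sum (R : pzRingType) (w : R) : R :=
  \sum_s cubic_char w s * cubic_char w (1 - s).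

Section InField.
Variables (K : fieldType) (w z : K).
Hypotheses (lK : (l%:R : K) != 0) (wE : w ^+ 2 + w + 1 = 0).
Hypotheses (zl : z ^+ l = 1) (z1 : z != 1).

Let w3 : w ^+ 3 = 1 := cube_root3 wE.

Lemma cubic_charM (v : K) s t : v ^+ 3 = 1 ->
  cubic_char v (s * t) = cubic_char v s * cubic_char v t.
Proof.
move=> v3; rewrite /cubic_char mulf_eq0.
have [->|s0] := eqVneq s 0; first by rewrite /= mul0r.
have [->|t0] := eqVneq t 0; first by rewrite /= mulr0.
rewrite (cubic_logM lamP) // -exprD /= -[LHS](expr_mod _ v3) -[RHS](expr_mod _ v3).
by congr (_ ^+ _); rewrite /= modn_mod.
Qed.

Lemma cubic_char_sqr t : cubic_char (w ^+ 2) t = cubic_char w t ^+ 2.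
Proof.
by rewrite /cubic_char; case: eqP => _; rewrite ?expr0n // -!exprM mulnC.
Qed.

Lemma cubic_char_expr3 t : t != 0 -> cubic_char w t ^+ 3 = 1.
Proof.
by move=> t0; rewrite /cubic_char (negPf t0) exprAC w3 expr1n.
Qed.

Lemma cubic_charN (v : K) t : v ^+ 3 = 1 -> cubic_char v (- t) = cubic_char v t.
Proof.
move=> v3; rewrite -mulN1r cubic_charM // {1}/cubic_char oppr_eq0 oner_eq0.
by rewrite cubic_logN1 mul1r.
Qed.

Lemma cubic_char_sum : (3 : K) != 0 -> \sum_t cubic_char w t = 0.
Proof.
move=> K3; have [u u0 lu] := cubic_log_nontriv lamP.
set S := \sum_t _; have e : cubic_char w u * S = S.
  rewrite big_distrr /= [RHS](reindex_inj (mulfI u0)); apply: eq_bigr => t _.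
  by rewrite cubic_charM.
have : (cubic_char w u - 1) * S = 0 by rewrite mulrBl e mul1r subrr.
move/eqP; rewrite mulf_eq0 subr_eq0 => /orP[|/eqP //].
rewrite /cubic_char (negPf u0) => /eqP wu.
have w1 := cube_root_neq1 wE K3; case/eqP: lu.
case: (lam u) wu => [[|[|[|//]]]] i /=; rewrite ?expr1.
- by move=> _; apply: val_inj.
- by move=> wu; rewrite wu eqxx in w1.
- by move=> w2; rewrite -w3 exprS w2 mulr1 eqxx in w1.
Qed.

Lemma cubic_char_sqr_sum : (3 : K) != 0 -> \sum_t cubic_char w t ^+ 2 = 0.
Proof.
move=> K3; rewrite -[RHS](cubic_char_sum K3) [RHS](reindex_inj invr_inj).
apply: eq_bigr => t _; have [->|t0] := eqVneq t 0.
  by rewrite invr0 /cubic_char eqxx expr0n.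
have c3 := cubic_char_expr3 t0.
have cV : cubic_char w t * cubic_char w t^-1 = 1.
  rewrite -cubic_charM // mulfV // /cubic_char oner_eq0.
  by rewrite cubic_log1.
by rewrite -[LHS]mulr1 -cV mulrA -exprSr c3 mul1r.
Qed.

Definition add_char (t : 'F_l) : K := z ^+ t.

Lemma add_char_nat n : add_char n%:R = z ^+ n.
Proof. by rewrite /add_char val_Fp_nat // expr_mod. Qed.

Lemma F_natK (t : 'F_l) : (t : nat)%:R = t.
Proof. exact: natr_Zp. Qed.

Lemma add_charD s t : add_char (s + t) = add_char s * add_char t.
Proof. by rewrite -[s]F_natK -[t]F_natK -natrD !add_char_nat exprD. Qed.

Lemma add_charMn s n : add_char (n%:R * s) = add_char s ^+ n.
Proof. by rewrite -[s]F_natK -natrM !add_char_nat mulnC exprM. Qed.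

Lemma add_char_neq1 t : t != 0 -> add_char t != 1.
Proof.
move=> t0; apply: contraNneq z1 => e.
by rewrite -[z]expr1 -add_char_nat -(mulVf t0) -[t^-1]F_natK add_charMn e expr1n.
Qed.

Lemma add_char_sum c : \sum_t add_char (t * c) = if c == 0 then l%:R else 0.
Proof.
case: eqP => [->|/eqP c0].
  under eq_bigr do rewrite mulr0 -[0]/(0%:R) add_char_nat expr0.
  by rewrite sumr_const card_Fp.
set S := \sum_t _; have e : add_char c * S = S.
  rewrite big_distrr /= [RHS](reindex_inj (addrI 1)); apply: eq_bigr => t _.
  by rewrite mulrDl mul1r add_charD.
have : (add_char c - 1) * S = 0 by rewrite mulrBl e mul1r subrr.
by move/eqP; rewrite mulf_eq0 subr_eq0 (negPf (add_char_neq1 c0)) => /eqP.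
Qed.

Definition gauss_sum (v : K) : K := \sum_t cubic_char v t * add_char t.

Hypothesis K3 : (3 : K) != 0.

(** Substituting s = r t in the double sum leaves, for each r, a sum of the
    additive character over the t different from 0, which singles out r = 1. *)
Lemma gauss_sum_norm : gauss_sum w * gauss_sum (w ^+ 2) = l%:R.
Proof.
have w23 : (w ^+ 2) ^+ 3 = 1 by rewrite exprAC w3 expr1n.
have -> : gauss_sum (w ^+ 2) = \sum_t cubic_char (w ^+ 2) t * add_char (- t).
  rewrite /gauss_sum (reindex_inj oppr_inj); apply: eq_bigr => t _.
  by rewrite cubic_charN.
rewrite [_ * _]mulrC big_distrl /=.
transitivity (\sum_t \sum_(r : 'F_l) (if t == 0 then 0 else
    cubic_char w r * add_char (t * (r - 1)))).
  apply: eq_bigr => t _; rewrite big_distrr /=.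
  have [->|t0] := eqVneq t 0.
    by apply: eq_bigr => r _; rewrite {1}/cubic_char eqxx !mul0r.
  rewrite (reindex_inj (mulfI t0)); apply: eq_bigr => r _.
  rewrite cubic_charM // cubic_char_sqr mulrBr mulr1 [t * r - t]addrC add_charD.
  rewrite -[RHS]mul1r -(cubic_char_expr3 t0); ring.
rewrite exchange_big /=.
transitivity (\sum_r cubic_char w r * ((if r == 1 then l%:R else 0) - 1)).
  apply: eq_bigr => r _; rewrite -subr_eq0 -add_char_sum.
  rewrite (bigD1 0) //= add0r [in RHS](bigD1 0) //= mul0r.
  rewrite [add_char 0](add_char_nat 0) expr0 addrAC subrr add0r big_distrr /=.
  by apply: eq_bigr => t /negPf ->.
under eq_bigr do rewrite mulrBr mulr1.
rewrite sumrB cubic_char_sum // subr0 (bigD1 1) //= big1; last first.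
  by move=> r /negPf ->; rewrite mulr0.
by rewrite /cubic_char oner_eq0 cubic_log1 expr0 mul1r addr0.
Qed.

(** Grouping the double sum by the value u of s + t, the substitution s = u s'
    extracts the Jacobi sum when u is not 0; the terms with u = 0 cancel. *)
Lemma gauss_sum_sqr : gauss_sum w ^+ 2 = jacobi_sum w * gauss_sum (w ^+ 2).
Proof.
rewrite expr2 /gauss_sum big_distrl /=.
transitivity (\sum_s \sum_u cubic_char w s * cubic_char w (u - s) * add_char u).
  apply: eq_bigr => s _; rewrite big_distrr /= [RHS](reindex_inj (addrI s)).
  by apply: eq_bigr => t _; rewrite addrAC subrr add0r add_charD; ring.
rewrite exchange_big /= big_distrr /=; apply: eq_bigr => u _.
rewrite -big_distrl /= mulrA; congr (_ * _).
have [->|u0] := eqVneq u 0.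
  rewrite [X in _ = _ * X](_ : _ = 0) ?mulr0; last by rewrite /cubic_char eqxx.
  rewrite -[RHS](cubic_char_sqr_sum K3).
  by apply: eq_bigr => s _; rewrite sub0r cubic_charN // expr2.
rewrite (reindex_inj (mulfI u0)) /jacobi_sum big_distrl /=.
apply: eq_bigr => s _; rewrite -{2}[u]mulr1 -mulrBr !cubic_charM //.
by rewrite cubic_char_sqr; ring.
Qed.

End InField.
End GaussSum.

(** * Jacobi sums as primary elements *)

Lemma nontrivial_root_exists (K : closedFieldType) (l : nat) : prime l ->
  (l%:R : K) != 0 -> exists2 z : K, z ^+ l = 1 & z != 1.
Proof.
case: l => [|[|l]] // l_pr lK.
have [z zE] := @GRing.solve_monicpoly K l.+1 (fun _ => -1) isT.
have S0 : \sum_(i < l.+2) z ^+ i = 0.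
  rewrite big_ord_recr /= zE -big_split /= big1 // => i _.
  by rewrite mulN1r subrr.
exists z; first by apply/eqP; rewrite -subr_eq0 subrX1 S0 mulr0.
apply: contraNneq lK => z1; rewrite -S0 z1.
under eq_bigr do rewrite expr1n.
by rewrite sumr_const card_ord.
Qed.

Section JacobiSum.
Variables (l : nat) (lam : 'F_l -> 'F_3).
Hypotheses (l_pr : prime l) (lm : (l %% 3 = 1)%N) (lamP : cubic_log lam).

Local Notation J := (jacobi_sum lam omega).

Lemma ev_sum (K : fieldType) (w : K) (I : finType) (F : I -> eis) :
  ev w (\sum_i F i) = \sum_i ev w (F i).
Proof.
by apply: (big_morph (ev w)); [apply: evD|rewrite -[0]/(0%:~R) ev_int].
Qed.

Lemma ev_cubic_char (K : fieldType) (w : K) t : w ^+ 2 + w + 1 = 0 ->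
  ev w (cubic_char lam omega t) = cubic_char lam w t.
Proof.
move=> wE; rewrite /cubic_char; case: eqP => _; last by rewrite evX // ev_omega.
by rewrite -[0]/(0%:~R) ev_int.
Qed.

Lemma ev_jacobi (K : fieldType) (w : K) : w ^+ 2 + w + 1 = 0 ->
  ev w J = jacobi_sum lam w.
Proof.
move=> wE; rewrite /jacobi_sum ev_sum; apply: eq_bigr => s _.
by rewrite evM // !ev_cubic_char.
Qed.

Lemma ev_jacobiJ (K : fieldType) (w : K) : w ^+ 2 + w + 1 = 0 ->
  ev w (eis_conj J) = jacobi_sum lam (w ^+ 2).
Proof.
by move=> wE; rewrite -(ev_sqr _ wE) ev_jacobi //; apply: cube_root_sqr.
Qed.

Lemma cube_root4 (K : fieldType) (w : K) : w ^+ 2 + w + 1 = 0 ->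
  (w ^+ 2) ^+ 2 = w.
Proof.
by move=> wE; rewrite -exprM -[(2 * 2)%N]/(3 + 1)%N exprD cube_root3 // mul1r.
Qed.

Lemma gauss_sum_cube (K : fieldType) (w z : K) :
  w ^+ 2 + w + 1 = 0 -> (3 : K) != 0 -> z ^+ l = 1 -> z != 1 ->
  gauss_sum lam z w ^+ 3 = jacobi_sum lam w * l%:R.
Proof.
move=> wE K3 zl z1; rewrite exprSr (gauss_sum_sqr l_pr lamP wE zl K3) -mulrA.
by rewrite [gauss_sum _ _ (w ^+ 2) * _]mulrC (gauss_sum_norm l_pr lamP wE zl z1 K3).
Qed.

(** Cubing the identities for the Gauss sums of the two conjugate characters
    over the algebraic numbers gives N(J) l^2 = l^3. *)
Lemma jacobi_norm : eis_norm J = l.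
Proof.
have [w wE] := cube_root_exists algC.
have lC : (l%:R : algC) != 0 by rewrite pnatr_eq0 -lt0n prime_gt0.
have [z zl z1] := nontrivial_root_exists l_pr lC.
have C3 : (3 : algC) != 0 by rewrite pnatr_eq0.
have w'E := cube_root_sqr wE.
have gg := gauss_sum_norm l_pr lamP wE zl z1 C3.
have g3 := gauss_sum_cube wE C3 zl z1; have g'3 := gauss_sum_cube w'E C3 zl z1.
apply: (@intr_inj algC); rewrite -(ev_norm wE) ev_jacobi // ev_jacobiJ //.
apply: (mulIf (mulf_neq0 lC lC)); rewrite mulrACA -g3 -g'3 -exprMn gg.
by rewrite exprS expr2.
Qed.

(** The q-th power map turns the additive character at t into its value at q
    t, and reindexing by q extracts a value of the cubic character. *)
Lemma gauss_sum_frob (q : nat) (K : fieldType) (w z : K) :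
  prime q -> q \in [pchar K] -> w ^+ 2 + w + 1 = 0 -> (q%:R : 'F_l) != 0 ->
  z ^+ l = 1 ->
  gauss_sum lam z w ^+ q * cubic_char lam (w ^+ q) q%:R
    = gauss_sum lam z (w ^+ q).
Proof.
move=> q_pr chK wE ql zl; have w3 := cube_root3 wE.
have wq3 : (w ^+ q) ^+ 3 = 1 by rewrite exprAC w3 expr1n.
rewrite /gauss_sum (expr_sump chK) big_distrl /=.
rewrite [RHS](reindex_inj (mulfI ql)); apply: eq_bigr => t _.
rewrite (cubic_charM lamP _ _ wq3) exprMn (add_charMn l_pr zl) mulrC mulrA.
congr (_ * _ * _); rewrite /cubic_char; case: eqP => _; last by rewrite exprAC.
by rewrite expr0n gtn_eqF ?prime_gt0.
Qed.

(** The reciprocity law for the split primes. The cubes of the Gauss sums g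
    and g' of the two conjugate characters are l J and l conj(J), and
    Frobenius multiplies g by a value of the character at q, exchanging g and
    g' when q = 2 mod 3. Comparing g^(3k) with g'^(3k) gives the k-th power of
    J / conj(J). *)
Lemma local_symbol_jacobi (q : nat) : prime q -> q != 3%N -> q != l ->
  local_symbol J q = lam q%:R.
Proof.
move=> q_pr q3 ql; set K := Fbar q; have chK : q \in [pchar K] := Fbar_pchar q_pr.
set w : K := cbrt1 q; have wE : w ^+ 2 + w + 1 = 0 := cbrt1P q.
have w3 := cube_root3 wE; have w'E := cube_root_sqr wE; have w4 := cube_root4 wE.
have lK : (l%:R : K) != 0 by rewrite -(dvdn_pcharf chK) dvdn_prime2.
have K3 := three_neq0 q_pr q3 chK.
have qF : (q%:R : 'F_l) != 0.
  by rewrite -(dvdn_pcharf (pchar_Fp l_pr)) dvdn_prime2 // eq_sym.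
have [z zl z1] := nontrivial_root_exists l_pr lK.
have gg := gauss_sum_norm l_pr lamP wE zl z1 K3.
have g3 := gauss_sum_cube wE K3 zl z1; have g'3 := gauss_sum_cube w'E K3 zl z1.
have fr := gauss_sum_frob q_pr chK wE qF zl.
have fr' := gauss_sum_frob q_pr chK w'E qF zl.
have gN : gauss_sum lam z w != 0.
  by apply: contraNneq lK => e; rewrite -gg e mul0r.
have g'N : gauss_sum lam z (w ^+ 2) != 0.
  by apply: contraNneq lK => e; rewrite -gg e mulr0.
set X := cubic_char lam w q%:R.
have XE : X = w ^+ lam q%:R by rewrite /X /cubic_char (negPf qF).
have X3 : X ^+ 3 = 1 by rewrite XE exprAC w3 expr1n.
have X'E : cubic_char lam (w ^+ 2) q%:R = X ^+ 2 by rewrite cubic_char_sqr.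
have wqE : (w ^+ 2) ^+ q = (w ^+ q) ^+ 2 by rewrite exprAC.
rewrite -[RHS]F3_natK; apply: (local_symbol_uniq q_pr q3 wE).
  rewrite jacobi_norm -[(_ %| _)%Z]/(q %| l)%N dvdn_prime2 //.
rewrite ev_jacobi // ev_jacobiJ // mulnC exprM -XE.
set k := torus_index q.
apply: (mulIf (expf_neq0 k lK)); rewrite -mulrA -!exprMn -g3 -g'3 -!exprM.
case: (prime_mod3 q_pr q3) => qm.
  have kE : (3 * k).+1 = q by rewrite -torus_index1.
  have wq : w ^+ q = w by rewrite (cube_root_mod wE) qm expr1.
  rewrite wqE wq in fr fr'; rewrite X'E in fr'.
  have e1 : gauss_sum lam z w ^+ (3 * k) * X = 1.
    by apply: (mulIf gN); rewrite mul1r mulrAC -exprSr kE.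
  have e2 : gauss_sum lam z (w ^+ 2) ^+ (3 * k) * X ^+ 2 = 1.
    by apply: (mulIf g'N); rewrite mul1r mulrAC -exprSr kE.
  have XqE : X ^+ q = X by rewrite -(expr_mod _ X3) qm expr1.
  rewrite XqE -[LHS]mulr1 -e2 -[RHS]mulr1 -e1; ring.
have kE : (3 * k)%N = q.+1 by rewrite torus_index2.
have wq : w ^+ q = w ^+ 2 by rewrite (cube_root_mod wE) qm.
rewrite wqE wq w4 in fr fr'; rewrite X'E in fr.
have XqE : X ^+ q = X ^+ 2 by rewrite -(expr_mod _ X3) qm.
have e1 : gauss_sum lam z w ^+ (3 * k) * X ^+ 2 = l%:R.
  by rewrite kE exprS -mulrA fr.
have e2 : gauss_sum lam z (w ^+ 2) ^+ (3 * k) * X = l%:R.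
  by rewrite kE exprS -mulrA fr' mulrC.
rewrite XqE -[LHS]mulr1 -X3.
by transitivity (gauss_sum lam z w ^+ (3 * k) * X ^+ 2 * X);
  [ring|rewrite e1 -e2; ring].
Qed.

Lemma eis1_sum (I : finType) (F : I -> eis) :
  eis1 (\sum_i F i) = \sum_i eis1 (F i).
Proof. by apply: (big_morph eis1). Qed.

Lemma eisw_sum (I : finType) (F : I -> eis) :
  eisw (\sum_i F i) = \sum_i eisw (F i).
Proof. by apply: (big_morph eisw). Qed.

(** (omega - 1)^2 = - 3 omega, so that omega^n = 1 + n (omega - 1) modulo 3. *)
Lemma omega_mod3 n : (eis1 (omega ^+ n))%:~R = 1 - n%:R :> 'F_3
  /\ (eisw (omega ^+ n))%:~R = n%:R :> 'F_3.
Proof.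
elim: n => [|n [IH1 IH2]]; first by rewrite expr0 /= subr0.
rewrite exprSr eis_mulE /= !mulr0 !mulr1 sub0r addr0 rmorphN rmorphB /= IH1 IH2.
split; first by rewrite -natr1; ring.
rewrite -natr1; have -> : 1 - n%:R - n%:R = n%:R + 1 - 3 * n%:R :> 'F_3 by ring.
by rewrite F3_0 mul0r subr0.
Qed.

(** Modulo 3 the term of index s is 1 + (lam s + lam (1 - s)) (omega - 1) for
    s outside {0, 1}, and the logarithms sum to 0 since lam (1/t) = - lam t.
    Hence J is l - 2, that is 2. *)
Lemma jacobi_primary : eis_primary J.
Proof.
have [F FE] : exists F : 'F_l -> eis,
    forall s, F s = cubic_char lam omega s * cubic_char lam omega (1 - s).
  by eexists.
have JE : J = \sum_s F s by apply: eq_bigr => s _; rewrite FE.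
have term s : s != 0 -> s != 1 ->
    F s = omega ^+ (lam s + lam (1 - s)%R)%N.
  move=> s0 s1; rewrite FE /cubic_char (negPf s0) subr_eq0 eq_sym (negPf s1).
  by rewrite exprD.
have l0 := cubic_log0 lamP; have l1 := cubic_log1 lamP.
have F0 : F 0 = 0 by rewrite FE /cubic_char eqxx mul0r.
have F1 : F 1 = 0 by rewrite FE subrr /cubic_char eqxx mulr0.
have ch3 := pchar_Fp (isT : prime 3).
have Jw : (eisw J)%:~R = 0 :> 'F_3.
  rewrite JE eisw_sum rmorph_sum /=.
  transitivity (\sum_s (lam s + lam (1 - s))).
    apply: eq_bigr => s _.
    have [->|s0] := eqVneq s 0.
      by rewrite F0 subr0 l0 l1 addr0.
    have [->|s1] := eqVneq s 1.
      by rewrite F1 subrr l0 l1 addr0.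
    by rewrite term // (omega_mod3 _).2 natrD !F3_natK.
  have bij : \sum_s lam (1 - s) = \sum_s lam s.
    rewrite [RHS](reindex_inj (h := fun s => 1 - s)) //.
    by move=> s t /addrI/oppr_inj.
  by rewrite big_split /= bij cubic_log_sum // addr0.
have J1 : (eis1 J)%:~R = 2 :> 'F_3.
  rewrite JE eis1_sum rmorph_sum /=.
  transitivity (\sum_s (1 - (lam s + lam (1 - s)) - (s == 0)%:R - (s == 1)%:R)).
    apply: eq_bigr => s _.
    have [->|s0] := eqVneq s 0.
      by rewrite F0 (subr0 1) l0 l1 addr0 eq_sym oner_eq0 /= !subr0 subrr.
    have [->|s1] := eqVneq s 1.
      by rewrite F1 subrr l0 l1 addr0 /= !subr0 subrr.
    by rewrite term // (omega_mod3 _).1 natrD !F3_natK !subr0.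
  have bij : \sum_s lam (1 - s) = \sum_s lam s.
    rewrite [RHS](reindex_inj (h := fun s => 1 - s)) //.
    by move=> s t /addrI/oppr_inj.
  have one (a : 'F_l) : \sum_s (s == a)%:R = 1 :> 'F_3.
    by rewrite (bigD1 a) //= eqxx big1 ?addr0 // => s /negPf ->.
  rewrite !sumrB big_split /= bij cubic_log_sum // !one sumr_const card_Fp //.
  have -> : l%:R = 1 :> 'F_3 by apply: (F3_eq (j := 1)).
  by apply: val_inj.
split; last by rewrite -(intr_eq0p ch3) Jw.
by apply/eqP; rewrite -(intr_eqp ch3) J1.
Qed.

Lemma symbol_jacobi (n : int) : coprimez n (3 * l%:Z) ->
  symbol J n = lam n%:~R.
Proof.
move=> cop.
have lamN t : lam (- t) = lam t.
  have [->|t0] := eqVneq t 0; first by rewrite oppr0.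
  rewrite -mulN1r (cubic_logM lamP) ?cubic_logN1 ?add0r //.
  by rewrite oppr_eq0 oner_eq0.
have -> : lam n%:~R = lam `|n|%:R.
  by case: n {cop} => n //=; rewrite NegzE rmorphN lamN.
have n0 : n != 0.
  by apply: contraTneq cop => ->; rewrite /coprimez gcd0z; have := prime_gt1 l_pr; lia.
have unit_of m : coprime m (3 * l) -> (m%:R : 'F_l) != 0.
  rewrite coprimeMr => /andP[_ ml]; rewrite -(dvdn_pcharf (pchar_Fp l_pr)).
  by rewrite -prime_coprime // coprime_sym.
apply: (symbol_multiplicative (S := fun m => coprime m (3 * l))
          (f := fun m => lam m%:R)) => //.
- by move=> a b; rewrite coprimeMl.
- exact: cubic_log1.
- move=> a b; rewrite coprimeMl => /andP[ca cb].
  by rewrite natrM (cubic_logM lamP) ?unit_of.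
move=> q q_pr cq; apply: local_symbol_jacobi => //.
  by apply: contraTneq cq => ->; rewrite coprimeMr.
by apply: contraTneq cq => ->; rewrite coprimeMr !(prime_coprime _ l_pr) dvdnn andbF.
Qed.

End JacobiSum.

(** * Cubic reciprocity with a rational argument *)

(** Primary up to sign. *)
Definition semiprimary (x : eis) := ~~ (3 %| eis1 x)%Z && (3 %| eisw x)%Z.

Lemma prime_dvdzM (l : nat) (a b : int) : prime l ->
  (l%:Z %| a * b)%Z = (l%:Z %| a)%Z || (l%:Z %| b)%Z.
Proof. by move=> l_pr; rewrite !dvdzE abszM Euclid_dvdM. Qed.

Lemma eis_mul_intE (z : int) (x : eis) :
  z%:~R * x = Eis (z * eis1 x) (z * eisw x).
Proof. by rewrite eis_intE eis_mulE /=; congr Eis; ring. Qed.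

Lemma eis_int_mulI (z : int) (x y : eis) : z != 0 ->
  z%:~R * x = z%:~R * y -> x = y.
Proof.
case: x y => [a b] [c d] z0; rewrite !eis_mul_intE /= => -[].
by move=> /(mulfI z0) -> /(mulfI z0) ->.
Qed.

Lemma eis_dvd_int (z : int) (x : eis) : (z %| eis1 x)%Z -> (z %| eisw x)%Z ->
  exists y, x = z%:~R * y.
Proof.
case: x => a b /= /dvdzP[c ->] /dvdzP[d ->]; exists (Eis c d).
by rewrite eis_intE eis_mulE /=; congr Eis; ring.
Qed.

(** One of the two conjugate evaluations vanishes, and Frobenius exchanges
    them. *)
Lemma inert_dvd (l : nat) (x : eis) : prime l -> (l %% 3 = 2)%N ->
  (l%:Z %| eis_norm x)%Z -> (l%:Z %| eis1 x)%Z /\ (l%:Z %| eisw x)%Z.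
Proof.
move=> l_pr lm; have chK := Fbar_pchar l_pr; have wE := cbrt1P l.
have l3 : l != 3%N by apply: contra_eq_neq lm => ->.
have fr y := ev_frob l_pr l3 chK wE y; rewrite lm /= in fr.
have l0 := prime_gt0 l_pr.
rewrite -!(intr_eq0p chK) -(ev_norm wE) => N0.
have [x0 xc0] : ev (cbrt1 l) x = 0 /\ ev (cbrt1 l) (eis_conj x) = 0.
  move: N0; rewrite mulf_eq0 => /orP[]/eqP e; split=> //.
    by rewrite -fr e expr0n gtn_eqF.
  by rewrite -[x]eis_conjK -fr e expr0n gtn_eqF.
have w1 := cube_root_neq1 wE (three_neq0 l_pr l3 chK).
have w0 := cube_root_neq0 wE.
have eB : (eisw x)%:~R = 0 :> Fbar l.
  have : (eisw x)%:~R * (cbrt1 l * (1 - cbrt1 l)) = 0.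
    transitivity (ev (cbrt1 l) x - ev (cbrt1 l) (eis_conj x)).
      by rewrite (evJ wE) /ev; ring.
    by rewrite x0 xc0 subrr.
  move/eqP; rewrite !mulf_eq0 (negPf w0) subr_eq0 [1 == _]eq_sym.
  by rewrite (negPf w1) /= orbF => /eqP.
by move: x0; rewrite /ev eB mul0r addr0 => ->.
Qed.

Lemma eis_dvd_norm (l : nat) (x y : eis) : prime l ->
  (l%:Z %| eisw (x * eis_conj y))%Z -> eis_norm y = l ->
  exists z, x = y * z.
Proof.
move=> l_pr dw Ny; have d1 : (l%:Z %| eis1 (x * eis_conj y))%Z.
  have : (l%:Z %| eis_norm (x * eis_conj y))%Z.
    by rewrite eis_normM eis_norm_conj Ny dvdz_mull.
  rewrite /eis_norm rpredDr; last by rewrite expr2 dvdz_mulr.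
  rewrite rpredBr; last by rewrite dvdz_mull.
  by rewrite expr2 prime_dvdzM // orbb.
have [z zE] := eis_dvd_int d1 dw; exists z.
have l0 : l%:Z != 0 by rewrite eqz_nat -lt0n prime_gt0.
apply: (eis_int_mulI l0); transitivity (y * (x * eis_conj y)).
  by rewrite -Ny -eis_mul_conj; ring.
by rewrite zE; ring.
Qed.

(** The product of the omega-coordinates of x conj(y) and x y is (eisw x)^2
    N(y) - (eisw y)^2 N(x), which l divides. *)
Lemma eis_dvd_prime_norm (l : nat) (x y : eis) : prime l -> eis_norm y = l ->
  (l%:Z %| eis_norm x)%Z -> exists z, x = y * z \/ x = eis_conj y * z.
Proof.
move=> l_pr Ny Nx.
have : (l%:Z %| eisw (x * eis_conj y) * eisw (x * y))%Z.
  have -> : eisw (x * eis_conj y) * eisw (x * y)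
      = eisw x ^+ 2 * eis_norm y - eisw y ^+ 2 * eis_norm x.
    by case: x y {Nx Ny} => [a b] [c d]; rewrite !eis_mulE /eis_conj /eis_norm /=; ring.
  by rewrite Ny rpredB // dvdz_mull.
rewrite prime_dvdzM // => /orP[] dw.
  by have [z ->] := eis_dvd_norm l_pr dw Ny; exists z; left.
have Ny' : eis_norm (eis_conj y) = l by rewrite eis_norm_conj.
have dw' : (l%:Z %| eisw (x * eis_conj (eis_conj y)))%Z by rewrite eis_conjK.
have [z ->] := eis_dvd_norm l_pr dw' Ny'.
by exists z; right.
Qed.

Lemma admissibleM (n : int) (x y : eis) :
  admissible n (x * y) = admissible n x && admissible n y.
Proof.
rewrite /admissible eis_normM !coprimezMr.
by case: coprimez => //=; rewrite andbA andbb.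
Qed.

Lemma admissibleJ (n : int) (x : eis) :
  admissible n (eis_conj x) = admissible n x.
Proof. by rewrite /admissible eis_norm_conj. Qed.

Lemma semiprimary_norm (x : eis) : semiprimary x ->
  exists k : int, eis_norm x = 3 * k + 1.
Proof.
case: x => a b; rewrite /semiprimary /eis_norm /= => /andP[a3 /dvdzP[c ->]].
have : (a %% 3)%Z = 1 \/ (a %% 3)%Z = 2.
  by move: a3; lia.
rewrite {3 4}(divz_eq a 3); move: (a %/ 3)%Z => d.
case=> ->.
  exists (3 * d ^+ 2 + 2 * d - (d * 3 + 1) * c + 3 * c ^+ 2); ring.
exists (3 * d ^+ 2 + 4 * d + 1 - (d * 3 + 2) * c + 3 * c ^+ 2); ring.
Qed.

Lemma semiprimary_norm1 (x : eis) : semiprimary x -> eis_norm x = 1 ->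
  exists z : int, x = z%:~R.
Proof.
case: x => a b; rewrite /semiprimary /eis_norm /= => /andP[_ /dvdzP[c ->]] N1.
have c0 : c = 0 by nia.
by exists a; rewrite c0 mul0r eis_intE.
Qed.

Lemma eis_primary_semiprimary (x : eis) : eis_primary x -> semiprimary x.
Proof. by case=> x1 xw; rewrite /semiprimary xw andbT; lia. Qed.

Lemma eis_primaryJ (x : eis) : eis_primary x -> eis_primary (eis_conj x).
Proof.
by case: x => a b [/= a2 b3]; split=> /=; lia.
Qed.

Lemma semiprimary_divl (x y : eis) : eis_primary x -> semiprimary (x * y) ->
  semiprimary y.
Proof.
case: x y => [a b] [c d] [/= a2 /dvdzP[e ->]].
have [f ->] : exists f, a = 3 * f + 2 by exists (a %/ 3)%Z; lia.
rewrite eis_mulE /semiprimary /= => /andP[h1 h2].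
have {h1} : ~~ (3 %| 2 * c + 3 * (f * c - e * d))%Z.
  by apply: contraNN h1 => h; rewrite (_ : _ - _ = 2 * c + 3 * (f * c - e * d)) //; ring.
have {h2} : (3 %| 2 * d + 3 * (f * d + e * c - e * d))%Z.
  by rewrite (_ : _ + _ = (3 * f + 2) * d + e * 3 * c - e * 3 * d) //; ring.
move: (f * c - e * d) (f * d + e * c - e * d) => u v; lia.
Qed.

(** Prime factors of x are removed one at a time. An inert prime is a rational
    integer and has trivial symbol. Above a split prime l the factor is a
    Jacobi sum or its conjugate, whose symbol at n is a character of n modulo
    l. What remains in the end is 1 or -1, because x is semiprimary
    throughout. *)
Theorem symbol_reciprocity (x : eis) (m n : int) : semiprimary x ->
  admissible m x -> admissible n x -> (eis_norm x %| m - n)%Z ->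
  symbol x m = symbol x n.
Proof.
have [N] := ubnP `|eis_norm x|; elim: N x => // N IH x xN sx am an dx.
have [k kE] := semiprimary_norm sx.
have N0 := eis_norm_ge0 x.
have [N1|N1] := eqVneq (eis_norm x) 1.
  by have [z ->] := semiprimary_norm1 sx N1; rewrite !symbol_int.
have gt1 : (1 < `|eis_norm x|)%N by lia.
have l_pr := pdiv_prime gt1; set l := pdiv _ in l_pr.
have lx : (l%:Z %| eis_norm x)%Z by rewrite dvdzE; apply: pdiv_dvd.
have l3 : l != 3%N by apply: contraTneq lx => ->; rewrite kE; lia.
have shrink y z : x = y * z -> (1 < `|eis_norm y|)%N ->
    [/\ (`|eis_norm z| < N)%N, admissible m y, admissible n y,
        admissible m z & admissible n z].
  move=> xE y1; move: am an; rewrite xE !admissibleM => /andP[-> ->] /andP[-> ->].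
  split=> //; move: xN gt1; rewrite xE eis_normM abszM; nia.
have split_symbol y z : x = y * z -> (1 < `|eis_norm y|)%N ->
    semiprimary z -> symbol y m = symbol y n -> symbol x m = symbol x n.
  move=> xE y1 sz ey; have [zN amy any amz anz] := shrink _ _ xE y1.
  rewrite xE !symbolMl // ey (IH z) //.
  by apply: dvdz_trans dx; rewrite xE eis_normM dvdz_mull.
case: (prime_mod3 l_pr l3) => lm; last first.
  have [l1 lw] := inert_dvd l_pr lm lx.
  have [y xE] := eis_dvd_int l1 lw.
  apply: (split_symbol _ _ xE); last by rewrite !symbol_int.
    by rewrite eis_norm_int abszX absz_nat; have := prime_gt1 l_pr; nia.
  move: sx; rewrite xE /semiprimary eis_mul_intE /=.
  rewrite !(prime_dvdzM (l := 3)) // negb_or => /andP[/andP[a ->] /orP[b|->//]].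
  by rewrite b in a.
have [lam lamP] := cubic_log_exists l_pr lm.
set J := jacobi_sum lam omega.
have NJ : eis_norm J = l := jacobi_norm l_pr lamP.
have pJ : eis_primary J := jacobi_primary l_pr lm lamP.
have J1 : (1 < `|eis_norm J|)%N by rewrite NJ absz_nat prime_gt1.
have lamE : lam m%:~R = lam n%:~R.
  congr lam; apply/eqP; rewrite (intr_eqp (pchar_Fp l_pr)) eqz_mod_dvd.
  exact: dvdz_trans lx dx.
have symJ k' : admissible k' J -> symbol J k' = lam k'%:~R.
  by move=> ak; apply: symbol_jacobi => //; rewrite -NJ.
have [z [xE|xE]] := eis_dvd_prime_norm l_pr NJ lx.
  have [zN amy any amz anz] := shrink _ _ xE J1.
  apply: (split_symbol _ _ xE) => //; last by rewrite !symJ.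
  by apply: semiprimary_divl pJ _; rewrite -xE.
have J1' : (1 < `|eis_norm (eis_conj J)|)%N by rewrite eis_norm_conj.
have [zN amy any amz anz] := shrink _ _ xE J1'.
rewrite !admissibleJ in amy any.
apply: (split_symbol _ _ xE) => //; last by rewrite !symbolJ // !symJ // lamE.
by apply: semiprimary_divl (eis_primaryJ pJ) _; rewrite -xE.
Qed.

(** * Supplements at the prime 3 *)

Lemma admissible_unit (n : int) (x : eis) : ~~ (3 %| n)%Z ->
  (exists k, eis_norm x = 3 ^+ k) -> admissible n x.
Proof.
move=> n3 [k kE]; rewrite /admissible kE -exprS coprimezXr //.
by rewrite coprimez_sym /coprimez /gcdz -[_ == _]/(coprime 3 `|n|) prime_coprime.
Qed.

Lemma admissible_omega (n : int) : ~~ (3 %| n)%Z -> admissible n omega.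
Proof. by move=> n3; apply: admissible_unit => //; exists 0%N. Qed.

Lemma admissible_theta (n : int) : ~~ (3 %| n)%Z -> admissible n eis_theta.
Proof. by move=> n3; apply: admissible_unit => //; exists 1%N. Qed.

Lemma symbol_theta (z n : int) : ~~ (3 %| n)%Z ->
  symbol (z%:~R * eis_theta) n = 0.
Proof.
move=> n3; apply: symbol_anti => //.
by rewrite eis_conjM eis_conj_int -mulrN; congr (_ * _).
Qed.

Lemma eis_theta_dvd (x : eis) : (3 %| eis_norm x)%Z ->
  exists y, x = eis_theta * y /\ eis_norm x = 3 * eis_norm y.
Proof.
case: x => a b; rewrite /eis_norm /= => d.
have : (3 %| (a + b) * (a + b))%Z.
  have -> : (a + b) * (a + b) = a ^+ 2 - a * b + b ^+ 2 + 3 * (a * b) by ring.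
  by rewrite rpredD // dvdz_mulr.
rewrite (@prime_dvdzM 3) // orbb => /dvdzP[c cE].
have aE : a = c * 3 - b by rewrite -cE; ring.
exists (Eis (b - c) (b - 2 * c)); rewrite /eis_norm eis_mulE /= aE.
by split; [congr Eis; ring|ring].
Qed.

Lemma eis_semiprimary_associate (x : eis) : ~~ (3 %| eis_norm x)%Z ->
  exists y, semiprimary y /\ [\/ x = y, x = omega * y | x = omega * (omega * y)].
Proof.
case: x => a b; rewrite /eis_norm /= => n3.
have {}n3 : ~~ (3 %| a + b)%Z.
  apply: contraNN n3 => d; have -> : a ^+ 2 - a * b + b ^+ 2
    = (a + b) * (a + b) - 3 * (a * b) by ring.
  by rewrite rpredB // ?dvdz_mulr.
have [b3|b3] := boolP (3 %| b)%Z.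
  exists (Eis a b); split; last by constructor 1.
  by rewrite /semiprimary /= b3 andbT; lia.
have [a3|a3] := boolP (3 %| a)%Z.
  exists (Eis (b - a) (- a)); split.
    by rewrite /semiprimary /=; lia.
  by constructor 2; rewrite eis_mulE /=; congr Eis; ring.
exists (Eis (- b) (a - b)); split.
  by rewrite /semiprimary /=; lia.
by constructor 3; rewrite !eis_mulE /=; congr Eis; ring.
Qed.

(** A general x is a product of a power of sqrt(-3), a power of omega and a
    semiprimary element. The first has trivial symbol, and the symbol of the
    second depends on n modulo 9. *)
Theorem symbol_reciprocity9 (x : eis) (m n : int) : x != 0 ->
  admissible m x -> admissible n x -> (eis_norm x %| m - n)%Z ->
  (9 %| m - n)%Z -> symbol x m = symbol x n.
Proof.
have [N] := ubnP `|eis_norm x|; elim: N x => // N IH x xN x0 am an dx d9.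
have m3 := admissible_not3 am; have n3 := admissible_not3 an.
have [nx3|nx3] := boolP (3 %| eis_norm x)%Z.
  have [y [xE NE]] := eis_theta_dvd nx3.
  move: am an x0; rewrite xE !admissibleM => /andP[amt am] /andP[ant an] x0.
  have y0 : y != 0 by apply: contraNneq x0 => ->; rewrite mulr0.
  have th k : ~~ (3 %| k)%Z -> symbol eis_theta k = 0.
    by move=> k3; rewrite -[eis_theta]mul1r -(symbol_theta 1 k3).
  rewrite !symbolMl // !th // !add0r; apply: IH => //.
    have := eis_norm_ge0 y; have : eis_norm y != 0.
      by apply: contraNneq y0 => /eis_norm_eq0 ->.
    by move: xN; rewrite NE; lia.
  by apply: dvdz_trans dx; rewrite NE dvdz_mull.
have om := symbol_omega_congr m3 n3 d9.
have ao := admissible_omega m3; have ao' := admissible_omega n3.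
have [y [sy yE]] := eis_semiprimary_associate nx3.
have step z : admissible m z -> admissible n z -> symbol z m = symbol z n ->
    symbol (omega * z) m = symbol (omega * z) n.
  by move=> az az' e; rewrite !symbolMl // om e.
case: yE => xE; move: am an dx; rewrite xE ?admissibleM ?ao ?ao' /= => am an dx.
- exact: symbol_reciprocity.
- apply: (step) => //; apply: symbol_reciprocity => //.
  by apply: dvdz_trans dx; rewrite eis_normM dvdz_mull.
apply: (step); rewrite ?admissibleM ?ao ?ao' //.
apply: (step) => //; apply: symbol_reciprocity => //.
by apply: dvdz_trans dx; rewrite !eis_normM dvdz_mull // dvdz_mull.
Qed.

Lemma prime3_coprimez (n : int) : ~~ (3 %| n)%Z -> coprimez n 3.
Proof.
move=> n3; rewrite coprimez_sym /coprimez /gcdz.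
by rewrite -[_ == _]/(coprime 3 `|n|) prime_coprime.
Qed.

Lemma coprimezP1 (n N : int) (k : int) : coprimez n N -> coprimez n (N + k * n).
Proof. by rewrite /coprimez -{1}(gcdzMDl k) mulrC addrC => ->. Qed.

(** In x = a + b omega the identity (2a - b)^2 = 3 a (a - b) + N(x) expresses
    T, the inverse of 3, through a, a - b and 2a - b; modulo each of these x
    is a rational multiple of omega, omega^2 or sqrt(-3). The contributions of
    omega cancel as a and a - b agree modulo 9. *)
Lemma symbol_inverse3_coprime (a b T : int) : coprimez a b ->
  ~~ (3 %| a)%Z -> (9 %| b)%Z -> admissible T (Eis a b) ->
  (eis_norm (Eis a b) %| 3 * T - 1)%Z -> symbol (Eis a b) T = 0.
Proof.
move=> cop a3 b9 aT dT; set y := Eis a b; set G := eis_norm y in dT *.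
have sy : semiprimary y by rewrite /semiprimary /= a3; lia.
have GE : G = a ^+ 2 - a * b + b ^+ 2 by [].
have ab3 : ~~ (3 %| a - b)%Z by lia.
have v3 : ~~ (3 %| 2 * a - b)%Z by lia.
have copS (n e : int) : ~~ (3 %| n)%Z -> coprimez n e ->
    (exists k, G = e + k * n) -> admissible n y.
  move=> n3 ce [k GE']; rewrite /admissible coprimezMr prime3_coprimez //=.
  by rewrite -/G GE' coprimezP1.
have copab : coprimez (a - b) a.
  rewrite coprimez_sym; have -> : a - b = - b + 1 * a by ring.
  by apply: coprimezP1; rewrite coprimezN.
have cop2 : coprimez (2 * a - b) a.
  rewrite coprimez_sym; have -> : 2 * a - b = - b + 2 * a by ring.
  by apply: coprimezP1; rewrite coprimezN.
have aa : admissible a y.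
  apply: (copS _ (b ^+ 2)) => //; first by rewrite coprimezXr.
  by exists (a - b); rewrite GE; ring.
have aab : admissible (a - b) y.
  apply: (copS _ (a ^+ 2)) => //; first by rewrite coprimezXr.
  by exists (- b); rewrite GE; ring.
have av : admissible (2 * a - b) y.
  apply: (copS _ (3 * a ^+ 2)) => //.
    by rewrite coprimezMr prime3_coprimez // coprimezXr.
  by exists (- a - b); rewrite GE; ring.
have nz n : admissible n y -> n != 0 by apply: admissible_neq0.
have key : symbol y (T * ((2 * a - b) * (2 * a - b)))
    = symbol y (a * (a - b)).
  apply: symbol_reciprocity => //.
  - by rewrite /admissible !coprimezMl; apply/and3P.
  - by rewrite /admissible !coprimezMl; apply/andP.
  have -> : T * ((2 * a - b) * (2 * a - b)) - a * (a - b)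
      = (3 * T - 1) * (a * (a - b)) + T * G by rewrite GE; ring.
  by apply: rpredD; [apply: dvdz_mulr|apply: dvdz_mull].
have sv : symbol y (2 * a - b) = 0.
  rewrite -(symbol_theta a v3); apply: symbol_congr; rewrite eis_mul_intE /=.
    by rewrite mulr1 subrr dvdz0.
  by rewrite -rpredN opprB mulrC dvdzz.
have sa : symbol y a = symbol omega a.
  transitivity (symbol (b%:~R * omega) a).
    apply: symbol_congr; rewrite eis_mul_intE /= ?mulr0 ?mulr1 ?subr0 ?dvdzz //.
    by rewrite subrr dvdz0.
  rewrite symbolMl ?symbol_int ?add0r ?admissible_omega //.
  by rewrite /admissible eis_norm_int coprimezMr prime3_coprimez // coprimezXr.
have sab : symbol y (a - b) = symbol omega (a - b) + symbol omega (a - b).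
  have ao := admissible_omega ab3.
  transitivity (symbol ((- a)%:~R * (omega * omega)) (a - b)).
    have -> : (- a)%:~R * (omega * omega) = Eis a a.
      by rewrite eis_mul_intE eis_mulE /=; congr Eis; ring.
    apply: symbol_congr => /=; first by rewrite subrr dvdz0.
    by rewrite -rpredN opprB dvdzz.
  rewrite !symbolMl ?symbol_int ?add0r // ?admissibleM ?ao //.
  rewrite /admissible eis_norm_int coprimezMr prime3_coprimez //.
  by rewrite coprimezXr // coprimezN.
have om : symbol omega (a - b) = symbol omega a.
  by apply: symbol_omega_congr => //; rewrite addrAC subrr sub0r rpredN.
move: key; rewrite !symbolM ?mulf_neq0 ?nz // sv !addr0 => ->.
rewrite sa sab om.
have -> : symbol omega a + (symbol omega a + symbol omega a)
  = 3 * symbol omega a by ring.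
by rewrite F3_0 mul0r.
Qed.

Lemma gcdz_split (a b : int) : a != 0 ->
  exists m c d : int, [/\ m != 0, a = c * m, b = d * m & coprimez c d].
Proof.
move=> a0; set m := gcdz a b; have m0 : m != 0 by rewrite gcdz_eq0 (negPf a0).
have [c aE] := dvdzP (dvdz_gcdl a b); have [d bE] := dvdzP (dvdz_gcdr a b).
exists m, c, d; split=> //; rewrite /coprimez; apply/eqP/(mulIf m0).
have absm : `|m|%:Z = m by [].
by rewrite mul1r -{1}absm mulz_gcdl -aE -bE.
Qed.

(** The supplementary law for 3, in the case where 3 is a cubic residue. *)
Theorem symbol_inverse3 (x : eis) (T : int) : semiprimary x ->
  (9 %| eisw x)%Z -> admissible T x -> (eis_norm x %| 3 * T - 1)%Z ->
  symbol x T = 0.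
Proof.
case: x => a b; rewrite /semiprimary /= => /andP[a3 _] b9 aT dT.
have a0 : a != 0 by apply: contraNneq a3 => ->.
have [m [c [d [m0 aE bE cop]]]] := gcdz_split b a0.
have xE : Eis a b = m%:~R * Eis c d.
  by rewrite eis_mul_intE /= aE bE; congr Eis; ring.
have m3 : ~~ (3 %| m)%Z by apply: contraNN a3; rewrite aE => ?; apply: dvdz_mull.
have c3 : ~~ (3 %| c)%Z by apply: contraNN a3; rewrite aE => ?; apply: dvdz_mulr.
have d9 : (9 %| d)%Z.
  have cop9 : coprimez 9 m.
    by rewrite -[9]/(3 ^+ 2 : int) coprimezXl // coprimez_sym prime3_coprimez.
  by rewrite -(Gauss_dvdzl d cop9) -bE.
move: aT dT; rewrite xE admissibleM => /andP[am ay] dT.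
rewrite symbolMl // symbol_int add0r; apply: symbol_inverse3_coprime => //.
by apply: dvdz_trans dT; rewrite eis_normM dvdz_mull.
Qed.

(** * Symbols attached to values of a binary form *)

Lemma eis_norm_sqrtm3 (c d : int) : eis_norm (sqrtm3 c d) = c ^+ 2 + 3 * d ^+ 2.
Proof. by rewrite /eis_norm /=; ring. Qed.

Lemma symbol_sqrtm3_dvdl (c d n : int) : ~~ (3 %| n)%Z -> (n %| c)%Z ->
  symbol (sqrtm3 c d) n = 0.
Proof.
move=> n3 nc; rewrite -(symbol_theta d n3) eis_mul_intE.
by apply: symbol_congr => /=; rewrite ?mulr1 ?addrK // mulrC subrr dvdz0.
Qed.

Lemma symbol_sqrtm3_dvdr (c d n : int) : (n %| d)%Z ->
  symbol (sqrtm3 c d) n = 0.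
Proof.
move=> nd; rewrite -(symbol_int c n) eis_intE.
apply: symbol_congr => /=; first by rewrite addrAC subrr add0r.
by rewrite subr0 dvdz_mull.
Qed.

Lemma symbol_sqrtm3_2 (c d : int) : symbol (sqrtm3 c d) 2 = 0.
Proof.
rewrite -(symbol_int (c + d) 2) eis_intE.
apply: symbol_congr => /=; first by rewrite subrr dvdz0.
by rewrite subr0 dvdz_mulr.
Qed.

Lemma symbolX (x : eis) (n : int) (k : nat) : n != 0 ->
  symbol x (n ^+ k) = symbol x n *+ k.
Proof.
move=> n0; elim: k => [|k IH]; first by rewrite expr0 symbol1.
by rewrite exprS symbolM ?expf_neq0 // IH mulrS.
Qed.

Lemma F3_mulrn3 (e : 'F_3) (k : nat) : e *+ (3 * k) = 0.
Proof. by rewrite mulrnA -[e *+ 3]mulr_natr F3_0 mulr0 mul0rn. Qed.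

Lemma symbol_sqrtm3_cube (c d h t : int) : h = 1 \/ h = 4 -> t != 0 ->
  symbol (sqrtm3 c d) (h * t ^+ 3) = 0.
Proof.
move=> hE t0; rewrite symbolM ?expf_neq0 //; last by case: hE => ->.
rewrite symbolX // -[X in _ *+ X]muln1 F3_mulrn3 addr0.
case: hE => ->; first exact: symbol1.
by rewrite -[4]/(2 * 2 : int) symbolM // symbol_sqrtm3_2 addr0.
Qed.

Lemma symbol_unit (x : eis) (n : int) : `|n|%N = 1%N -> symbol x n = 0.
Proof. by rewrite /symbol => ->; apply: (symbol1 x). Qed.

Lemma coprimez_absz1 (n : int) : `|n|%N != 1%N -> ~~ coprimez n 0.
Proof. by rewrite /coprimez gcdz0. Qed.

Lemma admissible_mul (m n : int) (x : eis) :
  admissible m x -> admissible n x -> admissible (m * n) x.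
Proof. by rewrite /admissible coprimezMl => -> ->. Qed.

Lemma admissible_exp (m : int) (k : nat) (x : eis) :
  admissible m x -> admissible (m ^+ k) x.
Proof. exact: coprimezXl. Qed.

Lemma admissibleN (m : int) (x : eis) : admissible (- m) x = admissible m x.
Proof. exact: coprimeNz. Qed.

Lemma three_part (z : int) : z != 0 ->
  exists r z1, z = 3 ^+ r * z1 /\ ~~ (3 %| z1)%Z.
Proof.
have [N] := ubnP `|z|; elim: N z => // N IH z zN z0.
have [z3|z3] := boolP (3 %| z)%Z; last by exists 0%N, z; rewrite expr0 mul1r.
have [y yE] := dvdzP z3.
have [||r [y1 [y1E y13]]] := IH y; [by lia|by lia|].
by exists r.+1, y1; rewrite yE y1E exprS; split=> //; ring.
Qed.

(** With N(x) = 3 k + 1, an inverse of 3 is - k, or N(x) - k if 3 divides k. *)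
Lemma inverse3_exists (x : eis) : semiprimary x ->
  exists T, admissible T x /\ (eis_norm x %| 3 * T - 1)%Z.
Proof.
move=> sx; have [k kE] := semiprimary_norm sx.
have gen T e : 3 * T - 1 = e * eis_norm x -> ~~ (3 %| T)%Z ->
    admissible T x /\ (eis_norm x %| 3 * T - 1)%Z.
  move=> TE T3; split; last by rewrite TE dvdz_mull.
  rewrite /admissible coprimezMr prime3_coprimez //=; apply/coprimezP.
  by exists (3, - e); rewrite /= mulNr -TE; ring.
have [k3|k3] := boolP (3 %| k)%Z.
  by exists (- k + eis_norm x); apply: (gen _ 2); rewrite kE; [ring|lia].
by exists (- k); apply: (gen _ (-1)); [rewrite kE; ring|rewrite rpredN].
Qed.

(** Multiplying n by T^e, with T inverse to 3, turns the congruence n = - 3^e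
    Z into n T^e = - Z between integers prime to 3. *)
Lemma symbol_recip_3power (x : eis) (n Z T : int) (e : nat) :
  semiprimary x -> admissible n x -> admissible Z x -> admissible T x ->
  (eis_norm x %| 3 * T - 1)%Z -> (eis_norm x %| n + 3 ^+ e * Z)%Z ->
  symbol x n + symbol x T *+ e = symbol x Z.
Proof.
move=> sx an aZ aT dT dn.
have n0 := admissible_neq0 an; have T0 := admissible_neq0 aT.
rewrite -symbolX // -symbolM ?expf_neq0 // -[RHS]symbolN.
apply: symbol_reciprocity => //.
- by apply: admissible_mul => //; apply: admissible_exp.
- by rewrite admissibleN.
have -> : n * T ^+ e - - Z
    = (n + 3 ^+ e * Z) * T ^+ e - Z * ((3 * T) ^+ e - 1).
  by rewrite exprMn; ring.
apply: rpredB; first exact: dvdz_mulr.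
by rewrite subrX1; apply: dvdz_mull; apply: dvdz_mulr.
Qed.

Lemma dvdz_addr (d m n : int) : (d %| n)%Z -> (d %| m + n)%Z = (d %| m)%Z.
Proof. exact: rpredDr. Qed.

Section FormSymbol.
Variables (P D Q X y n h t : int).
Hypotheses (QE : P ^+ 2 + 27 * D = Q) (Qcube : Q = h * t ^+ 3).
Hypotheses (hE : h = 1 \/ h = 4) (nE : n = X ^+ 2 - D * y ^+ 2).
Hypotheses (n_cop : coprimez n (3 * Q)) (yn_cop : coprimez y n).
Hypothesis n1 : `|n|%N != 1%N.

Let n3 : ~~ (3 %| n)%Z.
Proof.
apply/negP => d; have : ~~ (3%:Z %| 3 * Q)%Z := coprimez_prime n_cop (isT : prime 3) d.
by rewrite dvdz_mulr.
Qed.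

Let nQ : coprimez n Q.
Proof. by move: n_cop; rewrite coprimezMr => /andP[]. Qed.

Let y0 : y != 0.
Proof.
by apply: contraTneq yn_cop => ->; rewrite coprimez_sym coprimez_absz1.
Qed.

Let Q0 : Q != 0.
Proof. by apply: contraTneq nQ => ->; apply: coprimez_absz1. Qed.

Let t0 : t != 0.
Proof. by apply: contraNneq Q0 => e; rewrite Qcube e expr0n mulr0. Qed.

Let h3 : ~~ (3 %| h)%Z. Proof. by case: hE => ->. Qed.

(** The norm of the element is y^2 Q + 27 n, so n is congruent to - y^2 Q
    times a cube. By reciprocity the symbol at n is the symbol at y^2 Q, which
    is trivial: modulo y the element is a rational multiple of sqrt(-3), and
    modulo 2 it is a rational integer. *)
Lemma form_symbol_generic : ~~ (3 %| P)%Z -> ~~ (3 %| y)%Z ->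
  symbol (sqrtm3 (y * P) (- 3 * X)) n = 0.
Proof.
move=> P3 y3; set g := sqrtm3 _ _.
have NE : eis_norm g = y ^+ 2 * Q + 27 * n.
  by rewrite eis_norm_sqrtm3 nE -QE; ring.
have sg : semiprimary g.
  rewrite /semiprimary /=; apply/andP; split; last first.
    by rewrite mulrA [2 * _]mulrC -mulrA; apply: dvdz_mulr.
  by rewrite dvdz_addr; [rewrite (@prime_dvdzM 3) // negb_or y3|apply: dvdz_mulr].
have Q3 : ~~ (3 %| Q)%Z.
  apply: contraNN P3 => d; have : (3 %| P * P)%Z.
    have -> : P * P = Q - 3 * (9 * D) by rewrite -QE; ring.
    by rewrite rpredB // dvdz_mulr.
  by rewrite (@prime_dvdzM 3) // orbb.
have an : admissible n g.
  rewrite /admissible coprimezMr prime3_coprimez //= NE coprimezP1 //.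
  by rewrite coprimezMr nQ andbT coprimezXr // coprimez_sym.
have a27 k : ~~ (3 %| k)%Z -> coprimez k (27 * n) = coprimez k n.
  by move=> k3; rewrite coprimezMr -[27]/(3 ^+ 3 : int) coprimezXr // prime3_coprimez.
have ay : admissible y g.
  rewrite /admissible coprimezMr prime3_coprimez //= NE.
  have -> : y ^+ 2 * Q + 27 * n = 27 * n + (y * Q) * y by ring.
  by rewrite coprimezP1 // a27.
have aQ : admissible Q g.
  rewrite /admissible coprimezMr prime3_coprimez //= NE addrC.
  by rewrite coprimezP1 // a27 // coprimez_sym.
have [T [aT dT]] := inverse3_exists sg.
have T0 := admissible_neq0 aT.
have -> : symbol g n = symbol g (- (y ^+ 2 * (Q * T ^+ 3))).
  apply: symbol_reciprocity => //.
    rewrite admissibleN; apply: admissible_mul; last apply: admissible_mul => //;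
      exact: admissible_exp.
  have -> : n - - (y ^+ 2 * (Q * T ^+ 3))
    = eis_norm g * T ^+ 3 - (3 * T - 1) * (n * (9 * T ^+ 2 + 3 * T + 1)).
    by rewrite NE; ring.
  by apply: rpredB; apply: dvdz_mulr.
rewrite symbolN symbolM ?mulf_neq0 ?expf_neq0 // [symbol g (Q * _)]symbolM
  ?expf_neq0 // !symbolX //.
rewrite symbol_sqrtm3_dvdl ?dvdz_mulr // mul0rn add0r.
by rewrite -[X in _ *+ X]muln1 F3_mulrn3 addr0 Qcube symbol_sqrtm3_cube.
Qed.

(** The element need not be semiprimary, so the modulus 9 comes in; it divides
    the norm because 3 divides y. The congruence used is Q X^2 = n P^2, which
    holds because the difference is D times the norm; a common factor of P and
    X, which would spoil coprimality, is removed beforehand. *)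
Lemma form_symbol_y3 : ~~ (3 %| P)%Z -> (3 %| y)%Z ->
  symbol (sqrtm3 (y * P) (- 3 * X)) n = 0.
Proof.
move=> P3 y3.
have P0 : P != 0 by apply: contraNneq P3 => ->.
have X3 : ~~ (3 %| X)%Z.
  apply: contraNN n3 => d; rewrite nE !expr2.
  by apply: rpredB; rewrite dvdz_mull // dvdz_mull.
have Q3 : ~~ (3 %| Q)%Z.
  apply: contraNN P3 => d; have : (3 %| P * P)%Z.
    have -> : P * P = Q - 3 * (9 * D) by rewrite -QE; ring.
    by rewrite rpredB // dvdz_mulr.
  by rewrite (@prime_dvdzM 3) // orbb.
have [m [P1 [X1 [m0 PE XE cop]]]] := gcdz_split X P0.
have P13 : ~~ (3 %| P1)%Z by apply: contraNN P3; rewrite PE => ?; apply: dvdz_mulr.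
have X13 : ~~ (3 %| X1)%Z by apply: contraNN X3; rewrite XE => ?; apply: dvdz_mulr.
have m3 : ~~ (3 %| m)%Z by apply: contraNN X3; rewrite XE => ?; apply: dvdz_mull.
set g := sqrtm3 (y * P1) (- 3 * X1).
have gE : sqrtm3 (y * P) (- 3 * X) = m%:~R * g.
  by rewrite eis_mul_intE /sqrtm3 /= PE XE; congr Eis; ring.
have NE : eis_norm g = y ^+ 2 * P1 ^+ 2 + 27 * X1 ^+ 2.
  by rewrite eis_norm_sqrtm3; ring.
have mNE : m ^+ 2 * eis_norm g = y ^+ 2 * Q + 27 * n.
  by rewrite NE nE -QE PE XE; ring.
have c27 k : ~~ (3 %| k)%Z -> coprimez k 27.
  by move=> k3; rewrite -[27]/(3 ^+ 3 : int) coprimezXr // prime3_coprimez.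
have anm : coprimez n (m ^+ 2 * eis_norm g).
  rewrite mNE coprimezP1 // coprimezMr nQ andbT coprimezXr //.
  by rewrite coprimez_sym.
have aQm : coprimez Q (m ^+ 2 * eis_norm g).
  by rewrite mNE addrC coprimezP1 // coprimezMr c27 //= coprimez_sym.
rewrite coprimezMr in anm; rewrite coprimezMr in aQm.
have [am2 aNn] := andP anm; have [_ aNQ] := andP aQm.
have an : admissible n g by rewrite /admissible coprimezMr prime3_coprimez.
have aQ : admissible Q g by rewrite /admissible coprimezMr prime3_coprimez.
have aP1 : admissible P1 g.
  rewrite /admissible coprimezMr prime3_coprimez //= NE.
  have -> : y ^+ 2 * P1 ^+ 2 + 27 * X1 ^+ 2
    = 27 * X1 ^+ 2 + (y ^+ 2 * P1) * P1 by ring.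
  by rewrite coprimezP1 // coprimezMr c27 // coprimezXr.
have yX1 : coprimez y X1.
  have : coprimez y (n + D * y * y) by apply: coprimezP1.
  have -> : n + D * y * y = m ^+ 2 * X1 * X1 by rewrite nE XE; ring.
  by rewrite coprimezMr => /andP[].
have aX1 : admissible X1 g.
  rewrite /admissible coprimezMr prime3_coprimez //= NE.
  have -> : y ^+ 2 * P1 ^+ 2 + 27 * X1 ^+ 2
    = y ^+ 2 * P1 ^+ 2 + (27 * X1) * X1 by ring.
  by rewrite coprimezP1 // coprimezMr !coprimezXr // coprimez_sym.
have P10 := admissible_neq0 aP1; have X10 := admissible_neq0 aX1.
have n0 := admissible_neq0 an.
have g0 : g != 0.
  by apply: contraTneq aNn => ->; apply: coprimez_absz1.
have key : symbol g (Q * X1 ^+ 2) = symbol g (n * P1 ^+ 2).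
  have diff : Q * X1 ^+ 2 - n * P1 ^+ 2 = D * eis_norm g.
    by rewrite NE nE -QE PE XE; ring.
  apply: symbol_reciprocity9 => //.
  - by apply: admissible_mul => //; apply: admissible_exp.
  - by apply: admissible_mul => //; apply: admissible_exp.
  - by rewrite diff dvdz_mull.
  rewrite diff dvdz_mull // NE; have [z ->] := dvdzP y3.
  have -> : (z * 3) ^+ 2 * P1 ^+ 2 + 27 * X1 ^+ 2
    = 9 * (z ^+ 2 * P1 ^+ 2 + 3 * X1 ^+ 2) by ring.
  exact: dvdz_mulr.
rewrite gE symbolMl // ?symbol_int ?add0r; last first.
  by rewrite /admissible eis_norm_int coprimezMr prime3_coprimez.
move: key; rewrite symbolM ?expf_neq0 // [symbol g (n * _)]symbolM
  ?expf_neq0 // !symbolX //.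
rewrite (symbol_sqrtm3_dvdl _ P13) ?dvdz_mull // mul0rn addr0 => <-.
have -> : symbol g X1 = 0 by rewrite symbol_sqrtm3_dvdr ?dvdz_mull.
rewrite mul0rn addr0.
by rewrite Qcube symbol_sqrtm3_cube.
Qed.

(** Up to sqrt(-3) and a rational factor the element is X + 3 y P' sqrt(-3),
    of norm n + Q' y^2 with Q = 27 Q'. If 3 divides X then 9 divides the norm
    and the congruence n = - Q' y^2 holds modulo 9 as well. Otherwise the
    element is semiprimary, and the powers of 3 in Q' y^2 are either cubes or
    come from y; in the latter case 3 has trivial symbol. *)
Lemma form_symbol_27 (P' t' : int) : P = 27 * P' -> t = 3 * t' ->
  symbol (sqrtm3 (y * P) (- 3 * X)) n = 0.
Proof.
move=> PE tE; pose Q' := h * t' ^+ 3; set g := sqrtm3 X (3 * y * P').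
have gE : sqrtm3 (y * P) (- 3 * X) = (- 3)%:~R * (eis_theta * g).
  by rewrite eis_mul_intE eis_mulE /sqrtm3 /= PE; congr Eis; ring.
have QQ' : Q = 27 * Q' by rewrite Qcube tE /Q'; ring.
have DE : D = Q' - 27 * P' ^+ 2.
  apply: (@mulfI _ (27 : int)) => //.
  have -> : 27 * D = Q - P ^+ 2 by rewrite -QE; ring.
  by rewrite QQ' PE; ring.
have t'0 : t' != 0 by apply: contraNneq t0 => e; rewrite tE e mulr0.
have NE : eis_norm g = n + Q' * y ^+ 2.
  by rewrite eis_norm_sqrtm3 nE DE; ring.
have nQ' : coprimez n Q' by move: nQ; rewrite QQ' coprimezMr => /andP[].
have adm k : ~~ (3 %| k)%Z -> (k %| Q' * y ^+ 2)%Z -> coprimez k n ->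
    admissible k g.
  move=> k3 /dvdzP[z zE] kn.
  by rewrite /admissible coprimezMr prime3_coprimez //= NE zE coprimezP1.
have an : admissible n g.
  rewrite /admissible coprimezMr prime3_coprimez //= NE addrC.
  rewrite -[n in _ + n]mul1r coprimezP1 // coprimezMr nQ' coprimezXr //.
  by rewrite coprimez_sym.
have n0 := admissible_neq0 an.
have -> : symbol (sqrtm3 (y * P) (- 3 * X)) n = symbol g n.
  have at1 := admissible_theta n3.
  have a3 : admissible n (- 3)%:~R.
    rewrite /admissible eis_norm_int; have -> : 3 * (- 3) ^+ 2 = 3 ^+ 3 :> int by [].
    by rewrite coprimezXr // prime3_coprimez.
  rewrite gE !symbolMl ?admissibleM ?at1 // symbol_int add0r.
  by rewrite -[eis_theta]mul1r (symbol_theta 1) // add0r.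
have [X3|X3] := boolP (3 %| X)%Z.
  have Dy3 : ~~ (3 %| D * y)%Z.
    apply: contraNN n3 => d; rewrite nE !expr2 mulrA.
    by apply: rpredB; [apply: dvdz_mull|apply: dvdz_mulr].
  move: Dy3; rewrite (@prime_dvdzM 3) // negb_or => /andP[D3 y3].
  have Q'3 : ~~ (3 %| Q')%Z.
    apply: contraNN D3 => d; rewrite DE rpredB //.
    by rewrite -[27]/(3 * 9 : int) -mulrA dvdz_mulr.
  have Q'0 : Q' != 0 by apply: contraNneq Q'3 => ->.
  have ay : admissible y g by apply: adm => //; rewrite expr2 mulrA dvdz_mull.
  have aQ' : admissible Q' g by apply: adm => //; [apply: dvdz_mulr|rewrite coprimez_sym].
  have g0 : g != 0.
    apply: contraTneq an => e; rewrite /admissible e [eis_norm _]/= mulr0.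
    exact: coprimez_absz1.
  have -> : symbol g n = symbol g (- (Q' * y ^+ 2)).
    apply: symbol_reciprocity9 => //.
    - by rewrite admissibleN; apply: admissible_mul => //; apply: admissible_exp.
    - by rewrite opprK NE.
    rewrite opprK -NE eis_norm_sqrtm3; have [z ->] := dvdzP X3.
    have -> : (z * 3) ^+ 2 + 3 * (3 * y * P') ^+ 2
      = 9 * (z ^+ 2 + 3 * (y * P') ^+ 2) by ring.
    exact: dvdz_mulr.
  rewrite symbolN symbolM ?expf_neq0 // symbolX // symbol_sqrtm3_cube // add0r.
  by rewrite symbol_sqrtm3_dvdr ?mul0rn // -mulrA mulrCA dvdz_mulr.
have sg : semiprimary g.
  rewrite /semiprimary /=; apply/andP; split.
    by rewrite dvdz_addr // -mulrA dvdz_mulr.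
  by rewrite -mulrA mulrCA dvdz_mulr.
have [r [y1 [yE y13]]] := three_part y0.
have [s [t1 [t1E t13]]] := three_part t'0.
have y10 : y1 != 0 by apply: contraNneq y13 => ->.
have t10 : t1 != 0 by apply: contraNneq t13 => ->.
set Z := y1 ^+ 2 * (h * t1 ^+ 3).
have ZE : Q' * y ^+ 2 = 3 ^+ (2 * r + 3 * s) * Z.
  rewrite /Q' /Z t1E {1}yE exprD [(2 * r)%N]mulnC [(3 * s)%N]mulnC !exprM; ring.
have aZ : admissible Z g.
  apply: adm; last 1 first.
  - rewrite coprimezMl coprimezXl /=; last first.
      by move: yn_cop; rewrite yE coprimezMl => /andP[].
    have : coprimez Q' n by rewrite coprimez_sym.
    have -> : Q' = (3 ^+ s) ^+ 3 * (h * t1 ^+ 3) by rewrite /Q' t1E; ring.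
    by rewrite coprimezMl => /andP[].
  - by rewrite !(@prime_dvdzM 3) // !negb_or y13 t13 h3.
  by rewrite ZE dvdz_mull.
have [T [aT dT]] := inverse3_exists sg.
have := symbol_recip_3power sg an aZ aT dT (e := 2 * r + 3 * s).
rewrite -ZE -NE => /(_ (dvdzz _)).
have ZE0 : symbol g Z = 0.
  rewrite symbolM ?expf_neq0 ?mulf_neq0 ?expf_neq0 //; last by case: hE => ->.
  rewrite symbol_sqrtm3_cube // addr0 symbolX //.
  rewrite symbol_sqrtm3_dvdr ?mul0rn // yE.
  have -> : 3 * (3 ^+ r * y1) * P' = y1 * (3 * 3 ^+ r * P') by ring.
  exact: dvdz_mulr.
rewrite ZE0 mulrnDr F3_mulrn3 addr0.
case: r yE {ZE} => [|r] yE; first by rewrite muln0 mulr0n addr0.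
rewrite (symbol_inverse3 sg _ aT dT) ?mul0rn ?addr0 //= yE exprS.
have -> : 2 * (3 * (3 * 3 ^+ r * y1) * P') = 9 * (2 * (3 ^+ r * y1) * P') by ring.
exact: dvdz_mulr.
Qed.

End FormSymbol.

(** The symbol attached to a value X^2 - D y^2 prime to 3 Q is always trivial.
    Factoring such a value as a p carries the condition on a over to the prime
    p. *)
Theorem form_symbol (P D Q X y n h t : int) :
  P ^+ 2 + 27 * D = Q -> Q = h * t ^+ 3 -> h = 1 \/ h = 4 ->
  n = X ^+ 2 - D * y ^+ 2 -> coprimez n (3 * Q) -> coprimez y n ->
  ~~ (3 %| P)%Z \/ (exists P' t', P = 27 * P' /\ t = 3 * t') ->
  symbol (sqrtm3 (y * P) (- 3 * X)) n = 0.
Proof.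
move=> QE Qcube hE nE ncop yn [P3|[P' [t' [PE tE]]]];
  have [n1|n1] := eqVneq `|n|%N 1%N; try exact: symbol_unit.
  have [y3|y3] := boolP (3 %| y)%Z.
    exact: (form_symbol_y3 QE Qcube).
  exact: (form_symbol_generic QE Qcube).
exact: (form_symbol_27 QE Qcube hE nE ncop yn n1 PE tE).
Qed.

(** * Primary primes and their residue symbols *)

Lemma eis_dvdP (x y : eis) : eis_dvd x y <-> exists z, y = x * z.
Proof. by split=> -[z ->]; exists z; rewrite mulrC. Qed.

Lemma eis_mulIK (x y : eis) : x != 0 -> y * x = x -> y = 1.
Proof.
move=> x0 e; have N0 : eis_norm x != 0.
  by apply: contraNneq x0 => /eis_norm_eq0 ->.
apply: (eis_int_mulI N0); rewrite -eis_mul_conj mulr1 -{3}e; ring.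
Qed.

Lemma eis_norm_gt1 (x : eis) : eis_prime x -> 1 < eis_norm x.
Proof.
case=> x0 xu _; have := eis_norm_ge0 x.
have : eis_norm x <> 0 by move/eis_norm_eq0.
suff : eis_norm x <> 1 by lia.
move=> N1; apply: xu; exists (eis_conj x).
by rewrite mulrC eis_mul_conj N1.
Qed.

Lemma eis_primeJ (x : eis) : eis_prime x -> eis_prime (eis_conj x).
Proof.
case=> x0 xu xp; split.
- by move=> e; apply: x0; rewrite -[x]eis_conjK e.
- move=> [z zE]; apply: xu; exists (eis_conj z).
  by rewrite -[x]eis_conjK -eis_conjM -zE.
move=> y z [t tE].
have [|[u uE]|[u uE]] := xp (eis_conj y) (eis_conj z).
- by exists (eis_conj t); rewrite -eis_conjM tE eis_conjM eis_conjK.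
- by left; exists (eis_conj u); rewrite -eis_conjM -uE eis_conjK.
by right; exists (eis_conj u); rewrite -eis_conjM -uE eis_conjK.
Qed.

Lemma eis_prime_dvd_prod (x : eis) (s : seq eis) : eis_prime x ->
  eis_dvd x (\prod_(y <- s) y) -> exists2 y, y \in s & eis_dvd x y.
Proof.
move=> x_pr; elim: s => [|y s IH]; first by rewrite big_nil; case: x_pr.
rewrite big_cons; case: x_pr IH => _ _ xp IH /xp[|/IH[z zs]].
  by exists y; rewrite // mem_head.
by exists z; rewrite // in_cons zs orbT.
Qed.

Lemma eis_norm1_mod3 (x : eis) : (3 %| eisw x)%Z -> eis_norm x = 1 ->
  x = 1 \/ x = -1.
Proof.
case: x => a b; rewrite /eis_norm /= => /dvdzP[c ->] N1.
have c0 : c = 0 by nia.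
move: N1; rewrite c0 !(mul0r, mulr0, expr0n, subr0, addr0) => N1.
have : a = 1 \/ a = -1 by nia.
by case=> ->; [left|right].
Qed.

(** Associates differ by a unit; a unit congruent to 1 modulo 3 is 1. *)
Lemma eis_primary_assoc (x y : eis) : eis_prime x -> eis_prime y ->
  eis_primary x -> eis_primary y -> eis_dvd x y -> x = y.
Proof.
move=> x_pr y_pr px py [z yE].
have y0 : y != 0 by apply/eqP; case: y_pr.
have [_ xu _] := x_pr; have [_ _ yp] := y_pr.
have [|[t tE]|[t tE]] := yp z x.
- by exists 1; rewrite mul1r -yE.
- case: xu; exists t; apply/esym; apply: (eis_mulIK y0).
  by rewrite {2}yE tE; ring.
have tz : z * t = 1.
  by apply: (eis_mulIK y0); rewrite {2}yE tE mulrA.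
have Nz : eis_norm z = 1.
  have := eis_normM z t; rewrite tz -[eis_norm 1]/(1%:Z).
  have := eis_norm_ge0 z; have := eis_norm_ge0 t.
  move: (eis_norm z) (eis_norm t) => m n n0 m0 /(congr1 absz)/esym/eqP.
  by rewrite abszM muln_eq1 => /andP[/eqP m1 _]; lia.
have zE : z = 1.
  case: x z px py yE Nz {x_pr xu yp tE tz} => [a b] [u v] [/= a2 /dvdzP[e ->]].
  have [f ->] : exists f, a = 3 * f + 2 by exists (a %/ 3)%Z; lia.
  move=> [y1 yw] yE Nz; move: y1 yw; rewrite yE eis_mulE /= => h1 h2.
  have v3 : (3 %| v)%Z.
    have {h2} : (3 %| 2 * v + 3 * (u * e + v * f - v * e))%Z.
      by rewrite (_ : _ + _ = u * (e * 3) + v * (3 * f + 2) - v * (e * 3)) //; ring.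
    by move: (u * e + v * f - v * e) => k; lia.
  have u1 : (u = 1 %[mod 3])%Z.
    have {h1} : (2 * u + 3 * (u * f - v * e) = 2 %[mod 3])%Z.
      by rewrite (_ : _ + _ = u * (3 * f + 2) - v * (e * 3)) //; ring.
    by move: (u * f - v * e) => k; lia.
  by have [//|[uE _]] := @eis_norm1_mod3 (Eis u v) v3 Nz; rewrite uE in u1.
by rewrite yE zE mul1r.
Qed.

Section SplitPrime.
Variables (q : nat) (x : eis) (w : Fbar q).
Hypotheses (q_pr : prime q) (Nx : eis_norm x = q).
Hypotheses (wE : w ^+ 2 + w + 1 = 0) (xw : ev w x = 0).
Let chK := Fbar_pchar q_pr.

(** The kernel of the evaluation contains x and meets the integers in
    multiples of q, the norm of x; so x generates it. *)
Lemma split_dvd (y : eis) : eis_dvd x y <-> ev w y = 0.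
Proof.
split=> [[z ->]|yw]; first by rewrite evM // xw mulr0.
apply/eis_dvdP; apply: (eis_dvd_norm q_pr _ Nx).
rewrite -(intr_eq0p chK).
have -> : eisw (y * eis_conj x) = eisw y * eis1 x - eis1 y * eisw x.
  by rewrite eis_mulE /eis_conj /=; ring.
rewrite rmorphB !rmorphM /=; apply/eqP.
transitivity ((eisw y)%:~R * ev w x - (eisw x)%:~R * ev w y); last first.
  by rewrite xw yw !mulr0 subrr.
by rewrite /ev; ring.
Qed.

Lemma split_eis_prime : eis_prime x.
Proof.
split.
- by move=> x0; have := prime_gt0 q_pr; rewrite -ltz_nat -Nx x0.
- by move/split_dvd; rewrite -(mulr1z (1 : eis)) ev_int mulr1z => /eqP; rewrite oner_eq0.
move=> y z /split_dvd; rewrite evM // => /eqP; rewrite mulf_eq0.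
by case/orP=> /eqP e; [left|right]; apply/split_dvd.
Qed.

Lemma cubic_residue_split (a : eis) : (q %% 3 = 1)%N ->
  ~~ (q%:Z %| eis_norm a)%Z -> exists i : nat,
    cubic_residue a x = omega ^+ i /\ ev w a ^+ torus_index q = w ^+ i.
Proof.
move=> qm; rewrite -(intr_eq0p chK) -(ev_norm wE) mulf_eq0 negb_or => /andP[a0 _].
have q3 : q != 3%N by apply: contra_eq_neq qm => ->.
have kE : `|((eis_norm x - 1) %/ 3)%Z|%N = torus_index q.
  by have := torus_index1 q_pr q3 qm; rewrite Nx; lia.
have powE : (ev w a ^+ torus_index q) ^+ 3 = 1.
  apply: (mulIf a0); rewrite mul1r -exprM mulnC -exprSr -torus_index1 //.
  by rewrite (ev_frob q_pr q3 chK wE) qm.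
have [i iE] : exists i : nat, ev w a ^+ torus_index q = w ^+ i.
  have : (ev w a ^+ torus_index q - w ^+ 0) * (ev w a ^+ torus_index q - w ^+ 1)
      * (ev w a ^+ torus_index q - w ^+ 2) = 0.
    move: (_ ^+ torus_index q) powE => z z3.
    transitivity (z ^+ 3 - 1 + (w ^+ 2 + w + 1) * (z * w - z ^+ 2 - (w - 1))).
      by ring.
    by rewrite z3 wE subrr mul0r addr0.
  by move/eqP; rewrite !mulf_eq0 !subr_eq0 => /orP[/orP[]|] /eqP; eexists; eassumption.
rewrite /cubic_residue; case: asboolP => [/split_dvd e|_].
  by rewrite e eqxx in a0.
have dvd_iff j : eis_dvd x (a ^+ `|((eis_norm x - 1) %/ 3)%Z|%N - omega ^+ j)
    <-> ev w a ^+ torus_index q = w ^+ j.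
  rewrite split_dvd evB !evX // ev_omega kE.
  by split=> [/eqP|->]; rewrite ?subrr // subr_eq0 => /eqP.
case: xgetP => [z _ [j -> /dvd_iff jE]|/(_ (omega ^+ i)) H].
  by exists j.
by case: H; exists i => //; apply/dvd_iff.
Qed.

End SplitPrime.

Lemma inert_eis_dvd (q : nat) (x : eis) : prime q -> (q %% 3 = 2)%N ->
  eis_dvd q%:~R x <-> ev (cbrt1 q) x = 0.
Proof.
move=> q_pr qm; have chK := Fbar_pchar q_pr; have wE := cbrt1P q.
split=> [[z ->]|e].
  by rewrite evM // ev_int; have /eqP -> : (q%:~R : Fbar q) == 0;
    rewrite ?mulr0 // (intr_eq0p chK) dvdzz.
have [|d1 dw] := inert_dvd q_pr qm (x := x).
  by rewrite -(intr_eq0p chK) -(ev_norm wE) e mul0r.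
by apply/eis_dvdP; apply: eis_dvd_int.
Qed.

Lemma inert_eis_prime (q : nat) : prime q -> (q %% 3 = 2)%N ->
  eis_prime q%:~R.
Proof.
move=> q_pr qm; have wE := cbrt1P q; split.
- by rewrite eis_intE => -[q0]; rewrite q0 in q_pr.
- move/(inert_eis_dvd _ q_pr qm); rewrite -(mulr1z (1 : eis)) ev_int mulr1z.
  by move/eqP; rewrite oner_eq0.
move=> y z /(inert_eis_dvd _ q_pr qm); rewrite evM // => /eqP; rewrite mulf_eq0.
by case/orP=> /eqP e; [left|right]; apply/inert_eis_dvd.
Qed.

Lemma omega3 : omega ^+ 3 = 1. Proof. by []. Qed.

Lemma omega_expr_F3 (i : nat) (e : 'F_3) : e = i%:R -> omega ^+ e = omega ^+ i.
Proof. by move=> ->; rewrite F3_nat expr_mod // omega3. Qed.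

Lemma omega_exprD (e f : 'F_3) : omega ^+ e * omega ^+ f = omega ^+ (e + f)%R.
Proof.
by rewrite -exprD; apply/esym/omega_expr_F3; rewrite natrD !F3_natK.
Qed.

Lemma omega_expr_eq1 (e : 'F_3) : omega ^+ e = 1 -> e = 0.
Proof. by case: e => [[|[|[|]]]] //= i _; apply: val_inj. Qed.

(** For an inert prime the exponent (q^2 - 1)/3 is (q - 1) k, and x^(q-1) is
    conj(x) / x by Frobenius. *)
Lemma cubic_residue_inert (q : nat) (a : eis) : prime q -> (q %% 3 = 2)%N ->
  ~~ (q%:Z %| eis_norm a)%Z ->
  cubic_residue a q%:~R = omega ^+ local_symbol a q.
Proof.
move=> q_pr qm qa; have chK := Fbar_pchar q_pr; have wE := cbrt1P q.
have q3 : q != 3%N by apply: contra_eq_neq qm => ->.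
have spec := local_symbolP q_pr q3 qa; have w3 := cube_root3 wE.
have := qa; rewrite -(intr_eq0p chK) -(ev_norm wE) mulf_eq0 negb_or => /andP[A0 B0].
have q1 := prime_gt1 q_pr.
have kE : (`|((eis_norm q%:~R - 1) %/ 3)%Z| + torus_index q
    = q * torus_index q)%N.
  have := torus_index2 q_pr q3 qm; rewrite eis_norm_int.
  move: (torus_index q) => k kE; have -> : (q%:Z ^+ 2 - 1 = 3 * (q.-1 * k)%N%:Z).
    by nia.
  by rewrite mulKz // absz_nat; nia.
have dvd_iff j : eis_dvd q%:~R (a ^+ `|((eis_norm q%:~R - 1) %/ 3)%Z|%N - omega ^+ j)
    <-> ev (cbrt1 q) (eis_conj a) ^+ torus_index q
        = cbrt1 q ^+ j * ev (cbrt1 q) a ^+ torus_index q.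
  rewrite (inert_eis_dvd _ q_pr qm) evB !evX // ev_omega.
  have -> : ev (cbrt1 q) (eis_conj a) ^+ torus_index q
      = ev (cbrt1 q) a ^+ `|((eis_norm q%:~R - 1) %/ 3)%Z|%N
        * ev (cbrt1 q) a ^+ torus_index q.
    by rewrite -exprD kE exprM (ev_frob q_pr q3 chK wE) qm.
  split=> [/eqP|/(mulIf (expf_neq0 _ A0)) ->]; last by rewrite subrr.
  by rewrite subr_eq0 => /eqP ->.
rewrite /cubic_residue; case: asboolP => [/(inert_eis_dvd _ q_pr qm) e|_].
  by rewrite e eqxx in A0.
case: xgetP => [z _ [j -> /dvd_iff jE]|/(_ (omega ^+ local_symbol a q)) H].
  apply/esym/omega_expr_F3/(local_symbol_uniq q_pr q3 wE) => //.
  rewrite jE mulrA -exprD (cube_root_mod wE) (_ : (_ %% 3)%N = 0%N) ?mul1r //.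
  by rewrite -mulSnr -modnMml -addn1 -modnDml qm mul0n.
case: H; exists (local_symbol a q : nat) => //; apply/dvd_iff.
rewrite spec mulrA -exprD (cube_root_mod wE) (_ : (_ %% 3)%N = 0%N) ?mul1r //.
by rewrite addnC -mulSnr -modnMml -addn1 -modnDml qm mul0n.
Qed.

Lemma split_root_exists (q : nat) (x : eis) : prime q -> eis_norm x = q ->
  exists2 w : Fbar q, w ^+ 2 + w + 1 = 0 & ev w x = 0.
Proof.
move=> q_pr Nx; have wE := cbrt1P q.
have : ev (cbrt1 q) x * ev (cbrt1 q) (eis_conj x) = 0.
  by rewrite ev_norm // Nx; apply/eqP; rewrite (intr_eq0p (Fbar_pchar q_pr)).
move/eqP; rewrite mulf_eq0 => /orP[]/eqP e; first by exists (cbrt1 q).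
by exists (cbrt1 q ^+ 2); [apply: cube_root_sqr|rewrite ev_sqr].
Qed.

(** The symbols at x and at its conjugate are read with w and w^2; their
    product is the symbol of a at the rational prime q. *)
Lemma cubic_residue_split_pair (q : nat) (a x : eis) : prime q ->
  (q %% 3 = 1)%N -> eis_norm x = q -> ~~ (q%:Z %| eis_norm a)%Z ->
  cubic_residue a x * cubic_residue a (eis_conj x) = omega ^+ local_symbol a q.
Proof.
move=> q_pr qm Nx qa; have [w wE xw] := split_root_exists q_pr Nx.
have q3 : q != 3%N by apply: contra_eq_neq qm => ->.
have NxJ : eis_norm (eis_conj x) = q by rewrite eis_norm_conj.
have w'E := cube_root_sqr wE.
have xw' : ev (w ^+ 2) (eis_conj x) = 0 by rewrite ev_sqr // eis_conjK.
have [i [-> iE]] := cubic_residue_split q_pr Nx wE xw qm qa.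
have [j [-> jE]] := cubic_residue_split q_pr NxJ w'E xw' qm qa.
rewrite -exprD; apply/esym/omega_expr_F3/(local_symbol_uniq q_pr q3 wE) => //.
rewrite iE -ev_sqr // jE -exprM -exprD.
rewrite (cube_root_mod wE i) [RHS](cube_root_mod wE); congr (_ ^+ _).
have [d ->] : exists d, q = (3 * d + 1)%N by exists (q %/ 3)%N; lia.
have -> : ((3 * d + 1) * (i + j) + 2 * j = (d * (i + j) + j) * 3 + i)%N by ring.
by rewrite modnMDl.
Qed.

(** * Cubic Jacobi symbols with rational denominator *)

Lemma eis_prime_dvd_nat (x : eis) (n : nat) : eis_prime x -> (0 < n)%N ->
  eis_dvd x n%:~R -> exists2 q : nat, prime q & eis_dvd x q%:~R.
Proof.
move=> x_pr; have [_ xu xp] := x_pr.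
have [N] := ubnP n; elim: N n => // N IH n nN n0 xn.
have [n1|n1] := leqP n 1.
  by case: xu; move: xn; have -> : n = 1%N by lia.
have q_pr := pdiv_prime n1; set q := pdiv n in q_pr.
have [m nE] := dvdnP (pdiv_dvd n); rewrite -/q in nE.
have m0 : (0 < m)%N by case: m nE n0 => [->|].
have mN : (m < N)%N by move: nE (prime_gt1 q_pr) nN m0; nia.
have [||xq] := xp m%:~R q%:~R; last by exists q.
  by rewrite -intrM -PoszM -nE.
exact: IH.
Qed.

(** A prime dividing the rational prime q has norm q or q^2. In the second
    case it is q or - q, and - q is impossible: it would be primary only for q
    = 1 mod 3, where q factors through a Jacobi sum. *)
Lemma primary_prime_cases (x : eis) : eis_prime x -> eis_primary x ->
  (exists q : nat, [/\ prime q, (q %% 3 = 1)%N & eis_norm x = q]) \/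
  (exists q : nat, [/\ prime q, (q %% 3 = 2)%N & x = q%:~R]).
Proof.
move=> x_pr px; have N1 := eis_norm_gt1 x_pr.
have sx := eis_primary_semiprimary px; have [k kE] := semiprimary_norm sx.
have [||q q_pr [z zE]] := @eis_prime_dvd_nat x `|eis_norm x| x_pr.
- by lia.
- exists (eis_conj x); rewrite mulrC eis_mul_conj gez0_abs //; lia.
have q0 := prime_gt0 q_pr.
have NE : (q ^ 2 = `|eis_norm x| * `|eis_norm z|)%N.
  have := congr1 eis_norm zE; rewrite eis_normM eis_norm_int => /(congr1 absz).
  by rewrite abszX absz_nat abszM mulnC.
have /(dvdn_pfactor _ _ q_pr)[e e2 xE] : (`|eis_norm x| %| q ^ 2)%N.
  by rewrite NE dvdn_mulr.
have q3 : q != 3%N.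
  apply/eqP => q3; move: xE kE; rewrite q3; case: e e2 => [|e] _ h1 h2; last first.
    by move: h1; rewrite expnS; move: (3 ^ e)%N => m; lia.
  by move: h1 N1; rewrite expn0; lia.
case: e e2 xE => [|[|[|//]]] _ xE.
- by move: N1; rewrite -[eis_norm x]gez0_abs ?eis_norm_ge0 // xE.
- left; exists q; rewrite expn1 in xE; split=> //; last first.
    by rewrite -[LHS]gez0_abs ?eis_norm_ge0 // xE.
  by move: (prime_mod3 q_pr q3); lia.
have Nz : eis_norm z = 1.
  have := eis_norm_ge0 z; have : `|eis_norm z|%N = 1%N.
    by apply/eqP; rewrite -(@eqn_pmul2l (q ^ 2)) ?expn_gt0 ?q0 // muln1 -{1}xE -NE.
  lia.
have xzE : x = q%:~R * eis_conj z.
  rewrite zE -[LHS]mul1r -(mulr1z (1 : eis)) -Nz -eis_mul_conj; ring.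
have z3 : (3 %| eisw (eis_conj z))%Z.
  have : (3 %| q%:Z * eisw (eis_conj z))%Z.
    by case: px => _; rewrite xzE eis_mul_intE.
  rewrite (@prime_dvdzM 3) // => /orP[|//].
  by rewrite -[(3 %| q%:Z)%Z]/(3 %| q)%N dvdn_prime2 // eq_sym (negPf q3).
case: (eis_norm1_mod3 z3) => [|e|e]; first by rewrite eis_norm_conj.
  right; exists q; move: xzE; rewrite e mulr1 => xzE; split=> //.
  by case: px => + _; rewrite xzE eis_intE /=; lia.
have xN : x = - q%:~R by rewrite xzE e mulrN1.
have qm : (q %% 3 = 1)%N by case: px => + _; rewrite xN eis_intE eis_oppE /=; lia.
have [lam lamP] := cubic_log_exists q_pr qm.
set J := jacobi_sum lam omega.
have NJ : eis_norm J = q := jacobi_norm q_pr lamP.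
have xJ y : eis_norm y = q -> ~ eis_dvd x y.
  move=> Ny [t tE]; have := congr1 absz Ny.
  rewrite tE eis_normM abszM xE absz_nat -[RHS]muln1 mulnC expnS -mulnA => /eqP.
  rewrite eqn_pmul2l // expn1 mulnC muln_eq1 => /andP[_ /eqP q1].
  by rewrite q1 in q_pr.
have [_ _ xp] := x_pr.
have [|h|h] := xp J (eis_conj J).
- by exists (-1); rewrite eis_mul_conj NJ xN mulN1r opprK.
- by case: (xJ _ NJ h).
by case: (xJ (eis_conj J)) => //; rewrite eis_norm_conj.
Qed.

Definition primary_prime_seq (s : seq eis) :=
  forall x, x \in s -> eis_prime x /\ eis_primary x.

Lemma eis_int_factor (m n : int) (x : eis) : m != 0 ->
  n%:~R = m%:~R * x -> exists2 k, n = m * k & x = k%:~R.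
Proof.
case: x => a b m0; rewrite eis_mul_intE !eis_intE => -[nE mb].
exists a; first exact: nE.
have := esym mb; move/eqP; rewrite mulf_eq0 (negPf m0) /= => /eqP ->.
by rewrite eis_intE.
Qed.

(** As n is its own conjugate, a split prime in the factorization comes with
    its conjugate; inert primes stand alone. Removing a single inert prime or
    a conjugate pair divides n by a rational prime. *)
Lemma prod_cubic_residue_exact (a : eis) (s : seq eis) (n : int) :
  primary_prime_seq s -> n%:~R = \prod_(x <- s) x -> admissible n a ->
  \prod_(x <- s) cubic_residue a x = omega ^+ symbol a n.
Proof.
have [N] := ubnP (size s); elim: N s n => // N IH [|x s] n sN ps nE an.
  move: nE; rewrite !big_nil eis_intE => -[->].
  by rewrite symbol1.
have [x_pr px] : eis_prime x /\ eis_primary x by apply: ps; rewrite mem_head.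
have ps' : primary_prime_seq s by move=> y ys; apply: ps; rewrite in_cons ys orbT.
have n0 := admissible_neq0 an.
have factor (q : nat) (k : int) : prime q -> n = q%:Z * k ->
    [/\ k != 0, q%:Z != 0, ~~ (q%:Z %| eis_norm a)%Z & admissible k a].
  move=> q_pr nqk; have := n0; rewrite nqk mulf_eq0 negb_or => /andP[-> ->].
  split=> //; last by move: an; rewrite /admissible nqk coprimezMl => /andP[].
  have [] := @admissible_prime _ _ q an q_pr => //.
  by rewrite nqk abszM absz_nat dvdn_mulr.
case: (primary_prime_cases x_pr px) => [[q [q_pr qm Nx]]|[q [q_pr qm xE]]]; last first.
  have qz : q%:Z != 0 by rewrite eqz_nat -lt0n prime_gt0.
  move: nE; rewrite big_cons {1}xE => /(eis_int_factor qz)[k nqk sk].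
  have [k0 _ qa ak] := factor _ _ q_pr nqk.
  rewrite big_cons (IH s k) // xE cubic_residue_inert //.
  by rewrite nqk symbolM // symbol_prime // omega_exprD.
have pxJ := eis_primaryJ px; have x_prJ := eis_primeJ x_pr.
(* A primary element equal to its conjugate is rational, and has a square norm. *)
have xJx : eis_conj x <> x.
  case: x Nx {nE sN ps x_pr px pxJ x_prJ} => u v Nx [_ vE].
  have v0 : v = 0 by lia.
  have uq : (q = `|u| * `|u|)%N.
    rewrite -abszM -[LHS]absz_nat -Nx v0 /eis_norm /=; congr absz; ring.
  have /primeP[q1 /(_ `|u|%N)] := q_pr.
  rewrite {1}uq dvdn_mulr // => /(_ isT)/orP[]/eqP e; move: q1 uq; rewrite e.
    by move=> + uq; rewrite uq.
  by move=> q1 /eqP; rewrite -[X in X == _]mul1n eqn_pmul2r ?(ltnW q1) // ltn_eqF.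
have xJs : eis_conj x \in s.
  have [_ _ xJp] := x_prJ.
  have [|d|d] := xJp x (\prod_(y <- s) y).
  - exists (eis_conj (\prod_(y <- s) y)).
    rewrite [RHS]mulrC -eis_conjM; transitivity (n%:~R : eis).
      by rewrite nE big_cons.
    by rewrite -[LHS]eis_conj_int nE big_cons.
  - by case: xJx; apply: eis_primary_assoc.
  have [y ys yd] := eis_prime_dvd_prod x_prJ d.
  have [y_pr py] := ps' y ys.
  by rewrite (eis_primary_assoc x_prJ y_pr pxJ py yd).
have sperm := perm_to_rem xJs; set t := rem _ _ in sperm.
have pt : primary_prime_seq t by move=> y /mem_rem; apply: ps'.
have qz : q%:Z != 0 by rewrite eqz_nat -lt0n prime_gt0.
have : n%:~R = q%:~R * \prod_(y <- t) y.
  by rewrite nE big_cons (perm_big _ sperm) big_cons mulrA eis_mul_conj Nx.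
move/(eis_int_factor qz) => [k nqk tk].
have [k0 _ qa ak] := factor _ _ q_pr nqk.
rewrite big_cons (perm_big _ sperm) big_cons mulrA /=.
rewrite (cubic_residue_split_pair q_pr qm Nx qa) (IH t k) //; last first.
  by move: sN; rewrite /= (perm_size sperm) /= ltnS => /ltnW.
by rewrite nqk symbolM // symbol_prime // omega_exprD.
Qed.

Theorem prod_cubic_residue (a : eis) (s : seq eis) (n : int) :
  primary_prime_seq s ->
  n%:~R = \prod_(x <- s) x \/ n%:~R = - \prod_(x <- s) x ->
  admissible n a ->
  \prod_(x <- s) cubic_residue a x = omega ^+ symbol a n.
Proof.
move=> ps [nE|nE] an; first exact: prod_cubic_residue_exact.
rewrite -symbolN; apply: prod_cubic_residue_exact => //.
  by rewrite mulrNz nE opprK.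
by rewrite /admissible coprimeNz.
Qed.

Lemma cubic_jacobi_eq1 (a : eis) (n : int) : admissible n a ->
  cubic_jacobi a n%:~R = 1 -> symbol a n = 0.
Proof.
rewrite /cubic_jacobi => an; case: xgetP => [z _ [s [ps nE zE]] z1|_ /eqP].
  by apply: omega_expr_eq1; rewrite -(prod_cubic_residue ps nE an) -zE.
by rewrite eq_sym oner_eq0.
Qed.

(** A split prime is the product of a Jacobi sum and its conjugate. *)
Lemma prime_factorization (q : nat) : prime q -> q != 3%N ->
  exists2 s, primary_prime_seq s & q%:~R = \prod_(x <- s) x.
Proof.
move=> q_pr q3; case: (prime_mod3 q_pr q3) => qm; last first.
  exists [:: q%:~R]; last by rewrite big_seq1.
  move=> x; rewrite inE => /eqP ->; split; first exact: inert_eis_prime.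
  by rewrite /eis_primary eis_intE /=; split; lia.
have [lam lamP] := cubic_log_exists q_pr qm.
set J := jacobi_sum lam omega.
have NJ : eis_norm J = q := jacobi_norm q_pr lamP.
have pJ : eis_primary J := jacobi_primary q_pr qm lamP.
have [w wE Jw] := split_root_exists q_pr NJ.
have J_pr := split_eis_prime q_pr NJ wE Jw.
exists [:: J; eis_conj J]; last by rewrite big_cons big_seq1 eis_mul_conj NJ.
move=> x; rewrite !inE => /orP[]/eqP ->; split=> //.
  exact: eis_primeJ.
exact: eis_primaryJ.
Qed.

Lemma cubic_jacobi_prime (a : eis) (q : nat) : prime q ->
  admissible q%:Z a -> symbol a q%:Z = 0 -> cubic_jacobi a q%:~R = 1.
Proof.
move=> q_pr aq sq; have q3 : q != 3%N.
  by apply: contraNneq (admissible_not3 aq) => ->.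
have [s ps qE] := prime_factorization q_pr q3.
rewrite /cubic_jacobi; case: xgetP => [z _ [t [pt qtE ->]]|].
  by rewrite (prod_cubic_residue pt qtE aq) sq.
move/(_ (\prod_(x <- s) cubic_residue a x)); case.
by exists s; split=> //; left.
Qed.

(** * The cubic and its symbol at p *)

Lemma pair_by_sum_prod (F : fieldType) (A B r1 r2 m : F) :
  A + B = m * (r1 + r2) -> A * B = m ^+ 2 * (r1 * r2) ->
  (A = m * r1 /\ B = m * r2) \/ (A = m * r2 /\ B = m * r1).
Proof.
move=> sE pE; have : (A - m * r1) * (A - m * r2) = 0.
  transitivity (A ^+ 2 - A * (m * (r1 + r2)) + m ^+ 2 * (r1 * r2)); first by ring.
  by rewrite -sE -pE; ring.
have BE : B = m * (r1 + r2) - A by rewrite -sE; ring.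
move/eqP; rewrite mulf_eq0 !subr_eq0 => /orP[]/eqP AE; [left|right];
  by split=> //; rewrite BE AE; ring.
Qed.

Lemma cubic_class_symbolE (P b : int) :
  P%:~R - 3 * b%:~R * (1 + 2 * omega) = sqrtm3 P (- 3 * b).
Proof.
have -> : 1 + 2 * omega = eis_theta by [].
have -> : (3 : eis) = 3%:~R by [].
by rewrite -intrM eis_mul_intE !eis_intE eis_oppE eis_addE /=; congr Eis; ring.
Qed.

Section CubicInvariants.
Variables (a1 a2 a3 : int).
Local Notation P0 := (cubP0 a1 a2 a3).
Local Notation Q0 := (cubQ0 a1 a2).
Local Notation D0 := (cubD0 a1 a2 a3).
Local Notation P1 := (cubP1 a1 a2 a3).
Local Notation Q1 := (cubQ1 a1 a2 a3).
Local Notation D1 := (cubD1 a1 a2 a3).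

(** m is 1 when P0 is even and 2 when it is odd. *)
Lemma param_scale : exists m : int, [/\ m = 1 \/ m = 2, 2 * P1 = m * P0,
   Q1 = m ^+ 2 * Q0 & 4 * D1 = m ^+ 2 * D0].
Proof.
have DE := @cubD1_exact a1 a2 a3; have PE := @cubP1_exact a1 a2 a3.
rewrite /cubQ1; case e: (2 %| P0)%Z.
  exists 1; split; first by left.
  - by rewrite PE ?e //; ring.
  - by ring.
  by rewrite DE ?e //; ring.
exists 2; rewrite /cubP1 /cubD1 e; split; first by right.
- by ring.
- by ring.
by ring.
Qed.

Lemma param_cube : exists h, [/\ h = 1 \/ h = 4 & Q1 = h * (a1 ^+ 2 - 3 * a2) ^+ 3].
Proof.
have [m [mE _ QE _]] := param_scale; exists (m ^+ 2); split; last exact: QE.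
by case: mE => ->; [left|right].
Qed.

(** If 3 divides a1 then 27 divides P0; otherwise P0 = - 2 a1^3 modulo 3. *)
Lemma param_mod3 : ~~ (3 %| P1)%Z \/
  (exists P' t', P1 = 27 * P' /\ a1 ^+ 2 - 3 * a2 = 3 * t').
Proof.
have [m [mE PE _ _]] := param_scale.
have cop : coprimez 27 2 by [].
have [a13|a13] := boolP (3 %| a1)%Z; last first.
  left; apply: contraNN a13 => d.
  have : (3 %| 2 * m * a1 * (a1 * a1))%Z.
    have -> : 2 * m * a1 * (a1 * a1)
        = 3 * (3 * m * a1 * a2 - 9 * m * a3) - 2 * P1.
      by rewrite PE /cubP0; ring.
    by apply: rpredB; [apply: dvdz_mulr|apply: dvdz_mull].
  rewrite !(@prime_dvdzM 3) //; case: mE => -> /=; by rewrite !orbb.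
right; have [z zE] := dvdzP a13.
have : (27 %| P1 * 2)%Z.
  have -> : P1 * 2 = 27 * (m * (z * a2 - 2 * z ^+ 3 - a3)).
    by rewrite mulrC PE /cubP0 zE; ring.
  exact: dvdz_mulr.
rewrite (Gauss_dvdzl _ cop) => /dvdzP[P' P'E].
by exists P', (3 * z ^+ 2 - a2); split; [rewrite P'E mulrC|rewrite zE; ring].
Qed.

Variable p : nat.
Hypotheses (p_pr : prime p) (p_gt3 : (3 < p)%N).
Hypotheses (D0N : ~~ (p%:Z %| D0)%Z) (P0N : ~~ (p%:Z %| P0)%Z)
           (Q0N : ~~ (p%:Z %| Q0)%Z).
Local Notation K := (Fbar p).
Let chK := Fbar_pchar p_pr.
Let p3 : p != 3%N. Proof. by rewrite gtn_eqF. Qed.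

Lemma p_ndvd_small (m : nat) : (0 < m <= 3)%N -> ~~ (p%:Z %| m%:Z)%Z.
Proof.
case/andP=> m0 m3; apply/negP => /(dvdn_leq m0).
by rewrite leqNgt (leq_ltn_trans m3).
Qed.

Lemma param_ndvd : [/\ ~~ (p%:Z %| D1)%Z, ~~ (p%:Z %| P1)%Z & ~~ (p%:Z %| Q1)%Z].
Proof.
have [m [mE PE QE DE]] := param_scale.
have mN : ~~ (p%:Z %| m)%Z by case: mE => ->; apply: p_ndvd_small.
have dM := @prime_dvdzM p _ _ p_pr.
split.
- apply: contraNN D0N => d; have : (p%:Z %| m * (m * D0))%Z.
    by rewrite mulrA -expr2 -DE dvdz_mull.
  by rewrite !dM (negPf mN).
- apply: contraNN P0N => d; have : (p%:Z %| m * P0)%Z.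
    by rewrite -PE dvdz_mull.
  by rewrite !dM (negPf mN).
by rewrite QE dM negb_or Q0N andbT expr2 dM negb_or mN.
Qed.

(** Sum and product of the element and its conjugate are modulo p those of y m
    L1^3 and y m L2^3, where L1 and L2 are the Lagrange resolvents. So the
    symbol at p vanishes when the n-th powers of L1^3 and L2^3 agree. *)
Lemma splits_symbol (X y : int) : ~~ (p%:Z %| y)%Z ->
  (p%:Z %| X ^+ 2 - D1 * y ^+ 2)%Z ->
  splits_mod p a1 a2 a3 <-> symbol (sqrtm3 (y * P1) (- 3 * X)) p%:Z = 0.
Proof.
move=> yN dX; have [m [mE PE QE DE]] := param_scale.
have [D1N P1N Q1N] := param_ndvd.
have [x1 [x2 [x3 [rts frob]]]] := frobenius_roots p_pr D0N.
set w := cbrt1 p; have wE : w ^+ 2 + w + 1 = 0 := cbrt1P p.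
rewrite (splits_root_powers p_pr p_gt3 D0N P0N Q0N rts frob wE).
have PK := resolvent_cube_add rts wE; have QK := resolvent_cube_mul rts wE.
move: PK QK; move: (_ ^+ 3) => r1; move: (_ ^+ 3) => r2 PK QK.
set g := sqrtm3 _ _; pose A := ev w g; pose B := ev w (eis_conj g).
have X2 : (X%:~R : K) ^+ 2 = D1%:~R * y%:~R ^+ 2.
  apply/eqP; rewrite -subr_eq0; move: dX; rewrite -(intr_eq0p chK).
  have -> : (X ^+ 2 - D1 * y ^+ 2)%:~R
      = X%:~R ^+ 2 - D1%:~R * y%:~R ^+ 2 :> K by ring.
  by [].
have yK : (y%:~R : K) != 0 by rewrite (intr_eq0p chK).
have mK : (m%:~R : K) != 0.
  by rewrite (intr_eq0p chK); case: mE => ->; apply: p_ndvd_small.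
have K2 : (2 : K) != 0 by apply: (natr_neq0p chK); rewrite /= (ltn_trans _ p_gt3).
have sumE : A + B = y%:~R * m%:~R * (r1 + r2).
  rewrite PK -mulrA -[m%:~R * _]rmorphM /= -PE rmorphM /= /A /B (evJ wE).
  rewrite (cube_root2 wE) /ev /g /sqrtm3 /= !(rmorphD, rmorphM, rmorphN) /=.
  by ring.
have prodE : A * B = (y%:~R * m%:~R) ^+ 2 * (r1 * r2).
  rewrite /A /B (ev_norm wE) eis_norm_sqrtm3 QK.
  transitivity (y%:~R ^+ 2 * (m ^+ 2 * Q0)%:~R : K); last by ring.
  rewrite -QE -cubQ1E.
  transitivity (y%:~R ^+ 2 * P1%:~R ^+ 2 + 27 * X%:~R ^+ 2 : K); first by ring.
  by rewrite X2; ring.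
have ymK : y%:~R * m%:~R != 0 :> K by rewrite mulf_neq0.
have Ng : ~~ (p%:Z %| eis_norm g)%Z.
  rewrite -(intr_eq0p chK) -(ev_norm wE) -/A -/B prodE QK.
  by rewrite mulf_neq0 ?expf_neq0 // (intr_eq0p chK).
have symE : symbol g p%:Z = 0 <-> A ^+ torus_index p = B ^+ torus_index p.
  rewrite symbol_prime //; split=> e.
    by rewrite /A (local_symbolP p_pr p3 Ng) e muln0 mul1r.
  by rewrite /local_symbol -/w -/A -/B e eqxx.
rewrite symE; case: (pair_by_sum_prod sumE prodE) => -[-> ->];
  rewrite ![(y%:~R * m%:~R * _) ^+ _]exprMn.
  split=> [->//|]; exact: (mulfI (expf_neq0 _ ymK)).
by split=> [->//|]; move/(mulfI (expf_neq0 _ ymK)).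
Qed.

(** A square root of D1 is m/2 times the product of the differences of the
    roots; it is fixed by Frobenius. *)
Lemma splits_sqrt : splits_mod p a1 a2 a3 ->
  exists b : int, (p%:Z %| b ^+ 2 - D1)%Z.
Proof.
move=> spl; have [m [mE _ _ DE]] := param_scale.
have [x1 [x2 [x3 [rts _]]]] := frobenius_roots p_pr D0N.
have [/(_ spl)[f1 f2 f3] _] := splits_fixed p_pr rts.
have K2 : (2 : K) != 0 by apply: (natr_neq0p chK); rewrite /= (ltn_trans _ p_gt3).
pose d : K := m%:~R / 2 * ((x1 - x2) * (x2 - x3) * (x3 - x1)).
have dp : d ^+ p = d.
  rewrite /d !exprMn !(exprBp chK) f1 f2 f3 exprVn (expr_intp chK).
  by have -> : (2 : K) ^+ p = 2 by apply: (expr_intp chK 2).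
have [u uE] := fixed_Fp p_pr dp.
have D0K : (D0%:~R : K) = ((x1 - x2) * (x2 - x3) * (x3 - x1)) ^+ 2.
  have [e1 e2 e3 _] := rts.
  have -> : D0%:~R = a1%:~R ^+ 2 * a2%:~R ^+ 2 - 4 * a2%:~R ^+ 3
      - 4 * a1%:~R ^+ 3 * a3%:~R - 27 * a3%:~R ^+ 2
      + 18 * a1%:~R * a2%:~R * a3%:~R :> K by rewrite /cubD0; ring.
  by rewrite e1 e2 e3; ring.
have d2 : d ^+ 2 = D1%:~R.
  apply: (mulfI (expf_neq0 2 K2)); rewrite -exprMn /d [2 * _]mulrA.
  rewrite [2 * (_ / _)]mulrC divfK // exprMn -D0K.
  transitivity ((m ^+ 2 * D0)%:~R : K); first by ring.
  by rewrite -DE rmorphM /=; ring.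
exists (u : nat)%:Z; rewrite -(intr_eq0p chK) rmorphB rmorphXn /= -d2 uE.
by rewrite -{2}[u]natr_Zp rmorph_nat subrr.
Qed.

End CubicInvariants.

(** * Binary forms representing a prime *)

Lemma qequiv_refl (f : qform) : qequiv f f.
Proof.
exists 1, 0, 0, 1; split; first by ring.
by move=> x y; rewrite !mul1r !mul0r addr0 add0r.
Qed.

Lemma qequiv_disc (f g : qform) : qequiv f g -> qdisc g = qdisc f.
Proof.
case: f g => [a b c] [a' b' c'] [r [s [t [u [det fg]]]]].
have eA := fg 1 0; have eC := fg 0 1; have eB := fg 1 1.
move: eA eB eC; rewrite /qeval /= => eA eB eC.
have aE : a' = a * r ^+ 2 + b * r * t + c * t ^+ 2.
  by transitivity (a' * 1 ^+ 2 + b' * 1 * 0 + c' * 0 ^+ 2); [ring|rewrite eA; ring].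
have cE : c' = a * s ^+ 2 + b * s * u + c * u ^+ 2.
  by transitivity (a' * 0 ^+ 2 + b' * 0 * 1 + c' * 1 ^+ 2); [ring|rewrite eC; ring].
have bE : b' = 2 * a * r * s + b * (r * u + s * t) + 2 * c * t * u.
  transitivity ((a' * 1 ^+ 2 + b' * 1 * 1 + c' * 1 ^+ 2) - a' - c'); first by ring.
  by rewrite eB aE cE; ring.
rewrite /qdisc /= aE bE cE.
transitivity ((r * u - s * t) ^+ 2 * (b ^+ 2 - 4 * a * c)); first by ring.
by rewrite det; ring.
Qed.

Lemma qequiv_values (f g h : qform) (x y : int) : qequiv f g -> qequiv f h ->
  exists X Y, qeval h x y = qeval g X Y.
Proof.
move=> [r [s [t [u [det fg]]]]] [r' [s' [t' [u' [_ fh]]]]].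
set v1 := r' * x + s' * y; set v2 := t' * x + u' * y.
exists (u * v1 - s * v2), (- t * v1 + r * v2).
rewrite fh fg -/v1 -/v2; congr (qeval f _ _).
  transitivity ((r * u - s * t) * v1); first by rewrite det mul1r.
  by ring.
transitivity ((r * u - s * t) * v2); first by rewrite det mul1r.
by ring.
Qed.

Lemma prime_not_square_dvd (p : nat) (z : int) : prime p ->
  p%:Z = p%:Z * (p%:Z * z) -> False.
Proof.
move=> p_pr e; have p0 : p%:Z != 0 by rewrite eqz_nat -lt0n prime_gt0.
have : p%:Z * z = 1 by apply: (mulfI p0); rewrite mulr1 -e.
move/(congr1 absz)/eqP; rewrite abszM muln_eq1 => /andP[/eqP p1 _].
by rewrite absz_nat in p1; rewrite p1 in p_pr.
Qed.

Section Represented.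
Variables (P D Q a b c x y h t : int) (p : nat).
Hypotheses (p_pr : prime p) (QE : P ^+ 2 + 27 * D = Q).
Hypotheses (Qcube : Q = h * t ^+ 3) (hE : h = 1 \/ h = 4).
Hypothesis mod3 : ~~ (3 %| P)%Z \/ (exists P' t', P = 27 * P' /\ t = 3 * t').
Hypotheses (p_cop : coprimez p%:Z (3 * Q)) (a_cop : coprimez a (3 * Q)).
Hypotheses (DE : b ^+ 2 - a * c = D).
Hypothesis pE : p%:Z = a * x ^+ 2 + 2 * b * x * y + c * y ^+ 2.
Hypothesis sa : symbol (sqrtm3 P (- 3 * b)) a = 0.

Let split_cop (n : int) : coprimez n (3 * Q) -> coprimez n 3 /\ coprimez n Q.
Proof. by rewrite coprimezMr => /andP. Qed.

Let adm_class (n : int) : coprimez n (3 * Q) -> (n %| b ^+ 2 - D)%Z ->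
  admissible n (sqrtm3 P (- 3 * b)).
Proof.
move=> /split_cop[n3 nQ] /dvdzP[z zE].
rewrite /admissible coprimezMr n3 eis_norm_sqrtm3 /=.
have -> : P ^+ 2 + 3 * (- 3 * b) ^+ 2 = Q + (27 * z) * n.
  rewrite -QE; have -> : 27 * z * n = 27 * (b ^+ 2 - D) by rewrite zE; ring.
  by ring.
exact: coprimezP1.
Qed.

Let symbol_shift (n X z : int) : coprimez n (3 * Q) -> coprimez z n ->
  (n %| b ^+ 2 - D)%Z -> (n %| X - b * z)%Z ->
  symbol (sqrtm3 (z * P) (- 3 * X)) n = symbol (sqrtm3 P (- 3 * b)) n.
Proof.
move=> ncop zn nD nX; have [n3 _] := split_cop ncop.
transitivity (symbol (z%:~R * sqrtm3 P (- 3 * b)) n).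
  apply: symbol_congr; rewrite eis_mul_intE /=.
    have -> : z * P + - 3 * X - z * (P + - 3 * b) = (X - b * z) * - 3 by ring.
    exact: dvdz_mulr.
  have -> : 2 * (- 3 * X) - z * (2 * (- 3 * b)) = (X - b * z) * - 6 by ring.
  exact: dvdz_mulr.
rewrite symbolMl ?symbol_int ?add0r //; last exact: adm_class.
by rewrite /admissible eis_norm_int coprimezMr n3 coprimezXr // coprimez_sym.
Qed.

(** a p = (a x + b y)^2 - D y^2, and the symbol at a p of the corresponding
    element is trivial; modulo a this element is y times the one attached to
    b, so its symbol at p is trivial too. This needs y prime to a p, which
    fails only if p divides both a and y. In that case a/p = (X/p)^2 - D
    (y/p)^2 plays the same role: the symbol attached to b is trivial at a/p,
    hence at p. *)
Lemma represented_prime_symbol : exists X z : int,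
  [/\ ~~ (p%:Z %| z)%Z, (p%:Z %| X ^+ 2 - D * z ^+ 2)%Z
    & symbol (sqrtm3 (z * P) (- 3 * X)) p%:Z = 0].
Proof.
have dM := @prime_dvdzM p _ _ p_pr.
have [p3 pQ] := split_cop p_cop; have [a3 aQ] := split_cop a_cop.
have a0 : a != 0.
  by apply: contraTneq a_cop => ->; rewrite /coprimez gcd0z abszM eqz_nat muln_eq1.
have pz : p%:Z != 0 by rewrite eqz_nat -lt0n prime_gt0.
have [/andP[pa py]|bad] := boolP ((p%:Z %| a)%Z && (p%:Z %| y)%Z).
  have [a' aE] := dvdzP pa; have [y' yE] := dvdzP py.
  have one : 1 = a' * x ^+ 2 + 2 * b * x * y' + c * p%:Z * y' ^+ 2.
    by apply: (mulfI pz); rewrite mulr1 {1}pE aE yE; ring.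
  have a'cop : coprimez a' (3 * Q).
    by move: a_cop; rewrite aE coprimezMl => /andP[].
  have a'y' : coprimez y' a'.
    apply/coprimezP; exists (2 * b * x + c * p%:Z * y', x ^+ 2).
    by rewrite /= [RHS]one; ring.
  have a'D : (a' %| b ^+ 2 - D)%Z.
    by rewrite -DE aE; apply/dvdzP; exists (p%:Z * c); ring.
  exists b, 1; rewrite mulr1 !mul1r; split.
  - by rewrite dvdz1 absz_nat neq_ltn prime_gt1 ?orbT.
  - by rewrite -DE aE; apply/dvdzP; exists (a' * c); ring.
  have := form_symbol (n := a') (X := a' * x + b * y') (y := y') QE Qcube hE.
  rewrite symbol_shift //; last first.
    by apply/dvdzP; exists x; ring.
  move=> /(_ _ a'cop a'y' mod3) sa'.
  have a'0 : a' != 0 by apply: contraNneq a0 => e; rewrite aE e mul0r.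
  move: sa; rewrite aE symbolM // sa' ?add0r //.
  transitivity (a' * (1 : int)); first by rewrite mulr1.
  by rewrite [X in a' * X = _]one -DE aE; ring.
have co_y : coprimez y (a * p%:Z).
  apply: coprimez_primeP => q q_pr qy.
  rewrite (@prime_dvdzM q) // negb_or.
  have qp : (q%:Z %| p%:Z)%Z -> q = p.
    by rewrite -[(_ %| _)%Z]/(q %| p)%N dvdn_prime2 // => /eqP.
  have pN : ~~ (q%:Z %| p%:Z)%Z.
    apply/negP => /qp e; rewrite {}e in qy; have [y' yE] := dvdzP qy.
    have : (p%:Z %| a * (x * x))%Z.
      have -> : a * (x * x) = p%:Z - y' * p%:Z * (2 * b * x + c * y).
        by rewrite {1}pE yE; ring.
      by apply: rpredB; rewrite ?dvdzz // dvdz_mulr // dvdz_mull.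
    rewrite !dM orbb => /orP[pa|/dvdzP[x' xE]].
      by rewrite pa qy in bad.
    apply: (@prime_not_square_dvd p (a * x' ^+ 2 + 2 * b * x' * y' + c * y' ^+ 2)) => //.
    by rewrite {1}pE yE xE; ring.
  apply/andP; split=> //; apply: contraNN pN => qa.
  rewrite pE; apply: rpredD; [apply: rpredD|].
  - exact: dvdz_mulr.
  - exact: dvdz_mull.
  by rewrite expr2 mulrA dvdz_mull.
have nE : a * p%:Z = (a * x + b * y) ^+ 2 - D * y ^+ 2.
  by rewrite pE -DE; ring.
have ncop : coprimez (a * p%:Z) (3 * Q) by rewrite coprimezMl a_cop.
have := form_symbol QE Qcube hE nE ncop co_y mod3.
have [ya yp] : coprimez y a /\ coprimez y p%:Z.
  by move: co_y; rewrite coprimezMr => /andP.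
have sa' : symbol (sqrtm3 (y * P) (- 3 * (a * x + b * y))) a = 0.
  rewrite symbol_shift //.
    by rewrite -DE; apply/dvdzP; exists c; ring.
  by apply/dvdzP; exists x; ring.
rewrite symbolM // sa' add0r => s0.
exists (a * x + b * y), y; split=> //.
- by apply: (coprimez_prime (n := p%:Z)) => //; rewrite coprimez_sym.
- by rewrite -nE dvdz_mull.
Qed.

End Represented.

(** * The criteria together *)

Section ClassCriterion.
Variables (a1 a2 a3 : int) (p : nat).
Local Notation P0 := (cubP0 a1 a2 a3).
Local Notation Q0 := (cubQ0 a1 a2).
Local Notation D0 := (cubD0 a1 a2 a3).
Local Notation P1 := (cubP1 a1 a2 a3).
Local Notation Q1 := (cubQ1 a1 a2 a3).
Local Notation D1 := (cubD1 a1 a2 a3).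
Hypotheses (p_pr : prime p) (p_gt3 : (3 < p)%N).
Hypotheses (D0N : ~~ (p%:Z %| D0)%Z) (P0N : ~~ (p%:Z %| P0)%Z)
           (Q0N : ~~ (p%:Z %| Q0)%Z).

Lemma prime_coprimez (n : int) : ~~ (p%:Z %| n)%Z -> coprimez p%:Z n.
Proof. by move=> pn; rewrite coprimezE absz_nat prime_coprime. Qed.

(** The form (p, 2b, (b^2 - D1)/p) represents p and has first coefficient p. *)
Lemma splits_represented : splits_mod p a1 a2 a3 ->
  exists2 K, Gset P1 D1 Q1 K & class_represents K p%:Z.
Proof.
move=> spl; have [D1N P1N Q1N] := param_ndvd p_pr p_gt3 D0N P0N Q0N.
have p3N : ~~ (p%:Z %| 3)%Z by apply: p_ndvd_small.
have p1N : ~~ (p%:Z %| 1)%Z by apply: p_ndvd_small.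
have p2N : ~~ (p%:Z %| 2)%Z by apply: p_ndvd_small.
have dM := @prime_dvdzM p _ _ p_pr.
have [b pb] := splits_sqrt p_pr p_gt3 D0N spl; have [c cE] := dvdzP pb.
have bN : ~~ (p%:Z %| b)%Z.
  apply: contraNN D1N => d; have -> : D1 = b * b - (b ^+ 2 - D1) by ring.
  by apply: rpredB => //; apply: dvdz_mull.
pose f := QForm p%:Z (2 * b) c.
have p0 : 0 < p%:Z by rewrite ltz_nat prime_gt0.
have D1E : D1 = b ^+ 2 - p%:Z * c.
  by transitivity (b ^+ 2 - (b ^+ 2 - D1)); [ring|rewrite cE; ring].
exists (qclass f); last first.
  by exists f; [apply: qequiv_refl|exists 1, 0; rewrite /qeval /=; ring].
split.
  exists f; split=> //.
  - rewrite /qprimitive /=.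
    have /eqP -> : coprimez p%:Z (2 * b) by rewrite prime_coprimez // dM negb_or p2N.
    by rewrite gcd1z.
  - by rewrite /qdisc /= D1E; ring.
  move=> D4 x y xy; rewrite -(pmulr_rgt0 _ p0).
  have -> : p%:Z * qeval f x y = (p%:Z * x + b * y) ^+ 2 - D1 * y ^+ 2.
    by rewrite /qeval /= D1E; ring.
  have D10 : D1 < 0 by move: D4; rewrite pmulr_rlt0.
  have [y0|y0] := eqVneq y 0.
    have x0 : x != 0 by apply: contra_notN xy => /eqP ->; rewrite y0.
    rewrite y0 mulr0 addr0 expr0n mulr0 subr0 exprn_even_gt0 //=.
    by rewrite mulf_neq0 // gt_eqF.
  rewrite -mulNr ltr_wpDl ?sqr_ge0 // pmulr_rgt0 ?oppr_gt0 //.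
  by rewrite exprn_even_gt0.
exists p%:Z, b, c; split.
- exact: qequiv_refl.
- by [].
- by rewrite prime_coprimez // !dM !negb_or p3N D1N.
rewrite cubic_class_symbolE; apply: cubic_jacobi_prime => //.
  rewrite /admissible prime_coprimez // dM negb_or p3N eis_norm_sqrtm3 /=.
  have -> : P1 ^+ 2 + 3 * (- 3 * b) ^+ 2 = Q1 + 27 * (b ^+ 2 - D1).
    by rewrite -cubQ1E; ring.
  by rewrite dvdz_addr // dvdz_mull.
have /(splits_symbol p_pr p_gt3 D0N P0N Q0N p1N) : (p%:Z %| b ^+ 2 - D1 * 1 ^+ 2)%Z.
  by rewrite expr1n mulr1.
by rewrite mul1r => <-.
Qed.

Lemma represented_splits K : Gset P1 D1 Q1 K -> class_represents K p%:Z ->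
  splits_mod p a1 a2 a3.
Proof.
case=> -[f [_ fD _ ->]] [a [b [c [fg _ acop ja]]]] [g' fg' [x [y pE]]].
have [X [Y XY]] := qequiv_values x y fg fg'.
rewrite XY /qeval /= in pE.
have DE : b ^+ 2 - a * c = D1.
  apply: (@mulfI _ (4 : int)) => //; rewrite -fD -(qequiv_disc fg) /qdisc /=.
  by ring.
have [D1N P1N Q1N] := param_ndvd p_pr p_gt3 D0N P0N Q0N.
have [h [hE Qcube]] := param_cube a1 a2 a3.
have p3N : ~~ (p%:Z %| 3)%Z by apply: p_ndvd_small.
have dM := @prime_dvdzM p _ _ p_pr.
have p_cop : coprimez p%:Z (3 * Q1) by rewrite prime_coprimez // dM negb_or p3N.
have a_cop : coprimez a (3 * Q1).
  by move: acop; rewrite !coprimezMr => /andP[/andP[-> _] ->].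
rewrite cubic_class_symbolE in ja.
have adm : admissible a (sqrtm3 P1 (- 3 * b)).
  move: a_cop; rewrite /admissible !coprimezMr => /andP[-> aQ] /=.
  rewrite eis_norm_sqrtm3.
  have -> : P1 ^+ 2 + 3 * (- 3 * b) ^+ 2 = Q1 + (27 * c) * a.
    by rewrite -cubQ1E -DE; ring.
  exact: coprimezP1.
have sa := cubic_jacobi_eq1 adm ja.
have [X' [z [zN dX s0]]] := represented_prime_symbol p_pr (cubQ1E a1 a2 a3)
  Qcube hE (param_mod3 a1 a2 a3) p_cop a_cop DE pE sa.
exact/(splits_symbol p_pr p_gt3 D0N P0N Q0N zN dX).
Qed.

End ClassCriterion.

Theorem theorem1p3 (a1 a2 a3 : int) (p : nat) :
  let P0 := cubP0 a1 a2 a3 in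
  let Q0 := cubQ0 a1 a2 in
  let D0 := cubD0 a1 a2 a3 in
  let P1 := cubP1 a1 a2 a3 in
  let Q1 := cubQ1 a1 a2 a3 in
  let D1 := cubD1 a1 a2 a3 in
  prime p -> (3 < p)%N -> ~~ (p%:Z %| D0 * P0 * Q0)%Z ->
  let p3 := legendre p%:Z 3 in
  let n := `|((p%:Z - p3) %/ 3)%Z|%N in
  let i := #|[pred x : 'F_p |
               x ^+ 3 + a1%:~R * x ^+ 2 + a2%:~R * x + a3%:~R == 0]| = 3%N in
  let ii := exists2 K, Gset P1 D1 Q1 K & class_represents K p%:Z in
  let iii := (p%:Z %| cubicU a1 a2 a3 (p - 2))%Z in
  let iv := (p%:Z %| cubicU 0 (- 3 * (a1 ^+ 2 - 3 * a2))
                       (2 * a1 ^+ 3 - 9 * a1 * a2 + 27 * a3) p)%Z in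
  let v := (cubicS a1 a2 a3 p.+1 = a1 ^+ 2 - 2 * a2 %[mod p%:Z])%Z in
  let vi := (p%:Z %| lucasU P0 Q0 n)%Z in
  let vii := (lucasV P0 Q0 n =
      2 * (a1 ^+ 2 - 3 * a2) ^+ `|((1 - p3) %/ 2)%Z| %[mod p%:Z])%Z in
  let viii := rat_congr p
      (\sum_(1 <= k < (p %/ 3).+1)
          ('C(3 * k, k))%:R * (P0%:~R ^+ 2 / (27 * Q0%:~R)) ^+ k) 0 in
  let ix := (p%:Z %| cubicU 0 a2 a3 p)%Z in
  [/\ [/\ i <-> iii, i <-> iv, i <-> v, i <-> vi & i <-> vii],
      (~ exists m : int, D1 = m ^+ 2) -> (i <-> ii),
      ~~ (p%:Z %| P0 ^+ 2 - 3 * Q0)%Z -> (i <-> viii)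
    & a1 = 0 -> (i <-> ix)].
Proof.
move=> P0 Q0 D0 P1 Q1 D1 p_pr p_gt3.
have dM := @prime_dvdzM p _ _ p_pr.
rewrite dM negb_or => /andP[+ Q0N]; rewrite dM negb_or => /andP[D0N P0N].
move=> p3 n i ii iii iv v vi vii viii ix.
have [x1 [x2 [x3 [rts frob]]]] := frobenius_roots p_pr D0N.
have [w wE] := cube_root_exists (Fbar p).
split.
- split.
  + exact: (splits_cubicU p_pr p_gt3 P0N Q0N rts frob).
  + exact: (splits_cubicU_depressed p_pr p_gt3 P0N Q0N rts frob).
  + exact: (splits_cubicS p_pr Q0N rts frob).
  + exact: (splits_lucasU p_pr p_gt3 D0N P0N Q0N rts frob wE).
  exact: (splits_lucasV p_pr p_gt3 D0N P0N Q0N rts frob wE).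
- move=> _; split; first exact: splits_represented.
  by case=> K; apply: represented_splits.
- exact: (splits_binomial_sum p_pr p_gt3 D0N P0N Q0N rts frob wE).
exact: (splits_cubicU_sum0 p_pr P0N Q0N rts frob).
Qed.
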